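(* Let $p$ be a prime and $m \ge 1$ an integer. Let $\lambda_0, \lambda_1, \ldots, \lambda_m \in \mathbb{Z}$ with $\lambda_i \neq 0$ for some $i$, and let $\alpha_1, \ldots, \alpha_m \in \mathbb{Q}$ be pairwise distinct and non-zero. Let $Q>0$ be an integer such that $Q\alpha_i\in\mathbb{Z}$ for all $i=1,\ldots,m$. Assume that $M>1$, $\alpha<1$, $H>1$, $f(m,M,Q,\alpha)>1$, $$-\frac{1}{e^{R_1(m,M,Q,\alpha)}H} = \frac{-\log f(m,M,Q,\alpha)}{2^{m-1} e^{1.03883m} Q^m H \cdot \frac{M^{m+1}}{M-1} \cdot (m+1)(m+2) \alpha} \ge -\frac{1}{e},$$ and also that $$H\ge\max\left\{3,e^{R_1(m,M,Q,\alpha)}\right\}.$$ Then $$|\Lambda_p|_p>c_1(m,M,Q,\alpha)\,H^{\frac{(m+1)\log\alpha}{\log f(m,M,Q,\alpha)}+11.633\cdot\left(1+\frac{(m+1)\log\alpha}{\log f(m,M,Q,\alpha)}\right)\frac{\log\log H}{\log H}}.$$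
   Context: $|\cdot|_p$ is the $p$-adic absolute value (with $|p|_p=1/p$), $|\cdot|$ the usual absolute value. $\boldsymbol{\log}$ denotes the $p$-adic logarithm, $\boldsymbol{\log}(1+t)=\sum_{n=0}^\infty \frac{(-1)^n}{n+1}t^{n+1}$, which converges $p$-adically for $|t|_p<1$; non-bold $\log$ is the real natural logarithm. $\Lambda_p := \lambda_0+\lambda_1\boldsymbol{\log}(1+\alpha_1)+\ldots+\lambda_m\boldsymbol{\log}(1+\alpha_m)$, $M:=\max_{1\le i\le m}|\alpha_i|$, $\alpha:=\max_{1\le i\le m}|\alpha_i|_p$, $H:=\max_{0\le i\le m}|\lambda_i|$. $$f(m,M,Q,\alpha):=2^{-1}\cdot 3^{-m}e^{-1.03883m}Q^{-m}M^{-m}\alpha^{-m-1}.$$ \begin{multline*}R_1(m,M,Q,\alpha):=1.03883m+m\log Q+\log(m+1)+(m-1)\log 2+(m+1)\log M\\-\log(M-1)+\log(m+2)+\log\alpha-\log\log f(m,M,Q,\alpha),\end{multline*} $$c_1(m,M,Q,\alpha):=\frac{M-1}{6^m(m+1)e^{2.07766m}Q^{2m}M^{2m+1}}\cdot e^{\left(\frac{(m+1)\log\alpha}{\log f(m,M,Q,\alpha)}+1\right)\left(R_1(m,M,Q,\alpha)+1\right)}.$$ *)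

(* Defs.v *)
From HB Require Import structures.
From mathcomp Require Import all_boot all_order all_algebra.
From mathcomp Require Import generic_quotient ring_quotient.
From mathcomp Require Import boolp classical_sets functions reals.
From mathcomp Require Import topology normedtype sequences exp.

Set Implicit Arguments.
Unset Strict Implicit.
Unset Printing Implicit Defensive.

Import Order.TTheory GRing.Theory Num.Theory.
Import numFieldNormedType.Exports.

Local Open Scope classical_set_scope.
Local Open Scope ring_scope.

Section PadicNorm.
Variable p : nat.

Definition padic_val (x : rat) : int :=
  (logn p `|numq x|)%:Z - (logn p `|denq x|)%:Z.

(* the p-adic absolute value on rat, normalized by |p| = 1/p *)
Definition padic_norm (x : rat) : rat :=
  if x == 0 then 0 else (p%:R : rat) ^ (- padic_val x).

Lemma padic_norm0 : padic_norm 0 = 0.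
Proof. by rewrite /padic_norm eqxx. Qed.

Lemma padic_valE (a b : int) : a != 0 -> b != 0 ->
  padic_val (a%:~R / b%:~R) = (logn p `|a|)%:Z - (logn p `|b|)%:Z.
Proof.
move=> a0 b0; set x := _ / _.
have x0 : x != 0 by rewrite mulf_neq0 ?invr_neq0 ?intr_eq0.
have e : (a * denq x = numq x * b)%R.
  apply: (@intr_inj rat); rewrite !rmorphM /= [(numq x)%:~R]numqE /x.
  by rewrite mulrAC divfK ?intr_eq0.
have := congr1 (fun z : int => logn p `|z|) e.
rewrite !abszM !lognM ?absz_gt0 ?denq_neq0 ?numq_eq0 // => h.
rewrite /padic_val; apply/eqP; rewrite subr_eq addrAC eq_sym subr_eq -!PoszD.
by rewrite h.
Qed.

Hypothesis p_pr : prime p.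

Let p0 : (p%:R : rat) != 0.
Proof. by rewrite pnatr_eq0 -lt0n prime_gt0. Qed.

Let p_gt0 : (0 : rat) < p%:R.
Proof. by rewrite ltr0n prime_gt0. Qed.

Lemma padic_norm_ge0 x : 0 <= padic_norm x.
Proof. by rewrite /padic_norm; case: ifP => // _; apply/exprz_ge0/ltW. Qed.

Lemma padic_norm_eq0 x : (padic_norm x == 0) = (x == 0).
Proof.
rewrite /padic_norm; case: (eqVneq x 0) => [_|_]; first exact: eqxx.
by apply/negbTE/expfz_neq0.
Qed.

Lemma padic_norm1 : padic_norm 1 = 1.
Proof. by rewrite /padic_norm oner_eq0 /padic_val /= subrr oppr0 expr0z. Qed.

Lemma padic_valM x y : x != 0 -> y != 0 ->
  padic_val (x * y) = padic_val x + padic_val y.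
Proof.
move=> x0 y0; rewrite -{1}[x]divq_num_den -{1}[y]divq_num_den mulf_div.
rewrite -!rmorphM /= padic_valE ?mulf_neq0 ?denq_neq0 ?numq_eq0 //.
rewrite !abszM !lognM ?absz_gt0 ?denq_neq0 ?numq_eq0 //.
by rewrite !PoszD /padic_val opprD addrACA.
Qed.

Lemma padic_normM x y : padic_norm (x * y) = padic_norm x * padic_norm y.
Proof.
rewrite /padic_norm mulf_eq0; case: (eqVneq x 0) => [_|x0]; first by rewrite mul0r.
case: (eqVneq y 0) => [_|y0] /=; first by rewrite mulr0.
by rewrite padic_valM // opprD expfzDr.
Qed.

Lemma padic_normN x : padic_norm (- x) = padic_norm x.
Proof.
by rewrite /padic_norm oppr_eq0 /padic_val numqN denqN abszN.
Qed.

Let absz_val_int (k : nat) (a b : int) : (p ^ k %| `|a|)%N -> (p ^ k %| `|b|)%N ->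
  a + b != 0 -> (k <= logn p `|(a + b)%R|)%N.
Proof.
move=> ka kb ab; rewrite -pfactor_dvdn ?absz_gt0 //.
have := @dvdzE (Posz (p ^ k)) (a + b); rewrite absz_nat => <-.
by apply: rpredD; rewrite dvdzE absz_nat.
Qed.

Lemma padic_norm_ultra x y :
  padic_norm (x + y) <= Num.max (padic_norm x) (padic_norm y).
Proof.
wlog vxy : x y / (x != 0) && (y != 0) ==> (padic_val x <= padic_val y).
  move=> w; have [h|h] := leP (padic_val x) (padic_val y).
    by apply: w; rewrite h implybT.
  by rewrite addrC maxC; apply: w; rewrite (ltW h) implybT.
case: (eqVneq x 0) vxy => [->|x0]; first by rewrite add0r le_max lexx orbT.
case: (eqVneq y 0) => [->|y0] /=; first by rewrite addr0 le_max lexx.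
move=> vxy; case: (eqVneq (x + y) 0) => [->|xy0].
  by rewrite padic_norm0 le_max padic_norm_ge0.
rewrite le_max; apply/orP; left.
rewrite /padic_norm (negbTE xy0) (negbTE x0).
rewrite ler_eXz2l ?ltr1n ?prime_gt1 // lerN2.
pose a := numq x * denq y; pose b := numq y * denq x; pose d := denq x * denq y.
have a0 : a != 0 by rewrite mulf_neq0 ?denq_neq0 ?numq_eq0.
have b0 : b != 0 by rewrite mulf_neq0 ?denq_neq0 ?numq_eq0.
have d0 : d != 0 by rewrite mulf_neq0 ?denq_neq0.
have dx : (denq x)%:~R != 0 :> rat by rewrite intr_eq0 denq_neq0.
have dy : (denq y)%:~R != 0 :> rat by rewrite intr_eq0 denq_neq0.
have ex : x = a%:~R / d%:~R.
  by rewrite !rmorphM /= invfM mulrACA mulfV // mulr1 divq_num_den.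
have ey : y = b%:~R / d%:~R.
  by rewrite !rmorphM /= [_ * (denq y)%:~R]mulrC invfM mulrACA mulfV // mulr1 divq_num_den.
have exy : x + y = (a + b)%:~R / d%:~R by rewrite ex ey rmorphD /= mulrDl.
have ab0 : a + b != 0.
  by apply: contraNneq xy0 => ab; rewrite exy ab mul0r.
move: vxy; rewrite exy {1 2}ex {1}ey !padic_valE // !lerD2r !lez_nat => vxy.
apply: absz_val_int => //; rewrite pfactor_dvdn ?absz_gt0 //.
Qed.

End PadicNorm.

Section Qp.
Variables (p : nat) (p_pr : prime p).

Definition padic_cauchy (u : nat -> rat) : Prop :=
  forall e : rat, 0 < e -> exists N : nat, forall i j : nat,
    (N <= i)%N -> (N <= j)%N -> padic_norm p (u i - u j) < e.

Definition padic_null (u : nat -> rat) : Prop :=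
  forall e : rat, 0 < e -> exists N : nat, forall i : nat,
    (N <= i)%N -> padic_norm p (u i) < e.

Lemma padic_cauchy_bounded u : padic_cauchy u ->
  exists2 B, 0 < B & forall n, padic_norm p (u n) <= B.
Proof.
case/(_ 1 ltr01) => N uN.
exists (1 + \sum_(i < N.+1) padic_norm p (u i)).
  by rewrite ltr_pwDl // sumr_ge0 // => i _; apply: padic_norm_ge0.
have le_sum n : (n <= N)%N ->
    padic_norm p (u n) <= \sum_(i < N.+1) padic_norm p (u i).
  rewrite -ltnS => nN; rewrite (bigD1 (Ordinal nN)) //= lerDl.
  by rewrite sumr_ge0 // => i _; apply: padic_norm_ge0.
move=> n; have [nN|Nn] := leqP n N.
  by apply: (le_trans (le_sum _ nN)); rewrite lerDr.
rewrite -[u n](subrK (u N)).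
apply: le_trans (padic_norm_ultra p_pr _ _) _; rewrite ge_max; apply/andP; split.
  apply: (le_trans (ltW (uN _ _ (ltnW Nn) (leqnn N)))).
  by rewrite lerDl sumr_ge0 // => i _; apply: padic_norm_ge0.
by apply: (le_trans (le_sum _ (leqnn N))); rewrite lerDr.
Qed.

(* Depends on the primality proof only so that it can key the subring instance. *)
Definition cauchy_pred (_ : prime p) : {pred nat -> rat} :=
  fun u => `[< padic_cauchy u >].

Fact cauchy_pred_subring : subring_closed (cauchy_pred p_pr).
Proof.
split=> [|u v /asboolP uc /asboolP vc|u v /asboolP uc /asboolP vc]; apply/asboolP.
- by move=> e e0; exists 0%N => i j _ _; rewrite subrr padic_norm0.
- move=> e e0; have [N uN] := uc e e0; have [N' vN] := vc e e0.
  exists (maxn N N') => i j; rewrite !geq_max => /andP[iN iN'] /andP[jN jN'].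
  have -> : (u - v) i - (u - v) j = (u i - u j) + - (v i - v j).
    by change (u i - v i - (u j - v j) = u i - u j + - (v i - v j));
      rewrite !opprD addrACA.
  apply: le_lt_trans (padic_norm_ultra p_pr _ _) _.
  by rewrite gt_max padic_normN uN // vN.
- have [B B0 uB] := padic_cauchy_bounded uc.
  have [B' B'0 vB] := padic_cauchy_bounded vc.
  move=> e e0; have [N uN] := uc (e / B') (divr_gt0 e0 B'0).
  have [N' vN] := vc (e / B) (divr_gt0 e0 B0).
  exists (maxn N N') => i j; rewrite !geq_max => /andP[iN iN'] /andP[jN jN'].
  have -> : (u * v) i - (u * v) j = (u i - u j) * v i + u j * (v i - v j).
    change (u i * v i - u j * v j = (u i - u j) * v i + u j * (v i - v j)).
    by rewrite mulrBl mulrBr addrA subrK.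
  apply: le_lt_trans (padic_norm_ultra p_pr _ _) _.
  rewrite gt_max !padic_normM //; apply/andP; split.
    apply: le_lt_trans (ler_wpM2l (padic_norm_ge0 p_pr _) (vB i)) _.
    by rewrite -ltr_pdivlMr // uN.
  apply: le_lt_trans (ler_wpM2r (padic_norm_ge0 p_pr _) (uB j)) _.
  by rewrite mulrC -ltr_pdivlMr // vN.
Qed.

HB.instance Definition _ := GRing.isSubringClosed.Build (nat -> rat)
  (cauchy_pred p_pr) cauchy_pred_subring.

Record cauchy_seq := CauchySeq {
  cseq :> nat -> rat;
  cseqP : cseq \in cauchy_pred p_pr }.

HB.instance Definition _ := [isSub for cseq].
HB.instance Definition _ := [Choice of cauchy_seq by <:].
HB.instance Definition _ := [SubChoice_isSubComNzRing of cauchy_seq by <:].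

Definition null_ideal : {pred cauchy_seq} := fun u => `[< padic_null u >].

Fact null_ideal_idealr : idealr_closed null_ideal.
Proof.
split=> [||a u v /asboolP un /asboolP vn].
- by apply/asboolP => e e0; exists 0%N => i _; rewrite padic_norm0.
- apply/negP => /asboolP /(_ 1 ltr01) [N /(_ N (leqnn N))].
  by rewrite padic_norm1 ltxx.
- have [B B0 aB] := padic_cauchy_bounded (asboolW (cseqP a)).
  apply/asboolP => e e0; have [N uN] := un (e / B) (divr_gt0 e0 B0).
  have [N' vN] := vn e e0.
  exists (maxn N N') => i; rewrite geq_max => /andP[iN iN'].
  apply: le_lt_trans (padic_norm_ultra p_pr (a i * u i) (v i)) _.
  rewrite gt_max vN // andbT padic_normM //.
  apply: le_lt_trans (ler_wpM2r (padic_norm_ge0 p_pr _) (aB i)) _.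
  by rewrite mulrC -ltr_pdivlMr // uN.
Qed.

HB.instance Definition _ := isIdealr.Build cauchy_seq null_ideal null_ideal_idealr.

(* Q_p is the completion of rat for padic_norm p: Cauchy sequences modulo
   null sequences. See padic_abs_rat, Qp_dense and Qp_complete below. *)
Definition Qp : Type := {ideal_quot null_ideal}.

HB.instance Definition _ := GRing.ComNzRing.on Qp.
HB.instance Definition _ := NzRingQuotient.on Qp.

End Qp.

Section QpField.
Variables (p : nat) (p_pr : prime p).
Local Notation K := (Qp p_pr).
Local Notation pi := (\pi_K%qT : cauchy_seq p_pr -> K).

Lemma Qp_pi_surj (x : K) : exists u : cauchy_seq p_pr, x = pi u.
Proof. by exists (repr x); rewrite reprK. Qed.

Lemma Qp_pi_eq (u v : cauchy_seq p_pr) :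
  (pi u = pi v) <-> padic_null p (u - v : cauchy_seq p_pr).
Proof.
have e : ((u - v)%R \in @null_ideal p p_pr) = (pi u == pi v).
  exact: Quotient.idealrBE.
by split=> [/eqP|h]; [rewrite -e => /asboolP | apply/eqP; rewrite -e; apply/asboolP].
Qed.

Lemma Qp_pi_eq0 (u : cauchy_seq p_pr) : (pi u = 0) <-> padic_null p u.
Proof. by rewrite -[0](rmorph0 pi) Qp_pi_eq subr0. Qed.

Lemma cauchy_null_or_cst (u : nat -> rat) : padic_cauchy p u ->
  padic_null p u \/ exists N : nat, u N != 0 /\
    forall n : nat, (N <= n)%N -> padic_norm p (u n) = padic_norm p (u N).
Proof.
move=> uc; have [|nu] := EM (padic_null p u); first by left.
right; have [e e0 he] : exists2 e : rat, 0 < e & forall N : nat,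
    exists2 n : nat, (N <= n)%N & e <= padic_norm p (u n).
  apply: contrapT => h; apply: nu => e e0; apply: contrapT => h'; apply: h.
  exists e => // N; apply: contrapT => h; apply: h'; exists N => n Nn.
  by rewrite ltNge; apply/negP => le; apply: h; exists n.
have [N uN] := uc e e0; have [n Nn en] := he N.
exists n; split.
  by rewrite -(padic_norm_eq0 p_pr) gt_eqF // (lt_le_trans e0).
move=> k nk; have h := uN k n (leq_trans Nn nk) Nn.
apply/eqP; rewrite eq_le; apply/andP; split.
  rewrite -[u k](subrK (u n)); apply: le_trans (padic_norm_ultra p_pr _ _) _.
  by rewrite ge_max lexx andbT (le_trans (ltW h)).
have := padic_norm_ultra p_pr (u k) (- (u k - u n)).
rewrite subKr padic_normN // le_max => /orP[//|h'].
by have := lt_le_trans h en; rewrite ltNge h'.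
Qed.

Fact Qp_has_inv (x : K) : x != 0 -> exists y : K, y * x = 1.
Proof.
have [u ->] := Qp_pi_surj x; move=> /eqP x0.
have uc := asboolW (cseqP u).
have [un|[N [uN0 uN]]] := cauchy_null_or_cst uc; first by case: x0; apply/Qp_pi_eq0.
have uN_gt0 : 0 < padic_norm p (u N).
  by rewrite lt_neqAle eq_sym padic_norm_eq0 // uN0 padic_norm_ge0.
have u0 n : (N <= n)%N -> u n != 0.
  by move=> Nn; rewrite -(padic_norm_eq0 p_pr) uN // gt_eqF.
pose v n := (u n)^-1.
have vc : v \in cauchy_pred p_pr.
  apply/asboolP => e e0; have [M uM] := uc (e * (padic_norm p (u N) ^+ 2))
    (mulr_gt0 e0 (exprn_gt0 _ uN_gt0)).
  exists (maxn M N) => i j; rewrite !geq_max => /andP[Mi Ni] /andP[Mj Nj].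
  have ui := u0 _ Ni; have uj := u0 _ Nj.
  have -> : v i - v j = (u j - u i) / (u i * u j).
    by rewrite /v -[_^-1]div1r -[X in _ - X]div1r -mulNr addf_div // mul1r mulN1r.
  have := uM _ _ Mj Mi; rewrite padic_normM //.
  set a := padic_norm p (u j - u i).
  have -> : padic_norm p (u i * u j)^-1 = (padic_norm p (u N) ^+ 2)^-1.
    apply: (@mulfI _ (padic_norm p (u i * u j))).
      by rewrite padic_norm_eq0 // mulf_neq0.
    rewrite -padic_normM // mulfV ?mulf_neq0 // padic_norm1 padic_normM //.
    by rewrite !uN // mulfV // gt_eqF // mulr_gt0.
  by rewrite ltr_pdivrMr // exprn_gt0.
exists (pi (CauchySeq vc)); rewrite -rmorphM -(rmorph1 pi).
apply/Qp_pi_eq => e e0; exists N => i Ni.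
suff -> : (CauchySeq vc * u - 1 : cauchy_seq p_pr) i = 0 by rewrite padic_norm0.
change (v i * u i - 1 = 0).
by rewrite mulVf ?subrr ?u0.
Qed.

Definition Qp_inv (x : K) : K := xget 0 [set y | y * x = 1].

Fact Qp_mulVf (x : K) : x != 0 -> Qp_inv x * x = 1.
Proof.
move=> /Qp_has_inv [y yx]; rewrite /Qp_inv; case: xgetP => // nx.
by case: (nx y).
Qed.

Fact Qp_inv0 : Qp_inv 0 = 0.
Proof.
rewrite /Qp_inv; case: xgetP => // y _ /=.
by rewrite mulr0 => /esym/eqP; rewrite oner_eq0.
Qed.

HB.instance Definition _ := GRing.ComNzRing_isField.Build K Qp_mulVf Qp_inv0.

End QpField.

Section QpAbs.
Variables (R : realType) (p : nat) (p_pr : prime p).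
Local Notation K := (Qp p_pr).
Local Notation pi := (\pi_K%qT : cauchy_seq p_pr -> K).

(* padic_abs_pi: independent of the representative *)
Definition padic_abs (x : K) : R :=
  limn (fun n => ratr (padic_norm p (repr x n)) : R).

Definition padic_cvg (u : nat -> K) (l : K) : Prop :=
  (fun n => padic_abs (u n - l)) @ \oo --> (0 : R).

(* The sum of the series for log (1 + t) at t = x - 1, and 0 by convention
   if it diverges (it converges whenever |x - 1| < 1); see padic_logP. *)
Definition padic_log (x : K) : K :=
  xget 0 [set l | padic_cvg
    (fun N => \sum_(0 <= n < N) (-1) ^+ n / n.+1%:R * (x - 1) ^+ n.+1) l].

Lemma padic_normB_le (x y : rat) :
  `|padic_norm p x - padic_norm p y| <= padic_norm p (x - y).
Proof.
have le_add a b : padic_norm p a <= padic_norm p (a - b) + padic_norm p b.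
  rewrite -{1}[a](subrK b); apply: le_trans (padic_norm_ultra p_pr _ _) _.
  by rewrite ge_max lerDl lerDr !padic_norm_ge0.
rewrite ler_norml lerBlDr le_add andbT lerBrDl lerBlDr addrC.
by rewrite -[padic_norm p (x - y)]padic_normN opprB le_add.
Qed.

Lemma padic_null_cvg (u : nat -> rat) : padic_null p u <->
  (fun n => ratr (padic_norm p (u n)) : R) @ \oo --> (0 : R).
Proof.
split=> [un|/cvgrPdist_lt h e e0].
  apply/cvgrPdist_lt => e e0; have [k ke] : exists k : nat, k.+1%:R^-1 < e.
    by exists (Num.bound e^-1); rewrite invf_plt ?posrE //;
       apply: lt_trans (archi_boundP _) _; rewrite ?ltr_nat // invr_ge0 ltW.
  have [|N uN] := un (k.+1%:R^-1); first by rewrite invr_gt0.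
  exists N => // n /= Nn; rewrite sub0r normrN ger0_norm; last first.
    by rewrite ler0q padic_norm_ge0.
  apply: lt_trans ke; rewrite -[_^-1](_ : ratr (k.+1%:R^-1) = _).
    by rewrite ltr_rat uN.
  by rewrite fmorphV rmorph_nat.
have [|N _ hN] := h (ratr e); first by rewrite ltr0q.
exists N => n Nn; have := hN n Nn.
by rewrite /= sub0r normrN ger0_norm ?ler0q ?padic_norm_ge0 // ltr_rat.
Qed.

Lemma padic_cauchy_cvg (u : nat -> rat) : padic_cauchy p u ->
  cvgn (fun n => ratr (padic_norm p (u n)) : R).
Proof.
move=> uc; case: (cauchy_null_or_cst p_pr uc) => [/padic_null_cvg|[N [_ uN]]].
  by move=> h; apply/cvg_ex; exists 0.
apply/cvg_ex; exists (ratr (padic_norm p (u N))); apply: cvg_near_cst.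
by exists N => // n /= Nn; rewrite uN.
Qed.

Lemma padic_abs_pi (u : cauchy_seq p_pr) :
  (fun n => ratr (padic_norm p (u n)) : R) @ \oo --> padic_abs (pi u).
Proof.
set w := repr (pi u).
have uw : padic_null p (w - u : cauchy_seq p_pr) by apply/Qp_pi_eq; rewrite reprK.
have d0 : (fun n => ratr (padic_norm p (w n)) - ratr (padic_norm p (u n)) : R)
    @ \oo --> (0 : R).
  apply/norm_cvg0P; apply: squeeze_cvgr (cvg_cst 0) ((padic_null_cvg _).1 uw).
  near=> n; rewrite normr_ge0 /= -rmorphB /= -ratr_norm ler_rat.
  exact: padic_normB_le.
have wc : cvgn (fun n => ratr (padic_norm p (w n)) : R).
  exact: padic_cauchy_cvg (asboolW (cseqP w)).
have -> : (fun n => ratr (padic_norm p (u n)) : R) =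
    (fun n => ratr (padic_norm p (w n)) -
      (ratr (padic_norm p (w n)) - ratr (padic_norm p (u n)))).
  by apply/funext => n; rewrite subKr.
by rewrite -[padic_abs _]subr0; exact: cvgB wc d0.
Unshelve. all: by end_near. Qed.

Fact cst_cauchy (x : rat) : (fun=> x) \in cauchy_pred p_pr.
Proof.
by apply/asboolP => e e0; exists 0%N => i j _ _; rewrite subrr padic_norm0.
Qed.

Lemma pi_cst (x : rat) : pi (CauchySeq (cst_cauchy x)) = ratr x.
Proof.
pose c y := pi (CauchySeq (cst_cauchy y)).
have cB : zmod_morphism c.
  by move=> y z; rewrite /c -rmorphB; congr pi; apply/val_inj.
have cM : monoid_morphism c.
  split; first by rewrite /c -(rmorph1 pi); congr pi; apply/val_inj.
  by move=> y z; rewrite /c -rmorphM; congr pi; apply/val_inj.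
pose cm := GRing.isZmodMorphism.Build _ _ c cB.
pose cm' := GRing.isMonoidMorphism.Build _ _ c cM.
pose f : {rmorphism rat -> K} := HB.pack c cm cm'.
by rewrite -[LHS]/(f x) -(fmorph_eq_rat f).
Qed.

Lemma padic_abs_rat (x : rat) : padic_abs (ratr x) = ratr (padic_norm p x).
Proof.
have := @padic_abs_pi (CauchySeq (cst_cauchy x)); rewrite pi_cst => h.
apply: (cvg_unique _ h) => //=; exact: (@cvg_cst R).
Qed.

Lemma padic_abs0 : padic_abs 0 = 0.
Proof.
by have := padic_abs_rat 0; rewrite padic_norm0 -[0 : rat]/(0%:~R) !ratr_int.
Qed.

Lemma padic_abs_ge0 (x : K) : 0 <= padic_abs x.
Proof.
have [u ->] := Qp_pi_surj x; have h := @padic_abs_pi u.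
rewrite -(cvg_lim _ h) //; apply: limr_ge; first exact: cvgP h.
by near=> n; rewrite ler0q padic_norm_ge0.
Unshelve. all: by end_near. Qed.

Lemma padic_abs_eq0 (x : K) : (padic_abs x == 0) = (x == 0).
Proof.
apply/eqP/eqP => [|->]; last exact: padic_abs0.
have [u ->] := Qp_pi_surj x => h; apply/Qp_pi_eq0/padic_null_cvg.
by rewrite -h; exact: padic_abs_pi.
Qed.

Lemma padic_absM (x y : K) : padic_abs (x * y) = padic_abs x * padic_abs y.
Proof.
have [u ->] := Qp_pi_surj x; have [v ->] := Qp_pi_surj y.
have h := cvgM (@padic_abs_pi u) (@padic_abs_pi v).
rewrite -rmorphM -(cvg_lim _ (h _)) // -(cvg_lim _ (@padic_abs_pi (u * v))) //.
congr (limn _); apply/funext => n /=.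
by rewrite -[LHS]/(ratr (padic_norm p (u n * v n))) padic_normM // rmorphM.
Qed.

Lemma padic_abs_ultra (x y : K) :
  padic_abs (x + y) <= Num.max (padic_abs x) (padic_abs y).
Proof.
have [u ->] := Qp_pi_surj x; have [v ->] := Qp_pi_surj y.
rewrite -rmorphD /=.
apply/ler_addgt0Pr => e e0.
have /cvgrPdist_lt/(_ _ e0) hu := @padic_abs_pi u.
have /cvgrPdist_lt/(_ _ e0) hv := @padic_abs_pi v.
have h := @padic_abs_pi (u + v); rewrite -(cvg_lim _ h) //.
apply: limr_le; first exact: cvgP h.
near=> n.
have := padic_norm_ultra p_pr (u n) (v n); rewrite -(ler_rat R) => /le_trans; apply.
have hun : ratr (padic_norm p (u n)) <= padic_abs (pi u) + e.
  by apply/ler_distlCDr/ltW; near: n.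
have hvn : ratr (padic_norm p (v n)) <= padic_abs (pi v) + e.
  by apply/ler_distlCDr/ltW; near: n.
rewrite maxEle; case: ifP => _.
  by apply: (le_trans hvn); rewrite lerD2r le_max lexx orbT.
by apply: (le_trans hun); rewrite lerD2r le_max lexx.
Unshelve. all: by end_near. Qed.

Lemma padic_absN (x : K) : padic_abs (- x) = padic_abs x.
Proof.
have e : (-1 : K) = ratr (-1 : rat) by rewrite -[-1 : rat]/((-1)%:~R) ratr_int.
by rewrite -mulN1r padic_absM e padic_abs_rat padic_normN padic_norm1 rmorph1 mul1r.
Qed.

Lemma padic_cvg_unique (u : nat -> K) (l l' : K) :
  padic_cvg u l -> padic_cvg u l' -> l = l'.
Proof.
move=> ul ul'; apply/eqP; rewrite -subr_eq0 -padic_abs_eq0 eq_le padic_abs_ge0 andbT.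
have := cvgD ul ul'; rewrite addr0 => /(_ _) h; rewrite -(cvg_lim _ h) //.
apply: limr_ge; first exact: cvgP h.
near=> n; rewrite -[l - l'](subrKA (u n)) -[l - u n]opprB addrC /=.
apply: le_trans (padic_abs_ultra _ _) _.
by rewrite padic_absN ge_max lerDl lerDr !padic_abs_ge0.
Unshelve. all: by end_near. Qed.

Lemma padic_logP (x : K) (l : K) :
  padic_cvg (fun N => \sum_(0 <= n < N) (-1) ^+ n / n.+1%:R * (x - 1) ^+ n.+1) l ->
  padic_log x = l.
Proof.
move=> h; rewrite /padic_log; case: xgetP => [l' _ h'|/(_ l)//].
exact: padic_cvg_unique h' h.
Qed.

Lemma Qp_dense (x : K) (e : R) : 0 < e ->
  exists q : rat, padic_abs (x - ratr q) < e.
Proof.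
move=> e0; have [u ->] := Qp_pi_surj x.
have [q q0 qe] : exists2 q : rat, 0 < q & ratr q < e.
  have [k ke] : exists k : nat, k.+1%:R^-1 < e.
    exists (Num.bound e^-1); rewrite invf_plt ?posrE //.
    by apply: lt_trans (archi_boundP _) _; rewrite ?ltr_nat // invr_ge0 ltW.
  by exists (k.+1%:R^-1); rewrite ?invr_gt0 // fmorphV rmorph_nat.
have [N uN] := asboolW (cseqP u) q q0.
exists (u N); rewrite -pi_cst -rmorphB /=; apply: le_lt_trans qe.
have h := @padic_abs_pi (u - CauchySeq (cst_cauchy (u N))).
rewrite -(cvg_lim _ h) //; apply: limr_le; first exact: cvgP h.
near=> n; rewrite ler_rat ltW //.
by apply: uN => //; near: n; exact: nbhs_infty_ge.
Unshelve. all: by end_near. Qed.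

Theorem Qp_complete (u : nat -> K) :
  (forall e : R, 0 < e -> exists N : nat, forall i j : nat,
    (N <= i)%N -> (N <= j)%N -> padic_abs (u i - u j) < e) ->
  exists l : K, padic_cvg u l.
Proof.
move=> uc.
have /choice[r rP] (n : nat) : exists q : rat, padic_abs (u n - ratr q) < n.+1%:R^-1.
  by apply: Qp_dense; rewrite invr_gt0.
have small (e : R) : 0 < e -> exists N : nat, forall n : nat, (N <= n)%N -> n.+1%:R^-1 < e.
  move=> e0; exists (Num.bound e^-1) => n Nn; rewrite invf_plt ?posrE //.
  by apply: lt_trans (archi_boundP _) _; rewrite ?ltr_nat // invr_ge0 ltW.
have lt3 (a b c e : K) (d : R) : padic_abs (b - a) < d -> padic_abs (b - c) < d ->
    padic_abs (c - e) < d -> padic_abs (a - e) < d.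
  move=> ab bc ce; rewrite -(subrKA b a (- e)) -(subrKA c b (- e)).
  apply: le_lt_trans (padic_abs_ultra _ _) _; rewrite gt_max -padic_absN opprB ab /=.
  by apply: le_lt_trans (padic_abs_ultra _ _) _; rewrite gt_max bc.
have rc : r \in cauchy_pred p_pr.
  apply/asboolP => e e0; have e0' : (0 : R) < ratr e by rewrite ltr0q.
  have [N uN] := uc _ e0'; have [M rM] := small _ e0'.
  exists (maxn N M) => i j; rewrite !geq_max => /andP[Ni Mi] /andP[Nj Mj].
  rewrite -(ltr_rat R) -padic_abs_rat -pi_cst.
  have -> : pi (CauchySeq (cst_cauchy (r i - r j))) = ratr (r i) - ratr (r j).
    by rewrite -!pi_cst -rmorphB; congr pi; apply/val_inj.
  apply: (@lt3 _ (u i) (u j)); last 1 first.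
  - exact: lt_trans (rP j) (rM _ Mj).
  - exact: lt_trans (rP i) (rM _ Mi).
  - exact: uN.
exists (pi (CauchySeq rc)); apply/cvgrPdist_lt => e e0.
have e20 : 0 < e / 2 by rewrite divr_gt0.
have [N uN] := uc _ e20; have [M rM] := small _ e20.
near=> n; rewrite sub0r normrN ger0_norm ?padic_abs_ge0 //.
apply: (@le_lt_trans _ _ (e / 2)); last by rewrite ltr_pdivrMr // ltr_pMr // ltr1n.
have [q q0 qe] : exists2 q : rat, 0 < q & ratr q < e / 2.
  have [k ke] := small _ e20.
  by exists (k.+1%:R^-1); rewrite ?invr_gt0 // fmorphV rmorph_nat ke.
have [N' rN'] := asboolW rc q q0.
have h : padic_abs (ratr (r (maxn n N')) - pi (CauchySeq rc)) <= e / 2.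
  rewrite -pi_cst -rmorphB /=.
  have h := @padic_abs_pi (CauchySeq (cst_cauchy (r (maxn n N'))) - CauchySeq rc).
  rewrite -(cvg_lim _ h) //; apply: limr_le; first exact: cvgP h.
  near=> k; apply: le_trans (ltW qe); rewrite ler_rat ltW //.
  apply: rN'; first exact: leq_maxr.
  by near: k; exact: nbhs_infty_ge.
rewrite -(subrKA (u (maxn n N'))); apply: le_trans (padic_abs_ultra _ _) _.
have Nn : (N <= n)%N by near: n; exact: nbhs_infty_ge.
have Mn : (M <= n)%N by near: n; exact: nbhs_infty_ge.
rewrite ge_max ltW /=; last by apply: uN => //; exact: leq_trans (leq_maxl _ _).
rewrite -(subrKA (ratr (r (maxn n N')))); apply: le_trans (padic_abs_ultra _ _) _.
rewrite ge_max h andbT ltW //; apply: lt_trans (rP _) _.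
by apply: rM; exact: leq_trans (leq_maxl _ _).
Unshelve. all: by end_near. Qed.

End QpAbs.

Section Constants.
Variable R : realType.
Implicit Types (m : nat) (M Q a : R).

(* 1.03883, 2.07766 and 11.633, written with small numerals because large
   literals are unary *)
Definition cst1 : R := 1 + 3883 / 10 ^+ 5.

Definition cst2 : R := 2 + 7766 / 10 ^+ 5.

Definition cst3 : R := 11 + 633 / 10 ^+ 3.

Definition f m M Q a : R :=
  2^-1 * 3 ^- m * expR (- (cst1 * m%:R)) * Q ^- m * M ^- m * a ^- m.+1.

Definition R1 m M Q a : R :=
  cst1 * m%:R + m%:R * ln Q + ln (m%:R + 1) + (m%:R - 1) * ln 2
  + (m%:R + 1) * ln M - ln (M - 1) + ln (m%:R + 2) + ln a - ln (ln (f m M Q a)).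

Definition c1 m M Q a : R :=
  (M - 1) /
    (6 ^+ m * (m%:R + 1) * expR (cst2 * m%:R) * Q ^+ (2 * m) * M ^+ (2 * m + 1))
  * expR (((m%:R + 1) * ln a / ln (f m M Q a) + 1) * (R1 m M Q a + 1)).

(* The default value 0 of the maxima is harmless: the entries are nonnegative
   and there is at least one of them (0 < m for the first two). *)
Definition max_abs m (alpha : 'I_m -> rat) : R :=
  \big[Num.max/0]_(i < m) ratr `|alpha i|.

Definition max_padic_norm (p : nat) m (alpha : 'I_m -> rat) : R :=
  \big[Num.max/0]_(i < m) ratr (padic_norm p (alpha i)).

Definition height m (lam : 'I_m.+1 -> int) : R :=
  \big[Num.max/0]_(i < m.+1) `|lam i|%:~R.

(* lam ord0 is the constant term; lam (lift ord0 i) goes with alpha i *)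
Definition Lambda (p : nat) (p_pr : prime p) m
    (lam : 'I_m.+1 -> int) (alpha : 'I_m -> rat) : Qp p_pr :=
  (lam ord0)%:~R
  + \sum_(i < m) (lam (lift ord0 i))%:~R * padic_log R (1 + ratr (alpha i)).

End Constants.

(* Main.v *)
(* Fix a degree parameter l and let G be the l-th divided derivative of
   X^l q prod_j (X - alpha_j)^l, with deg q <= m.  Integration by parts l times shows
   that the moments int_0^alpha_j X^n G vanish for n < l and are p-adically at most
   about alpha^((m+1) l) otherwise.  Write G = G(-1) + (1 + X) K and integrate G / (1 + X),
   expanding 1 / (1 + X) as a power series: G(-1) log (1 + alpha_j) + int_0^alpha_j K is
   the alternating sum of the moments, hence small, a simultaneous Pade approximation.
   If G(-1) and all the integrals vanish, then the (l+1)-fold primitive of K vanishes to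
   order l + 1 at 0 and at every alpha_j, which are too many zeros for its degree; so
   q = 0.  Hence for some q = X^mu the number lambda_0 G(-1) -
   sum_j lambda_j int_0^alpha_j K is nonzero; it is rational, its denominator divides
   lcm(1, .., m l + m) Q^(m l + m), and the size of its numerator bounds its p-adic
   value from below.  When l is the least integer with
     l log f >= R_1 + 1 + log H + 11.633 log log H,
   the remainder is p-adically smaller, and the bound passes to the linear form.

   The inequality lcm(1, .., n) <= e^(1.03883 n) follows by Chebyshev's method: an
   explicit combination of the log floor(n/d)! with total weight 0 bounds psi n in terms
   of some psi (n/k), which starts an induction from the values n < 2^14. *)

(* Raising l by one multiplies the archimedean bound on the numerator by S = 2 * 3^m e^(1.03883 m)
   Q^m M^m and the p-adic remainder by alpha^(m+1), up to a factor linear in l. Since f = 1 / (S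
   alpha^(m+1)), the hypothesis f > 1 says that the remainder wins this race. In S, the 2 comes from
   the binomial coefficients of the divided derivative, 3^m from sum_i C(m l, i) 2^i = 3^(m l), M^m
   from the coefficients of prod_j (X - alpha_j)^l, and e^(1.03883 m) Q^m from the denominators. The
   factor linear in l bounds the p-adic size of the 1 / k produced by integration; the term 11.633
   log log H pays for it. With E = (m+1) log alpha / log f one has log S / log f = -(1 + E), whence
   the exponent of H: the coefficients lambda_i contribute H^(-1) to the lower bound, and S^(-l)
   contributes H^(1 + E). All integrals are values of polynomial primitives over the rationals; the
   p-adic logarithm enters only as the limit of its partial sums. *)
Require Import Defs.
From HB Require Import structures.
From Stdlib Require Import ZArith.
From mathcomp Require Import all_boot all_order all_algebra.
From mathcomp Require Import ssrZ zify ring lra.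
From mathcomp Require Import boolp reals interval_inference.
From mathcomp Require Import normedtype sequences derive realfun exp.

Set Implicit Arguments.
Unset Strict Implicit.
Unset Printing Implicit Defensive.

Import Order.TTheory GRing.Theory Num.Theory.
Import numFieldNormedType.Exports.

Local Open Scope ring_scope.

(* ssrint reserves the delimiter %Z for int. *)
Delimit Scope Z_scope with ZZ.

(** * Bounds for logarithms and factorials *)

Section LogBounds.
Variable R : realType.
Implicit Types x y z t a b : R.

Lemma le_derive_ge0 (f df : R -> R) a b : a <= b ->
  (forall x, a <= x <= b -> is_derive x 1 f (df x)) ->
  (forall x, a <= x <= b -> 0 <= df x) -> f a <= f b.
Proof.
move=> ab fd df0; have [||c cab e] := @MVT_segment R f df a b ab.
- by move=> x; rewrite in_itv /= => /andP[/ltW ax /ltW xb]; apply: fd; rewrite ax.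
- apply: derivable_within_continuous => x; rewrite in_itv /= => xab.
  by have [] := fd x xab.
- by rewrite -subr_ge0 e mulr_ge0 ?subr_ge0 ?df0 //; move: cab; rewrite in_itv.
Qed.

Lemma is_derive_ln1D t : -1 < t -> is_derive t 1 (fun u => ln (1 + u)) (1 + t)^-1.
Proof.
move=> t1; have p1 : 0 < 1 + t by lra.
have d := is_derive1_ln p1.
suff d1 : is_derive t 1 (fun u => 1 + u) (1:R).
  by have := is_derive1_comp d d1; rewrite mulr1.
by apply: is_derive_eq; rewrite add0r mulr1.
Qed.

Lemma is_derive_ln1B t : t < 1 -> is_derive t 1 (fun u => ln (1 - u)) (- (1 - t)^-1).
Proof.
move=> t1; have p1 : 0 < 1 - t by lra.
have d := is_derive1_ln p1.
suff d1 : is_derive t 1 (fun u => 1 - u) (-1:R).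
  by have := @is_derive1_comp R (@ln R) (fun u => 1 - u) _ _ _ d d1; rewrite mulrN1.
by apply: is_derive_eq; ring.
Qed.

(** The series 2 (z + z^3 / 3 + z^5 / 5 + ...) is truncated; the difference of the two sides has
    derivative 2 t^4 / (1 - t^2). *)
Lemma ln_atanh_ge z : 0 <= z < 1 -> 2 * z + 2 / 3 * z ^+ 3 <= ln ((1 + z) / (1 - z)).
Proof.
move=> /andP[z0 z1].
pose g t : R := ln (1 + t) - ln (1 - t) - (2 * t + 2 / 3 * t ^+ 3).
suff: g 0 <= g z.
  rewrite /g addr0 subr0 ln1 expr0n /= !mulr0 addr0 !subr0 subr_ge0 ln_div //;
    rewrite posrE; lra.
apply: (@le_derive_ge0 g (fun t => (1 + t)^-1 + (1 - t)^-1 - (2 + 2 * t ^+ 2)))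
    => // t /andP[t0 tz].
  have d1 := @is_derive_ln1D t (lt_le_trans (ltrN10 _) t0).
  have d2 := @is_derive_ln1B t (le_lt_trans tz z1).
  have n1 : 1 + t != 0 by rewrite gt_eqF //; lra.
  have n2 : 1 - t != 0 by rewrite gt_eqF //; lra.
  by apply: is_derive_eq; rewrite /= /GRing.scale /=; field; rewrite n1 n2.
have p1 : 0 < 1 + t by lra.
have p2 : 0 < 1 - t by lra.
have -> : (1 + t)^-1 + (1 - t)^-1 - (2 + 2 * t ^+ 2) = 2 * t ^+ 4 / ((1 + t) * (1 - t)).
  by field; rewrite !gt_eqF.
by rewrite divr_ge0 ?mulr_ge0 ?exprn_ge0 // ltW.
Qed.

(** The coefficient 1/2 in place of 2/5 covers the tail of the series: the difference has derivative
    t^4 (1 - 5 t^2) / (2 (1 - t^2)), and t^2 <= 4/25 on this range. *)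
Lemma ln_atanh_le z : 0 <= z <= 2 / 5 ->
  ln ((1 + z) / (1 - z)) <= 2 * z + 2 / 3 * z ^+ 3 + z ^+ 5 / 2.
Proof.
move=> /andP[z0 z1].
pose g t : R := (2 * t + 2 / 3 * t ^+ 3 + t ^+ 5 / 2) - (ln (1 + t) - ln (1 - t)).
suff: g 0 <= g z.
  rewrite /g addr0 subr0 ln1 !expr0n /= !(mulr0, mul0r) !addr0 !subr0 subr_ge0 ln_div //;
    rewrite posrE; lra.
apply: (@le_derive_ge0 g (fun t : R => 2 + 2 * t ^+ 2 + 5 / 2 * t ^+ 4
   - ((1 + t)^-1 + (1 - t)^-1)) _ _ z0) => t /andP[t0 tz].
  have d1 := @is_derive_ln1D t (lt_le_trans (ltrN10 _) t0).
  have t1 : t < 1 by lra.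
  have d2 := @is_derive_ln1B t t1.
  have n1 : 1 + t != 0 by rewrite gt_eqF //; lra.
  have n2 : 1 - t != 0 by rewrite gt_eqF //; lra.
  apply: is_derive_eq; rewrite /= /GRing.scale /=.
  set a := (1 + t)^-1; set b := (1 - t)^-1.
  by field.
have p1 : 0 < 1 + t by lra.
have p2 : 0 < 1 - t by lra.
have -> : 2 + 2 * t ^+ 2 + 5 / 2 * t ^+ 4 - ((1 + t)^-1 + (1 - t)^-1)
    = t ^+ 4 / 2 * (1 - 5 * t ^+ 2) / ((1 + t) * (1 - t)).
  by field; rewrite !gt_eqF.
have t2 : t ^+ 2 <= (2 / 5) ^+ 2 by rewrite lerXn2r ?nnegrE //; lra.
apply: divr_ge0; last by rewrite ltW // mulr_gt0.
by apply: mulr_ge0; [rewrite divr_ge0 ?exprn_ge0 | lra].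
Qed.

(** One step of Stirling's formula. With z = 1 / (2 x + 1), (x + 1) / x = (1 + z) / (1 - z) and x +
    1/2 = 1 / (2 z); the upper bound is a difference so that it telescopes. *)
Lemma ln_succ_bounds x : 1 <= x ->
  0 <= (x + 1 / 2) * (ln (x + 1) - ln x) - 1 <= 13 / 144 * (x^-1 - (x + 1)^-1).
Proof.
move=> x1; have x0 : 0 < x by lra.
have n0 : x != 0 by rewrite gt_eqF.
have n1 : x + 1 != 0 by rewrite gt_eqF //; lra.
have n2 : 2 * x + 1 != 0 by rewrite gt_eqF //; lra.
pose z := (2 * x + 1)^-1.
have z0 : 0 < z by rewrite invr_gt0; lra.
have z1 : z <= 1 / 3 by rewrite /z -[leRHS]invrK lef_pV2 ?posrE; lra.
have e : (1 + z) / (1 - z) = (x + 1) / x.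
  by rewrite /z; field; rewrite n0 n2 /=; apply/eqP; lra.
have ex : x + 1 / 2 = (2 * z)^-1 by rewrite /z; field; rewrite n2.
have := @ln_atanh_ge z; have := @ln_atanh_le z.
rewrite e ln_div ?posrE //; last by lra.
set L := ln _ - _ => /(_ ltac:(lra)) hu /(_ ltac:(lra)) hl.
have zn : z != 0 by rewrite gt_eqF.
rewrite ex; apply/andP; split.
  have : (2 * z)^-1 * (2 * z + 2 / 3 * z ^+ 3) <= (2 * z)^-1 * L.
    by rewrite ler_pM2l ?invr_gt0 //; lra.
  have -> : (2 * z)^-1 * (2 * z + 2 / 3 * z ^+ 3) = 1 + z ^+ 2 / 3 by field.
  by have := exprn_ge0 2 (ltW z0); lra.
have : (2 * z)^-1 * L <= (2 * z)^-1 * (2 * z + 2 / 3 * z ^+ 3 + z ^+ 5 / 2).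
  by rewrite ler_pM2l ?invr_gt0 //; lra.
have -> : (2 * z)^-1 * (2 * z + 2 / 3 * z ^+ 3 + z ^+ 5 / 2) =
   1 + z ^+ 2 * (1 / 3 + z ^+ 2 / 4) by field.
have z2 : z ^+ 2 <= (1 / 3) ^+ 2 by rewrite lerXn2r ?nnegrE //; lra.
have z3 : z ^+ 2 <= (x^-1 - (x + 1)^-1) / 4.
  have -> : (x^-1 - (x + 1)^-1) / 4 = (4 * x * (x + 1))^-1 by field; rewrite n0 n1.
  rewrite /z exprVn lef_pV2 ?posrE ?exprn_gt0 ?mulr_gt0 //; try lra.
(* 13/36 = 1/3 + (1/3)^2 / 4, and 13/144 is a quarter of it. *)
have : z ^+ 2 * (1 / 3 + z ^+ 2 / 4) <= z ^+ 2 * (13 / 36).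
  by rewrite ler_pM2l ?exprn_gt0 //; lra.
lra.
Qed.

(** The defects of [ln_succ_bounds] add up to at most 13/144 (1 - 1/n), and 1 - 13/144 > 9/10. *)
Lemma ln_fact_bounds n : (0 < n)%N ->
  (n%:R + 1 / 2) * ln n%:R - n%:R + 9 / 10 <= ln (n`!%:R : R) <=
  (n%:R + 1 / 2) * ln n%:R - n%:R + 1.
Proof.
move=> n0; suff /andP[h1 h2] :
  (n%:R + 1 / 2) * ln n%:R - n%:R + 1 - 13 / 144 * (1 - n%:R^-1)
    <= ln (n`!%:R : R) <= (n%:R + 1 / 2) * ln n%:R - n%:R + 1.
  have : 0 <= n%:R^-1 :> R by rewrite invr_ge0.
  by move=> ?; apply/andP; split=> //; lra.
elim: n n0 => // -[_ _|n /(_ isT) IH _].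
  by rewrite (_ : 1`!%N = 1%N) // ln1 invr1; lra.
rewrite factS natrM lnM ?posrE ?ltr0n ?fact_gt0 //.
have := @ln_succ_bounds n.+1%:R; rewrite ler1n natr1 => /(_ isT); move: IH.
set a := n.+1%:R^-1; set b := n.+2%:R^-1.
have -> : n.+2%:R = n.+1%:R + 1 :> R by rewrite natr1.
set l := ln _`!%:R; set x := n.+1%:R => /andP[h1 h2] /andP[h3 h4].
by apply/andP; split; lra.
Qed.

Lemma ge1_ln_geV t : 1 <= t -> 1 - t^-1 <= ln t.
Proof.
move=> t1; have t0 : 0 < t by lra.
rewrite -[in ln t](invrK t) lnV ?posrE ?invr_gt0 //.
rewrite -[in ln t^-1](subrK 1 t^-1) [_ - 1 + 1]addrC.
have : ln (1 + (t^-1 - 1)) <= t^-1 - 1.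
  have : 0 < t^-1 by rewrite invr_gt0.
  by move=> ?; apply: le_ln1Dx; lra.
by lra.
Qed.

(** As N <= x <= N + 1, monotonicity in the real argument gives the upper bound from N!, and the
    lower one from ln N! = ln (N + 1)! - ln (N + 1). *)
Lemma ln_fact_divn_bounds n d (x := n%:R / d%:R : R) :
  (0 < d)%N -> (2 * d <= n)%N ->
  x * ln x - x - 1 / 2 * ln x + 9 / 10 <= ln ((n %/ d)`!%:R : R) <=
  x * ln x - x + 1 / 2 * ln x + 1.
Proof.
move=> d0 dn; set N := (n %/ d)%N.
have N0 : (0 < N)%N by rewrite divn_gt0 //; lia.
have dp : 0 < d%:R :> R by rewrite ltr0n.
have Nx : N%:R <= x by rewrite ler_pdivlMr // -natrM ler_nat leq_trunc_div.
have xN : x <= N%:R + 1.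
  by rewrite ler_pdivrMr // natr1 -natrM ler_nat ltnW // ltn_ceil.
have x2 : 2 <= x by rewrite ler_pdivlMr // -natrM ler_nat.
have N1 : 1 <= N%:R :> R by rewrite ler1n.
apply/andP; split.
  have /andP[h _] := ln_fact_bounds (ltn0Sn N).
  move: h; rewrite factS natrM lnM ?posrE ?ltr0n ?fact_gt0 // -natr1 => h.
  suff : x * ln x - x - 1 / 2 * ln x <=
     (N%:R + 1) * ln (N%:R + 1) - (N%:R + 1) - 1 / 2 * ln (N%:R + 1) by lra.
  apply: (@le_derive_ge0 (fun t : R => t * ln t - t - 1 / 2 * ln t)
    (fun t => ln t - 1 / 2 * t^-1) _ _ xN) => t /andP[t0 _].
    have tp : 0 < t by lra.
    have d1 := is_derive1_ln tp.
    apply: is_derive_eq; rewrite /= /GRing.scale /=; field; by rewrite gt_eqF.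
  have t1 : 1 <= t by lra.
  have := ge1_ln_geV t1.
  have : t^-1 <= 1 / 2 by rewrite -[leRHS]invrK lef_pV2 ?posrE; lra.
  lra.
have /andP[_ h] := ln_fact_bounds N0.
suff : N%:R * ln N%:R - N%:R + 1 / 2 * ln N%:R <= x * ln x - x + 1 / 2 * ln x by lra.
apply: (@le_derive_ge0 (fun t : R => t * ln t - t + 1 / 2 * ln t)
    (fun t => ln t + 1 / 2 * t^-1) _ _ Nx) => t /andP[t0 _].
  have tp : 0 < t by lra.
  have d1 := is_derive1_ln tp.
  apply: is_derive_eq; rewrite /= /GRing.scale /=; field; by rewrite gt_eqF.
by rewrite addr_ge0 ?ln_ge0 ?mulr_ge0 ?invr_ge0 //; lra.
Qed.

End LogBounds.

(** * Least common multiples *)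

(** The exponential of the von Mangoldt function: p at the powers p^k with k >= 1, and 1
    elsewhere. *)
Definition mangoldt_base (n : nat) : nat :=
  if n == (pdiv n ^ logn (pdiv n) n)%N then pdiv n else 1%N.

(** Equal to lcm(1, .., n), in the form whose logarithm is Chebyshev's psi. *)
Definition lcm_upto (n : nat) : nat := (\prod_(1 <= j < n.+1) mangoldt_base j)%N.

Lemma pdiv_pfactor p k : prime p -> pdiv (p ^ k.+1) = p.
Proof.
move=> pp; have : prime (pdiv (p ^ k.+1)).
  by rewrite pdiv_prime // -(exp1n k.+1) ltn_exp2r // prime_gt1.
have := pdiv_dvd (p ^ k.+1) => /[swap] qp.
by rewrite Euclid_dvdX // dvdn_prime2 // => /andP[/eqP].
Qed.

Lemma mangoldt_base_pfactor p k : prime p -> mangoldt_base (p ^ k.+1) = p.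
Proof. by move=> pp; rewrite /mangoldt_base pdiv_pfactor // pfactorK // eqxx. Qed.

Lemma mangoldt_base_gt0 n : (0 < mangoldt_base n)%N.
Proof. by rewrite /mangoldt_base; case: ifP => // _; exact: pdiv_gt0. Qed.

Lemma mangoldt_base_eq p n : prime p -> (p %| mangoldt_base n)%N ->
  mangoldt_base n = p /\ exists k, n = (p ^ k.+1)%N.
Proof.
move=> pp; rewrite /mangoldt_base; case: ifP => [/eqP e|_]; last first.
  by rewrite dvdn1 => /eqP p1; rewrite p1 in pp.
have [n1|n1] := leqP n 1.
  have -> : pdiv n = 1%N by case: n n1 {e} => [|[]].
  by rewrite dvdn1 => /eqP p1; rewrite p1 in pp.
rewrite dvdn_prime2 ?pdiv_prime // => /eqP ep; split=> //.
case: (logn _ n) e => [e|k e]; first by rewrite e in n1.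
by exists k; rewrite ep.
Qed.

Lemma logn_mangoldt_base p n : prime p ->
  logn p (mangoldt_base n) = (n == p ^ logn p n)%N && (0 < logn p n)%N :> nat.
Proof.
move=> pp; have [pd|pd] := boolP (p %| mangoldt_base n)%N.
  have [-> [k ->]] := mangoldt_base_eq pp pd.
  by rewrite pfactorK // eqxx -{2}(expn1 p) pfactorK.
have -> : logn p (mangoldt_base n) = 0%N.
  by apply/eqP; rewrite -leqn0 leqNgt logn_gt0 mem_primes pp mangoldt_base_gt0.
case: eqP => //= e; case: (logn p n) e => // k e.
by case/negP: pd; rewrite e mangoldt_base_pfactor.
Qed.

Lemma logn_mangoldt_base_sum p n j : prime p -> (0 < j <= n)%N ->
  logn p (mangoldt_base j) = (\sum_(1 <= k < n.+1) (j == p ^ k))%N.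
Proof.
move=> pp /andP[j0 jn]; rewrite logn_mangoldt_base //.
under [RHS]eq_bigr => k _.
  rewrite (_ : (j == p ^ k)%N = (j == p ^ logn p j)%N && (k == logn p j)); first over.
  apply/eqP/andP => [->|[/eqP -> /eqP ->]]; last by rewrite pfactorK.
  by rewrite pfactorK // !eqxx.
under [RHS]eq_bigr do rewrite -mulnb.
rewrite -big_distrr /= -mulnb; congr (_ * _)%N.
under [RHS]eq_bigr do rewrite -[nat_of_bool _]muln1 mulnbl.
rewrite -big_mkcond /= big_nat1_eq ltnS.
by case: (posnP (logn p j)) => //= _; rewrite (leq_trans (ltnW (ltn_logl _ j0))).
Qed.

Lemma sum_logn_mangoldt p n (F : nat -> nat) : prime p ->
  (\sum_(1 <= j < n.+1) logn p (mangoldt_base j) * F j =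
   \sum_(1 <= k < n.+1 | p ^ k <= n) F (p ^ k))%N.
Proof.
move=> pp.
under eq_big_nat => j /andP[j0 jn] do
  rewrite (@logn_mangoldt_base_sum p n) // ?j0 // big_distrl /=.
rewrite exchange_big /= [RHS]big_mkcond; apply: eq_bigr => k _.
under eq_bigr do rewrite mulnbl.
by rewrite -big_mkcond /= big_nat1_eq ltnS expn_gt0 prime_gt0.
Qed.

Lemma logn_prod_mangoldt p n (F : nat -> nat) : prime p ->
  logn p (\prod_(1 <= j < n.+1) mangoldt_base j ^ F j) =
  (\sum_(1 <= k < n.+1 | p ^ k <= n) F (p ^ k))%N.
Proof.
move=> pp; rewrite -sum_logn_mangoldt //.
suff [_ //] : (0 < \prod_(1 <= j < n.+1) mangoldt_base j ^ F j)%N /\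
  logn p (\prod_(1 <= j < n.+1) mangoldt_base j ^ F j) =
  (\sum_(1 <= j < n.+1) logn p (mangoldt_base j) * F j)%N.
elim/big_rec2: _ => [|j x y _ [y0 <-]]; first by rewrite logn1.
have m0 : (0 < mangoldt_base j ^ F j)%N by rewrite expn_gt0 mangoldt_base_gt0.
by rewrite muln_gt0 m0 y0 lognM // lognX mulnC.
Qed.

(** Legendre's formula: p has exponent sum_k floor(n / p^k) on both sides. *)
Lemma fact_mangoldt n :
  n`! = (\prod_(1 <= j < n.+1) mangoldt_base j ^ (n %/ j))%N.
Proof.
apply: eqn_from_log => [||p]; first exact: fact_gt0.
  by apply: prodn_gt0 => j; rewrite expn_gt0 mangoldt_base_gt0.
have [pp|npp] := boolP (prime p); last by rewrite /logn (negbTE npp).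
rewrite logn_fact // logn_prod_mangoldt // [RHS]big_mkcond.
by apply: eq_bigr => k _; case: leqP => // h; rewrite divn_small.
Qed.

Lemma lcm_upto_gt0 n : (0 < lcm_upto n)%N.
Proof. by apply: prodn_gt0 => j; exact: mangoldt_base_gt0. Qed.

(** A prime p contributes once for each power p^i <= n with i >= 1, and every i up to the valuation
    of k qualifies. *)
Lemma dvdn_lcm_upto k n : (0 < k <= n)%N -> (k %| lcm_upto n)%N.
Proof.
move=> /andP[k0 kn]; apply/dvdn_partP => // p.
rewrite mem_primes => /and3P[pp _ _]; rewrite p_part pfactor_dvdn ?lcm_upto_gt0 //.
rewrite /lcm_upto; under eq_bigr do rewrite -[mangoldt_base _]expn1.
rewrite (@logn_prod_mangoldt p n (fun=> 1%N)) //.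
have ek : (p ^ logn p k <= n)%N.
  by apply: leq_trans kn; apply: dvdn_leq => //; exact: pfactor_dvdnn.
have en : (logn p k <= n)%N by rewrite (leq_trans _ kn) // ltnW // ltn_logl.
rewrite (@big_cat_nat _ _ _ (logn p k).+1) //= [X in (X + _)%N]big_nat_cond.
rewrite (eq_bigl (fun i => 1 <= i < (logn p k).+1)%N); last first.
  move=> i; case: (boolP (1 <= i < (logn p k).+1)%N) => //= /andP[_].
  by rewrite ltnS => ie; rewrite (leq_trans _ ek) // leq_pexp2l ?prime_gt0.
by rewrite -big_nat sum_nat_const_nat subn1 muln1 leq_addr.
Qed.

(** * Chebyshev's psi and weighted sums of log factorials *)

Section Chebyshev.
Variable R : realType.

Definition psi (n : nat) : R := ln (lcm_upto n)%:R.

Lemma psiE n : psi n = \sum_(1 <= j < n.+1) ln (mangoldt_base j)%:R.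
Proof.
rewrite /psi /lcm_upto; suff [_ //] : (0 < \prod_(1 <= j < n.+1) mangoldt_base j)%N /\
  ln (\prod_(1 <= j < n.+1) mangoldt_base j)%N%:R =
    \sum_(1 <= j < n.+1) ln (mangoldt_base j)%:R :> R.
elim/big_rec2: _ => [|j x y _ [y0 <-]]; first by rewrite ln1.
have m0 := mangoldt_base_gt0 j.
by rewrite muln_gt0 m0 y0 natrM lnM ?posrE ?ltr0n.
Qed.

Lemma ln_mangoldt_ge0 j : 0 <= ln (mangoldt_base j)%:R :> R.
Proof. by rewrite ln_ge0 // ler1n mangoldt_base_gt0. Qed.

Lemma psi_widen n m : (m <= n)%N ->
  psi m = \sum_(1 <= j < n.+1) ln (mangoldt_base j)%:R * (j <= m)%N%:R.
Proof.
move=> mn; rewrite psiE [RHS](@big_cat_nat _ _ _ m.+1) //=.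
rewrite [X in _ + X]big_nat_cond [X in _ + X]big1 ?addr0; last first.
  by move=> j /andP[/andP[mj _] _]; rewrite leqNgt mj mulr0.
by apply: eq_big_nat => j /andP[_]; rewrite ltnS => ->; rewrite mulr1.
Qed.

Lemma ln_fact_mangoldt n N : (n <= N)%N ->
  ln (n`!%:R : R) = \sum_(1 <= j < N.+1) ln (mangoldt_base j)%:R * (n %/ j)%:R.
Proof.
move=> nN; transitivity (\sum_(1 <= j < n.+1) ln (mangoldt_base j)%:R * (n %/ j)%:R : R).
  rewrite fact_mangoldt.
  suff [_ //] : (0 < \prod_(1 <= j < n.+1) mangoldt_base j ^ (n %/ j))%N /\
    ln (\prod_(1 <= j < n.+1) mangoldt_base j ^ (n %/ j))%N%:R =
    \sum_(1 <= j < n.+1) ln (mangoldt_base j)%:R * (n %/ j)%:R :> R.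
  elim/big_rec2: _ => [|j x y _ [y0 <-]]; first by rewrite ln1.
  have m0 := mangoldt_base_gt0 j.
  by rewrite muln_gt0 expn_gt0 m0 y0 natrM lnM ?posrE ?ltr0n ?expn_gt0 ?m0 //
    natrX lnXn ?ltr0n // mulr_natr.
rewrite [RHS](@big_cat_nat _ _ _ n.+1) //=.
rewrite [X in _ + X]big_nat_cond [X in _ + X]big1 ?addr0 //.
by move=> j /andP[/andP[nj _] _]; rewrite divn_small // mulr0.
Qed.

(* The factorials are summed against prime powers: each condition at y compares the
   coefficients of [ln (mangoldt_base j)] for the j with n %/ j = y. *)
Lemma chebyshev_scheme (b w : seq (nat * R)) n :
  (forall y : nat, (0 < y)%N ->
    1 <= \sum_(p <- b) p.2 * (y %/ p.1)%:R + \sum_(p <- w) p.2 * (p.1 <= y)%N%:R) ->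
  (forall p, p \in b -> 0 < p.1)%N -> (forall p, p \in w -> 0 < p.1)%N ->
  psi n <= \sum_(p <- b) p.2 * ln ((n %/ p.1)`!%:R) + \sum_(p <- w) p.2 * psi (n %/ p.1).
Proof.
move=> h b0 w0.
have -> : \sum_(p <- b) p.2 * ln ((n %/ p.1)`!%:R) =
    \sum_(1 <= j < n.+1) \sum_(p <- b) ln (mangoldt_base j)%:R * (p.2 * (n %/ j %/ p.1)%:R).
  rewrite exchange_big /=; apply: eq_big_seq => p pb.
  rewrite (@ln_fact_mangoldt _ n) ?leq_div // big_distrr /=.
  by apply: eq_bigr => j _; rewrite mulrCA -!divnMA mulnC.
have -> : \sum_(p <- w) p.2 * psi (n %/ p.1) =
    \sum_(1 <= j < n.+1) \sum_(p <- w) ln (mangoldt_base j)%:R * (p.2 * (p.1 <= n %/ j)%N%:R).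
  rewrite exchange_big /=; apply: eq_big_seq => p pw.
  rewrite (@psi_widen n) ?leq_div // big_distrr /=.
  apply: eq_big_nat => j /andP[j0 _]; rewrite mulrCA; congr (_ * (_ * _%:R)).
  by rewrite !leq_divRL ?w0 // mulnC.
rewrite psiE -big_split /=; apply: ler_sum_nat => j /andP[j0 jn].
rewrite -!big_distrr -mulrDr /= -[leLHS]mulr1 ler_wpM2l ?ln_mangoldt_ge0 //.
by apply: h; rewrite divn_gt0.
Qed.

End Chebyshev.

(** * Certified computation for small n *)

Section IntegerReals.
Variable R : realType.

(** The large computations run on binary integers by [vm_compute]; this embedding carries their
    outcome to R. *)
Definition zr (z : Z) : R := (int_of_Z z)%:~R.

Lemma zrD x y : zr (x + y)%ZZ = zr x + zr y.
Proof. by rewrite /zr -intrD; congr _%:~R; lia. Qed.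

Lemma zrN x : zr (- x)%ZZ = - zr x.
Proof. by rewrite /zr -intrN; congr _%:~R; lia. Qed.

Lemma zrB x y : zr (x - y)%ZZ = zr x - zr y.
Proof. by rewrite -zrN -zrD. Qed.

Lemma zrM x y : zr (x * y)%ZZ = zr x * zr y.
Proof. by rewrite /zr -intrM; congr _%:~R; lia. Qed.

Lemma zr_nat n : zr (Z.of_nat n) = n%:R.
Proof. by rewrite /zr pmulrn; congr _%:~R; lia. Qed.

Lemma zr_le x y : (zr x <= zr y) = (x <=? y)%ZZ.
Proof. by rewrite /zr ler_int; lia. Qed.

Lemma zr_lt x y : (zr x < zr y) = (x <? y)%ZZ.
Proof. by rewrite /zr ltr_int; lia. Qed.

Lemma zr0 : zr 0%ZZ = 0. Proof. by []. Qed.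
Lemma zr1 : zr 1%ZZ = 1. Proof. by []. Qed.

Lemma zr_pos p : zr (Zpos p) = (Pos.to_nat p)%:R.
Proof. by rewrite -zr_nat; congr zr; lia. Qed.

Lemma zr_mul_div_le x y : (0 < y)%ZZ -> zr y * zr (x / y)%ZZ <= zr x.
Proof. by move=> y0; rewrite -zrM zr_le; apply/Z.leb_le/Z.mul_div_le. Qed.

Lemma zr_mul_succ_div_ge x y : (0 < y)%ZZ -> zr x <= zr y * zr (x / y + 1)%ZZ.
Proof.
move=> y0; rewrite -zrM zr_le; apply/Z.leb_le/Z.lt_le_incl.
exact: Z.mul_succ_div_gt.
Qed.

End IntegerReals.

(* The value 1 when out of fuel is the safe one: it makes mangoldt_bound answer q. *)
Fixpoint strip (fuel : nat) (q n : Z) : Z :=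
  if fuel is fuel'.+1 then
    if (n mod q =? 0)%ZZ then strip fuel' q (n / q) else n
  else 1%ZZ.

(** Trial division. Any answer at least [mangoldt_base n] is sound, and n always is one; the exit at
    n < q * q saves time. *)
Fixpoint mangoldt_bound (ps : seq Z) (n : Z) : Z :=
  if ps is q :: ps' then
    if (n mod q =? 0)%ZZ then (if (strip 20 q n =? 1)%ZZ then q else 1%ZZ)
    else if (n <? q * q)%ZZ then n else mangoldt_bound ps' n
  else n.

Lemma strip_pow fuel (q : Z) k : (1 < q)%ZZ -> strip fuel q (q ^ Z.of_nat k) = 1%ZZ.
Proof.
move=> q1; elim: fuel k => // fuel IH [|k].
  by rewrite /= Z.mod_small //; lia.
rewrite Nat2Z.inj_succ Z.pow_succ_r ?[(q * _)%ZZ]Z.mul_comm /=; last lia.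
by rewrite Z.mod_mul ?Z.div_mul ?IH //; lia.
Qed.

Arguments strip : simpl never.

Lemma mangoldt_boundP ps n : (0 < n)%N ->
  all (fun q => (0 <? q)%ZZ && prime (Z.to_nat q)) ps ->
  (Z.of_nat (mangoldt_base n) <= mangoldt_bound ps (Z.of_nat n))%ZZ.
Proof.
move=> n0; have triv : (Z.of_nat (mangoldt_base n) <= Z.of_nat n)%ZZ.
  have : (mangoldt_base n <= n)%N.
    by rewrite /mangoldt_base; case: ifP => // _; exact: pdiv_leq.
  lia.
elim: ps => //= q ps IH /andP[/andP[/Z.ltb_lt q0 pq] /IH {}IH].
case: ifP => [/Z.eqb_eq qn|_]; last by case: ifP.
have dq : (Z.to_nat q %| n)%N.
  by have /Z.mod_divide := qn => -[|z]; [lia | move=> hz; apply/dvdnP; exists (Z.to_nat z); nia].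
have [m1|m1] := eqVneq (mangoldt_base n) 1%N.
  by rewrite m1; case: ifP => _ //; move: q0; clear; lia.
have pm : prime (pdiv (mangoldt_base n)).
  by rewrite pdiv_prime // ltn_neqAle eq_sym m1 mangoldt_base_gt0.
have [e [k nk]] := mangoldt_base_eq pm (pdiv_dvd _).
have qe : Z.to_nat q = mangoldt_base n.
  by rewrite e; move: dq; rewrite {1}nk Euclid_dvdX // dvdn_prime2 // => /andP[/eqP].
have -> : Z.of_nat n = (q ^ Z.of_nat k.+1)%ZZ.
  rewrite nk -e -qe.
  have -> : forall a b, Z.of_nat (a ^ b)%N = (Z.of_nat a ^ Z.of_nat b)%ZZ by lia.
  by rewrite Z2Nat.id //; lia.
by rewrite strip_pow ?Z.eqb_refl -?qe; have := prime_gt1 pq; lia.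
Qed.

(** Fixed-point evaluation of top x^n lcm(1, .., n) for some x <= un / ud, rounded up at each step;
    -1 signals that top was exceeded. *)
Fixpoint sieve_run (ps : seq Z) (fuel : nat) (un ud top n r : Z) : Z :=
  if fuel is fuel'.+1 then
    let r' := (mangoldt_bound ps n * r * un / ud + 1)%ZZ in
    if (r' <=? top)%ZZ then sieve_run ps fuel' un ud top (n + 1) r' else (- 1)%ZZ
  else r.

Lemma sieve_runS ps fuel un ud top n r : sieve_run ps fuel.+1 un ud top n r =
  (let r' := (mangoldt_bound ps n * r * un / ud + 1)%ZZ in
   if (r' <=? top)%ZZ then sieve_run ps fuel un ud top (n + 1)%ZZ r' else (- 1)%ZZ).
Proof. by []. Qed.

Section Sieve.
Variable R : realType.

Lemma lcm_uptoS n : lcm_upto n.+1 = (lcm_upto n * mangoldt_base n.+1)%N.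
Proof. by rewrite /lcm_upto big_nat_recr. Qed.

(** The test r' <= top yields x^k lcm(1, .., k) <= 1 at each step; the invariant is also returned at
    the end so that two runs can be chained. *)
Lemma sieve_runP (x : R) ps fuel un ud top n r : (0 < ud)%ZZ -> (0 <= un)%ZZ -> (0 < top)%ZZ ->
  all (fun q => (0 <? q)%ZZ && prime (Z.to_nat q)) ps ->
  x <= zr R un / zr R ud -> 0 <= x ->
  zr R top * x ^+ n * (lcm_upto n)%:R <= zr R r ->
  (0 <= sieve_run ps fuel un ud top (Z.of_nat n.+1) r)%ZZ ->
  zr R top * x ^+ (n + fuel) * (lcm_upto (n + fuel))%:R <=
    zr R (sieve_run ps fuel un ud top (Z.of_nat n.+1) r) /\
  forall k, (n < k <= n + fuel)%N -> x ^+ k * (lcm_upto k)%:R <= 1.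
Proof.
move=> ud0 un0 t0 pps xu x0; elim: fuel n r => [|fuel IH] n r hr hs.
  by rewrite addn0; split=> // k; rewrite ltnNge; case: leqP.
move: hs; rewrite sieve_runS; cbv zeta; set r' := (_ + 1)%ZZ.
case: ifP => [r't|] //.
have -> : (Z.of_nat n.+1 + 1)%ZZ = Z.of_nat n.+2 by lia.
have hr' : zr R top * x ^+ n.+1 * (lcm_upto n.+1)%:R <= zr R r'.
  have hud : 0 < zr R ud by rewrite -(zr0 R) zr_lt; apply/Z.ltb_lt.
  have hun : 0 <= zr R un by rewrite -(zr0 R) zr_le; apply/Z.leb_le.
  have ht : 0 <= zr R top by rewrite -(zr0 R) zr_le; apply/Z.leb_le/Z.lt_le_incl.
  rewrite -(ler_pM2l hud); apply: le_trans (zr_mul_succ_div_ge R _ ud0).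
  rewrite !zrM lcm_uptoS natrM exprS.
  have mb : (mangoldt_base n.+1)%:R <= zr R (mangoldt_bound ps (Z.of_nat n.+1)).
    by rewrite -zr_nat zr_le; apply/Z.leb_le/mangoldt_boundP.
  have hx : zr R ud * x <= zr R un by rewrite mulrC -ler_pdivlMr.
  have -> : zr R ud * (zr R top * (x * x ^+ n) *
      ((lcm_upto n)%:R * (mangoldt_base n.+1)%:R)) =
    (mangoldt_base n.+1)%:R * (zr R top * x ^+ n * (lcm_upto n)%:R) * (zr R ud * x) by ring.
  have h1 : 0 <= zr R top * x ^+ n * (lcm_upto n)%:R.
    by rewrite !mulr_ge0 ?exprn_ge0.
  have h2 : 0 <= zr R ud * x by rewrite mulr_ge0 // ltW.
  apply: (ler_pM _ h2 _ hx); first by rewrite mulr_ge0.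
  exact: (ler_pM (ler0n _ _) h1 mb hr).
move=> /(IH _ _ hr'); rewrite addSnnS => -[h1 h2]; split=> // k /andP[nk kn].
have [|nk'] := ltnP n.+1 k; first by move=> nk'; apply: h2; rewrite nk' kn.
have -> : k = n.+1 by apply/eqP; rewrite eqn_leq nk nk'.
have ht : 0 < zr R top by rewrite -(zr0 R) zr_lt; apply/Z.ltb_lt.
by rewrite -(ler_pM2l ht) mulr1 mulrA (le_trans hr') // zr_le.
Qed.

End Sieve.

(** All primes below 128, since 128^2 = 2^14. *)
Definition small_primes : seq Z :=
  [:: 2; 3; 5; 7; 11; 13; 17; 19; 23; 29; 31; 37; 41; 43; 47; 53; 59; 61; 67; 71; 73;
      79; 83; 89; 97; 101; 103; 107; 109; 113; 127]%ZZ.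

(* Fixed-point scale; the integer r of sieve_run exceeds sieve_top x^n lcm(1, .., n).
   224/633 is barely above x = e^-1.03883, since psi n / n comes close to 1.03883 at
   n = 113; beyond 300 there is room for the cheaper 91/256. *)
Definition sieve_top : Z := (2 ^ 130)%ZZ.

Definition sieve_mid : Z := sieve_run small_primes 300 224 633 sieve_top 1 sieve_top.

Lemma small_primesP : all (fun q => (0 <? q)%ZZ && prime (Z.to_nat q)) small_primes.
Proof. by vm_compute. Qed.

Lemma sieve_mid_ge0 : (0 <=? sieve_mid)%ZZ.
Proof. by vm_compute. Qed.

(** The run ends at 300 + 128 * 126 = 16428, just past 2^14, where the Chebyshev induction takes
    over. *)
Lemma sieve_end_ge0 :
  (0 <=? sieve_run small_primes (128 * 126) 91 256 sieve_top 301 sieve_mid)%ZZ.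
Proof. by vm_compute. Qed.

Section SmallRange.
Variable R : realType.

Lemma expR_ge_partial (x : R) n : 0 <= x ->
  \sum_(0 <= k < n) x ^+ k / k`!%:R <= expR x.
Proof.
move=> x0; have nd : nondecreasing_seq (series (exp_coeff x)).
  apply/nondecreasing_seqP => k; rewrite /series /= big_nat_recr //= lerDl.
  exact: exp_coeff_ge0.
exact: nondecreasing_cvgn_le nd (is_cvg_series_exp_coeff x) n.
Qed.

(** The margin is only about 10^-5, so e is bounded to five decimals and e^0.03883 by its cubic
    Taylor polynomial. *)
Lemma expR_cst1_ge : 633 / 224 <= expR (cst1 R).
Proof.
have h1 : (271 * 10 ^+ 3 + 828) / 10 ^+ 5 <= expR 1 :> R.
  have := @expR_ge_partial 1 10 ler01; rewrite !big_nat_recr // big_geq //= add0r.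
  rewrite !expr1n !factS fact0 !natrM => h.
  by apply: le_trans h; lra.
rewrite /cst1; set y : R := (X in 1 + X).
have y0 : 0 <= y by rewrite divr_ge0 ?exprn_ge0 ?ler0n.
have h2 : 1 + y + y ^+ 2 / 2 + y ^+ 3 / 6 <= expR y.
  have := @expR_ge_partial y 4 y0; rewrite !big_nat_recr // big_geq //= add0r.
  by rewrite expr0 expr1 !factS !fact0 !divr1.
rewrite expRD; have h3 : 0 <= 1 + y + y ^+ 2 / 2 + y ^+ 3 / 6.
  by rewrite !addr_ge0 ?divr_ge0 ?exprn_ge0 ?ler0n ?ler01.
apply: le_trans (ler_pM _ h3 h1 h2); last by lra.
rewrite /y; lra.
Qed.

Lemma lcm_upto_small n : (0 < n < 2 ^ 14)%N -> (lcm_upto n)%:R <= expR (cst1 R * n%:R).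
Proof.
move=> /andP[n0 nN].
pose x : R := expR (- cst1 R).
have x0 : 0 < x by exact: expR_gt0.
have x1 : x <= zr R 224 / zr R 633.
  rewrite /x expRN !zr_pos.
  have -> : (Pos.to_nat 224) = 224%N by lia.
  have -> : (Pos.to_nat 633) = 633%N by lia.
  rewrite -[leRHS]invf_div lef_pV2; first exact: expR_cst1_ge.
    by rewrite posrE expR_gt0.
  by rewrite posrE divr_gt0 ?ltr0n.
have x2 : x <= zr R 91 / zr R 256.
  apply: le_trans x1 _; rewrite ler_pdivrMr; last by rewrite -(zr0 R) zr_lt.
  rewrite mulrAC ler_pdivlMr; last by rewrite -(zr0 R) zr_lt.
  by rewrite -!zrM zr_le.
suff : x ^+ n * (lcm_upto n)%:R <= 1.
  rewrite -expRM_natr mulNr expRN -ler_pdivlMl ?invr_gt0 ?expR_gt0 //.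
  by rewrite invrK mulr1.
have ge0 a : (0 <? a)%ZZ -> (0 <= a)%ZZ by move=> /Z.ltb_lt /Z.lt_le_incl.
have gt0 a : (0 <? a)%ZZ -> (0 < a)%ZZ by move=> /Z.ltb_lt.
have run0 := @sieve_runP R x small_primes 300 224 633 sieve_top 0 sieve_top
  (gt0 633%ZZ isT) (ge0 224%ZZ isT) (gt0 sieve_top isT) small_primesP x1 (ltW x0).
have run1 := @sieve_runP R x small_primes (128 * 126) 91 256 sieve_top 300 sieve_mid
  (gt0 256%ZZ isT) (ge0 91%ZZ isT) (gt0 sieve_top isT) small_primesP x2 (ltW x0).
have /run0 [|e1 h1] : zr R sieve_top * x ^+ 0 * (lcm_upto 0)%:R <= zr R sieve_top.
- have -> : lcm_upto 0 = 1%N by rewrite /lcm_upto big_geq.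
  rewrite expr0 !mulr1; exact: lexx.
- by move: sieve_mid_ge0; clear; move/Z.leb_le.
have [n3|n3] := leqP n 300; first by apply: h1; rewrite n0.
have /run1 [|e2 h2] := e1; first by move: sieve_end_ge0; clear; move/Z.leb_le.
by apply: h2; rewrite n3 (leq_trans (ltnW nN)).
Qed.

End SmallRange.

(* A pair (d, b) stands for the coefficient d b / 10^6 of ln [n/d]! in Chebyshev's method.
   The b sum to 0; with the weights (k, w) of psi (n/k), they come from the linear program
   that minimizes the resulting bound on psi n / n, rounded to integers. *)
Definition cheb_b : seq (Z * Z) :=
  [:: (1, 1000003); (2, -500000); (3, -333333); (5, -200000); (6, 166667); (7, -142857);
      (10, 100000); (11, -90909); (13, -64721); (14, 60098); (15, 63349); (17, -58824);
      (19, -51568); (20, -1010); (21, 40736); (22, 45455); (23, -37341); (24, -5882);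
      (26, 32360); (28, 5665); (29, -20541); (30, -45152); (31, -7297); (33, 6854); (34, 13932);
      (35, 4532); (37, -13118); (38, 12241); (39, 21574); (40, 505); (41, -24390); (42, -16591);
      (43, -15413); (44, -999); (46, 13377); (47, -1825); (48, -1069); (50, 392); (51, 5071);
      (53, -6840); (55, 7351); (56, -746); (57, 8936); (58, 10270); (59, -8587); (60, -1148);
      (65, 3263); (66, -3427); (68, 742); (69, 4850); (71, -5208); (74, 6559); (75, -1125);
      (77, 2074); (78, -10787); (79, -972); (82, 5113); (85, 1698); (86, 4429); (87, 2668);
      (88, 1816); (90, 2101); (92, 2002); (93, 2513); (94, 2980); (95, 8189); (96, 2005);
      (97, -690)]%ZZ.

Definition cheb_w : seq (Z * Z) :=
  [:: (15, 49763); (21, 144553); (34, 526303); (35, 841371); (57, 470432); (159, 248387);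
      (219, 398127); (809, 4534); (842, 93215); (859, 71913); (1068, 167453); (1089, 249642);
      (4718, 206351); (7999, 12527062)]%ZZ.

Definition cheb_den : Z := 1000000%ZZ.

(** * Verification of the coefficient condition *)

Definition zsum T (F : T -> Z) (s : seq T) : Z := foldr (fun p a => (F p + a)%ZZ) 0%ZZ s.

(** Up to the factor [cheb_den], [esum] and [wsum] are the two sums in the condition of
    [chebyshev_scheme]. *)
Definition esum (bs : seq (Z * Z)) (y : Z) : Z := zsum (fun p => p.2 * p.1 * (y / p.1))%ZZ bs.

Definition wsum (y : Z) : Z := zsum (fun p => if (p.1 <=? y)%ZZ then p.2 else 0%ZZ) cheb_w.

(* An entry (d, e, r) counts down the distance r from the current y to the next multiple
   of d, where [esum] jumps by e = b d. *)
Fixpoint tick (cs : seq (Z * Z * Z)) : seq (Z * Z * Z) * Z :=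
  if cs is (d, e, r) :: cs' then
    let (cs'', s) := tick cs' in
    if (r =? 1)%ZZ then ((d, e, d) :: cs'', (e + s)%ZZ)
    else ((d, e, (r - 1)%ZZ) :: cs'', s)
  else ([::], 0%ZZ).

Definition counters (bs : seq (Z * Z)) (y : Z) : seq (Z * Z * Z) :=
  [seq (p.1, p.2 * p.1, p.1 - y mod p.1)%ZZ | p <- bs].

Fixpoint scan (fuel : nat) (y : Z) (cs : seq (Z * Z * Z)) (e : Z) : bool :=
  if fuel is fuel'.+1 then
    (cheb_den <=? e + wsum y)%ZZ &&
    (let (cs', s) := tick cs in scan fuel' (y + 1) cs' (e + s))
  else true.

Lemma tickP bs y : all (fun p => 0 <? p.1)%ZZ bs -> (0 <= y)%ZZ ->
  tick (counters bs y) = (counters bs (y + 1), esum bs (y + 1) - esum bs y)%ZZ.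
Proof.
move=> bs0 y0; elim: bs bs0 => [|[d b] bs IH] //= /andP[/Z.ltb_lt d0 /IH {}IH].
rewrite IH /esum /=; set u := zsum _ _; set v := zsum _ _.
have r0 := Z.mod_pos_bound y d d0; have ey := Z.div_mod y d ltac:(lia).
have e1 := Z.div_mod (y + 1) d ltac:(lia); have r1 := Z.mod_pos_bound (y + 1) d d0.
set q := (y / d)%ZZ in ey *; set q1 := ((y + 1) / d)%ZZ in e1 *.
set r := (y mod d)%ZZ in ey r0 *; set r' := ((y + 1) mod d)%ZZ in e1 r1 *.
case: Z.eqb_spec => er.
  have eq1 : q1 = (q + 1)%ZZ by nia.
  have er' : r' = 0%ZZ by nia.
  by rewrite eq1 er' Z.sub_0_r; congr (_, _); ring_simplify; lia.
have eq1 : q1 = q by nia.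
have er' : r' = (r + 1)%ZZ by nia.
by rewrite eq1 er'; congr ((_, _, _) :: _, _); lia.
Qed.

Lemma scanP bs fuel y : all (fun p => 0 <? p.1)%ZZ bs -> (0 <= y)%ZZ ->
  scan fuel y (counters bs y) (esum bs y) ->
  forall k, (y <= k < y + Z.of_nat fuel)%ZZ -> (cheb_den <= esum bs k + wsum k)%ZZ.
Proof.
move=> bs0; elim: fuel y => [|fuel IH] y y0; first by move=> _ k; lia.
rewrite [scan _ _ _ _]/= tickP // => /andP[/Z.leb_le h1 h2] k hk.
have [->//|kn] := Z.eq_dec k y.
apply: (IH (y + 1)%ZZ); [lia | | lia].
by move: h2; congr scan; lia.
Qed.

(** A floor loses at most (d - 1) / d, and the loss matters only where b > 0. As the b of [cheb_b]
    sum to 0, the lower bound is then independent of y, and all large y reduce to the single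
    comparison [cheb_tail]. *)
Lemma esum_ge bs y : all (fun p => 0 <? p.1)%ZZ bs -> (0 <= y)%ZZ ->
  (zsum snd bs * y - zsum (fun p => if 0 <? p.2 then p.2 * (p.1 - 1) else 0)%ZZ bs
   <= esum bs y)%ZZ.
Proof.
move=> bs0 y0; elim: bs bs0 => [|[d b] bs IH] //= /andP[/Z.ltb_lt d0 /IH {}IH].
rewrite /esum /= -/(esum _ _).
have r0 := Z.mod_pos_bound y d d0; have ey := Z.div_mod y d ltac:(lia).
set q := (y / d)%ZZ in ey *; set r := (y mod d)%ZZ in ey r0 *.
have : (b * y - (if 0 <? b then b * (d - 1) else 0) <= b * d * q)%ZZ.
  by case: Z.ltb_spec => ?; nia.
move: IH; set u := zsum _ _; set v := zsum _ _; set w := esum _ _; lia.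
Qed.

Lemma cheb_b_gt0 : all (fun p => 0 <? p.1)%ZZ cheb_b.
Proof. by vm_compute. Qed.

Lemma cheb_scan : scan (80 * 100) 1 (counters cheb_b 1) (esum cheb_b 1).
Proof. by vm_compute. Qed.

Lemma cheb_tail : (cheb_den + zsum (fun p => if 0 <? p.2 then p.2 * (p.1 - 1) else 0)%ZZ cheb_b
   <=? zsum snd cheb_w)%ZZ && (zsum snd cheb_b =? 0)%ZZ.
Proof. by vm_compute. Qed.

Lemma cheb_w_bounds : all (fun p => (1 <? p.1) && (p.1 <? 8000) && (0 <? p.2))%ZZ cheb_w.
Proof. by vm_compute. Qed.

Lemma cheb_scheme_ge y : (0 < y)%ZZ -> (cheb_den <= esum cheb_b y + wsum y)%ZZ.
Proof.
move=> y0; have [yY|Yy] := Z.lt_ge_cases y 8000.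
  apply: (scanP cheb_b_gt0 _ cheb_scan); first by [].
  by have -> : Z.of_nat (80 * 100) = 8000%ZZ by []; lia.
have /andP[/Z.leb_le h1 /Z.eqb_eq h2] := cheb_tail.
have := esum_ge cheb_b_gt0 (Z.lt_le_incl _ _ y0); rewrite h2 => h3.
(* Every threshold k is below 8000, so all weights count from there on. *)
have -> : wsum y = zsum snd cheb_w.
  rewrite /wsum; elim: cheb_w cheb_w_bounds => [|[k w] s IH] //= /andP[/andP[/andP[_ k8] _] /IH ->].
  by case: Z.leb_spec; move: k8 => /Z.ltb_lt; lia.
lia.
Qed.

Lemma le_of_eq d (T : porderType d) (x y : T) : x = y -> (x <= y)%O.
Proof. by move=> ->. Qed.

(** * Integer brackets for logarithms *)

Section LogTable.
Variable R : realType.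
Variable S : Z.
Implicit Types d lo hi : Z.

Definition log_bounds d lo hi :=
  zr R lo <= zr R S * ln (zr R d) <= zr R hi.

(* The increments are those of ln_atanh_ge and ln_atanh_le at z = 1 / v,
   where (1 + z) / (1 - z) = (d + 1) / d. *)
Fixpoint log_table (fuel : nat) d lo hi : seq (Z * Z) :=
  if fuel is fuel'.+1 then
    let v := (2 * d + 1)%ZZ in
    (lo, hi) :: log_table fuel' (d + 1)
      (lo + S * (6 * v ^ 2 + 2) / (3 * v ^ 3))
      (hi + (S * (12 * v ^ 4 + 4 * v ^ 2 + 3) / (6 * v ^ 5) + 1))
  else [::].

Lemma zr_numerals : (zr R 2%ZZ = 2) * (zr R 3%ZZ = 3) * (zr R 4%ZZ = 4) * (zr R 5%ZZ = 5)
  * (zr R 6%ZZ = 6) * (zr R 9%ZZ = 9) * (zr R 10%ZZ = 10) * (zr R 12%ZZ = 12).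
Proof.
exact: (zr_nat R 2, zr_nat R 3, zr_nat R 4, zr_nat R 5, zr_nat R 6, zr_nat R 9,
  zr_nat R 10, zr_nat R 12).
Qed.

Lemma zrX x n : zr R (x ^ Z.of_nat n)%ZZ = zr R x ^+ n.
Proof.
elim: n => [|n IH]; first by rewrite expr0.
by rewrite Nat2Z.inj_succ Z.pow_succ_r ?zrM ?IH ?exprS //; lia.
Qed.

Lemma log_bounds_step d lo hi (v := (2 * d + 1)%ZZ) : (0 < S)%ZZ -> (0 < d)%ZZ ->
  log_bounds d lo hi ->
  log_bounds (d + 1) (lo + S * (6 * v ^ 2 + 2) / (3 * v ^ 3))
    (hi + (S * (12 * v ^ 4 + 4 * v ^ 2 + 3) / (6 * v ^ 5) + 1)).
Proof.
move=> S0 d0 /andP[h1 h2].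
have D1 : 1 <= zr R d by rewrite -(zr1 R) zr_le; apply/Z.leb_le; lia.
set x := zr R d in D1 h1 h2.
have ev : zr R v = 2 * x + 1 by rewrite /v zrD zrM zr1 zr_numerals.
clearbody v; have v3 : 3 <= zr R v by rewrite ev; lra.
have v0 : 0 < zr R v by lra.
have vn : zr R v != 0 by rewrite gt_eqF.
pose z := (zr R v)^-1.
have z0 : 0 < z by rewrite invr_gt0.
have z1 : z <= 2 / 5.
  have : z <= 3^-1 by rewrite /z lef_pV2 ?posrE.
  by lra.
have SR0 : 0 < zr R S by rewrite -(zr0 R) zr_lt; apply/Z.ltb_lt.
have e : (1 + z) / (1 - z) = (x + 1) / x.
  by rewrite /z ev; field; rewrite !gt_eqF //; lra.
have := @ln_atanh_ge R z; have := @ln_atanh_le R z.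
rewrite e ln_div ?posrE //; try lra.
set L := ln (x + 1) - ln x => /(_ ltac:(lra)) hu /(_ ltac:(lra)) hl.
have zS : zr R S * ln (zr R (d + 1)%ZZ) = zr R S * ln x + zr R S * L.
  by rewrite zrD zr1 -/x /L; ring.
rewrite /log_bounds zS !zrD; apply/andP; split.
  apply: lerD => //.
  have p0 : 0 < zr R (3 * v ^ 3)%ZZ.
    by rewrite zrM (zrX v 3) zr_numerals mulr_gt0 ?exprn_gt0.
  rewrite -(ler_pM2l p0); apply: le_trans (zr_mul_div_le R _ _) _.
    by apply/Z.ltb_lt; rewrite -(zr_lt R).
  apply: le_trans (_ : zr R (3 * v ^ 3)%ZZ * (zr R S * (2 * z + 2 / 3 * z ^+ 3)) <= _).
    rewrite !(zrM, zrD, zrX v 3, zrX v 2) !zr_numerals ?zr1 /z.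
    apply: le_of_eq; by field.
  by rewrite ler_pM2l // ler_pM2l.
apply: lerD => //.
have p0 : 0 < zr R (6 * v ^ 5)%ZZ.
  by rewrite zrM (zrX v 5) zr_numerals mulr_gt0 ?exprn_gt0.
rewrite -(ler_pM2l p0) -zrD; apply: le_trans (zr_mul_succ_div_ge R _ _); last first.
  by apply/Z.ltb_lt; rewrite -(zr_lt R).
apply: le_trans (_ : zr R (6 * v ^ 5)%ZZ * (zr R S * (2 * z + 2 / 3 * z ^+ 3 + z ^+ 5 / 2)) <= _).
  by rewrite ler_pM2l // ler_pM2l.
rewrite !(zrM, zrD, zrX v 5, zrX v 4, zrX v 2) !zr_numerals ?zr1 /z.
apply: le_of_eq; by field.
Qed.

Lemma log_tableP fuel d lo hi i : (0 < S)%ZZ -> (0 < d)%ZZ -> log_bounds d lo hi -> (i < fuel)%N ->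
  log_bounds (d + Z.of_nat i) (nth (0, 0)%ZZ (log_table fuel d lo hi) i).1
    (nth (0, 0)%ZZ (log_table fuel d lo hi) i).2.
Proof.
move=> S0; elim: fuel d lo hi i => // fuel IH d lo hi [|i] d0 h ifuel.
  by rewrite Z.add_0_r.
have := @IH (d + 1)%ZZ _ _ i ltac:(lia) (log_bounds_step S0 d0 h) ifuel.
by have -> : (d + 1 + Z.of_nat i = d + Z.of_nat i.+1)%ZZ by lia.
Qed.

(** 2 = 9/8 * (4/3)^2, where 9/8 and 4/3 correspond to z = 1/17 and z = 1/7, small enough for the
    truncated series. *)
Lemma ln2_bounds : 6 / 10 + 93 / 10 ^+ 3 + 98 / 10 ^+ 6 <= ln (2 : R) <=
  6 / 10 + 93 / 10 ^+ 3 + 160 / 10 ^+ 6.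
Proof.
have e : ln (2 : R) = ln ((1 + 1 / 17) / (1 - 1 / 17)) + 2 * ln ((1 + 1 / 7) / (1 - 1 / 7)).
  have p1 : (0 : R) < (1 + 1 / 7) / (1 - 1 / 7) by rewrite divr_gt0 //; lra.
  have p2 : (0 : R) < (1 + 1 / 17) / (1 - 1 / 17) by rewrite divr_gt0 //; lra.
  have dbl : forall y : R, 2 * y = y + y by move=> y; ring.
  have e : 2 = (1 + 1 / 17) / (1 - 1 / 17) *
      ((1 + 1 / 7) / (1 - 1 / 7) * ((1 + 1 / 7) / (1 - 1 / 7))) :> R.
    by field.
  move: p1 p2 e; set a := (_ / _) => p1; set b := (_ / _) => p2 e.
  clearbody a b; by rewrite {1}e dbl !lnM ?posrE ?mulr_gt0.
have h1 := @ln_atanh_ge R (1 / 17) ltac:(lra).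
have h2 := @ln_atanh_ge R (1 / 7) ltac:(lra).
have h3 := @ln_atanh_le R (1 / 17) ltac:(lra).
have h4 := @ln_atanh_le R (1 / 7) ltac:(lra).
by rewrite e; apply/andP; split; lra.
Qed.

End LogTable.

Definition log_scale : Z := (10 ^ 9)%ZZ.

(** Entry d - 1 brackets 10^9 ln d; ln 1 is exact, and the recursion is seeded at 2 by
    [ln2_bounds]. *)
Definition cheb_log_table : seq (Z * Z) :=
  (0, 0)%ZZ :: log_table log_scale 99 2 693098000 693160000.

Definition ln_lo (d : Z) : Z := (nth (0, 0)%ZZ cheb_log_table (Z.to_nat d).-1).1.
Definition ln_hi (d : Z) : Z := (nth (0, 0)%ZZ cheb_log_table (Z.to_nat d).-1).2.

(** These terms are the coefficients in [scheme_term_le], with logarithms rounded so that the total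
    goes up; 10 and 9 are the constants 1 and 9/10 of [ln_fact_divn_bounds], in tenths. *)
Definition main_term (p : Z * Z) : Z :=
  (if 0 <? p.2 then - p.2 * ln_lo p.1 else - p.2 * ln_hi p.1)%ZZ.
Definition abs_term (p : Z * Z) : Z := (Z.abs p.2 * p.1)%ZZ.
Definition abs_ln_term (p : Z * Z) : Z := (Z.abs p.2 * p.1 * ln_lo p.1)%ZZ.
Definition cst_term (p : Z * Z) : Z := ((if 0 <? p.2 then 10 else 9) * (p.2 * p.1))%ZZ.
Definition inv_term (p : Z * Z) : Z := (p.2 / p.1 + 1)%ZZ.

(* The bound on psi n is affine in n once ln n is replaced by its tangent at 2 ^ 14:
   the two conditions compare the values at 2 ^ 14 and the slopes. *)
Lemma cheb_numeric :
  let s := log_scale in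
  let P := zsum main_term cheb_b in
  let A := zsum abs_term cheb_b in
  let L := zsum abs_ln_term cheb_b in
  let K := zsum cst_term cheb_b in
  let V := zsum inv_term cheb_w in
  let C := (10 ^ 5 + 3883)%ZZ in
  ((10 ^ 5 * (20 * 2 ^ 14 * P - 10 * L + 140 * A * ln_hi 2 + 2 * K * s) <=?
     20 * s * 2 ^ 14 * C * (cheb_den - V)) &&
   (10 ^ 5 * (2 * 2 ^ 14 * P + A * s) <=? 2 * 2 ^ 14 * s * C * (cheb_den - V)))%ZZ.
Proof. by vm_compute. Qed.

Lemma cheb_b_bounds : all (fun p => (0 <? p.1) && (p.1 <=? 100))%ZZ cheb_b.
Proof. by vm_compute. Qed.

Arguments log_table : simpl never.

Lemma of_nat_divn m d : (0 < d)%N -> Z.of_nat (m %/ d) = (Z.of_nat m / Z.of_nat d)%ZZ.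
Proof.
move=> d0; apply: (Z.div_unique_pos _ _ _ (Z.of_nat (m %% d))).
  by have := ltn_pmod m d0; lia.
by rewrite {1}(divn_eq m d) Nat2Z.inj_add Nat2Z.inj_mul Z.mul_comm.
Qed.

(** * The bound on psi for all n *)

Section PsiBound.
Variable R : realType.
Local Notation zr := (zr R).

Lemma ln_tableP d : (0 < d <= 100)%ZZ -> log_bounds R log_scale d (ln_lo d) (ln_hi d).
Proof.
move=> [d0 d100]; rewrite /ln_lo /ln_hi /cheb_log_table.
have [->|d1] := Z.eq_dec d 1.
  by rewrite /log_bounds /= zr0 zr1 ln1 mulr0 lexx.
have [i ei] : exists i, (Z.to_nat d).-1 = i.+1 by exists ((Z.to_nat d).-2); lia.
have -> : d = (2 + Z.of_nat i)%ZZ by lia.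
have -> : (Z.to_nat (2 + Z.of_nat i)).-1 = i.+1 by lia.
rewrite [nth _ _ _]/=; apply: log_tableP; [by [] | by [] | | by lia].
rewrite /log_bounds (zr_nat R 2) /log_scale (zrX R 10 9) (zr_nat R 10).
have -> : 693098000%ZZ = (6 * 10 ^ 8 + 93 * 10 ^ 6 + 98 * 10 ^ 3)%ZZ by [].
have -> : 693160000%ZZ = (6 * 10 ^ 8 + 93 * 10 ^ 6 + 160 * 10 ^ 3)%ZZ by [].
rewrite !zrD !zrM zr1 (zr_nat R 10) (zr_nat R 6)
  (zr_nat R 93) (zr_nat R 98) (zr_nat R 160).
by have /andP[h1 h2] := ln2_bounds R; apply/andP; split; lra.
Qed.

Lemma zr_sum T (F : T -> Z) s : zr (zsum F s) = \sum_(p <- s) zr (F p).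
Proof. by elim: s => [|p s IH]; rewrite ?big_nil ?big_cons //= zrD IH. Qed.

(** The sign of b decides which side of [ln_fact_divn_bounds] and which end of the bracket for ln d
    apply. The leading term b (n ln n - n) is kept apart because it cancels in the sum over
    [cheb_b]. *)
Lemma scheme_term_le (s d b lo hi : Z) n :
  (0 < s)%ZZ -> (0 < d)%ZZ -> (2 * d <= Z.of_nat n)%ZZ ->
  log_bounds R s d lo hi ->
  zr s * (zr (b * d)%ZZ * ln ((n %/ Z.to_nat d)`!%:R)) <=
  zr s * zr b * (n%:R * ln n%:R - n%:R)
  + n%:R * zr (if 0 <? b then - b * lo else - b * hi)%ZZ
  + zr s * zr (Z.abs b * d)%ZZ / 2 * ln n%:R - zr (Z.abs b * d * lo)%ZZ / 2
  + zr s * zr ((if 0 <? b then 10 else 9) * (b * d))%ZZ / 10.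
Proof.
move=> s0 d0 dn /andP[hlo hhi].
have dN : (0 < Z.to_nat d)%N by lia.
have dnN : (2 * Z.to_nat d <= n)%N by lia.
have := @ln_fact_divn_bounds R n (Z.to_nat d) dN dnN.
have D0 : 0 < zr d by rewrite -(zr0 R) zr_lt; apply/Z.ltb_lt.
have sR : 0 < zr s by rewrite -(zr0 R) zr_lt; apply/Z.ltb_lt.
have eD : (Z.to_nat d)%:R = zr d by rewrite -zr_nat Z2Nat.id //; lia.
have n0 : 0 < n%:R :> R by rewrite ltr0n; lia.
rewrite eD ln_div ?posrE //; set T := ln _`!%:R.
set t := ln (zr d) in hlo hhi *; set l := ln n%:R.
move: D0 sR n0 hlo hhi; rewrite !zrM.
set D := zr d; set S := zr s; set N := n%:R.
move=> D0 S0 N0 hlo hhi.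
pose x := N / D; rewrite -/x; have -> : N = x * D by rewrite /x divfK ?gt_eqF.
have x0 : 0 < x by rewrite divr_gt0.
clearbody x T t l D S => /andP[T1 T2].
case: Z.ltb_spec => hb.
  have B0 : 0 < zr b by rewrite -(zr0 R) zr_lt; apply/Z.ltb_lt.
  rewrite (Z.abs_eq _ (Z.lt_le_incl _ _ hb)).
  rewrite !zrM zrN (zr_nat R 10); set B := zr b in B0 *; clearbody B.
  move: hlo; set ll := zr lo; clearbody ll => hlo.
  have f1 := ler_wpM2l (ltW (mulr_gt0 (mulr_gt0 S0 B0) D0)) T2.
  have f2 := ler_wpM2l (ltW (mulr_gt0 (mulr_gt0 B0 x0) D0)) hlo.
  have f3 := ler_wpM2l (ltW (mulr_gt0 B0 D0)) hlo.
  lra.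
have [B B0 eB] : exists2 B, 0 <= B & zr b = - B.
  exists (zr (- b)%ZZ); last by rewrite zrN opprK.
  by rewrite -(zr0 R) zr_le; apply/Z.leb_le; lia.
have -> : Z.abs b = (- b)%ZZ by lia.
rewrite !zrM !zrN (zr_nat R 9) !eB !opprK.
move: hlo hhi; set ll := zr lo; set hh := zr hi; clearbody ll hh => hlo hhi.
have f1 := ler_wpM2l (mulr_ge0 (mulr_ge0 (ltW S0) B0) (ltW D0)) T1.
have f2 := ler_wpM2l (mulr_ge0 (mulr_ge0 B0 (ltW x0)) (ltW D0)) hhi.
have f3 := ler_wpM2l (mulr_ge0 B0 (ltW D0)) hlo.
lra.
Qed.

Lemma sum_affine T (s : seq T) (F0 F1 F2 F3 F4 : T -> Z) (a x y l : R) :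
  \sum_(p <- s) (a * zr (F0 p) * x + y * zr (F1 p) + a * zr (F2 p) / 2 * l
    - zr (F3 p) / 2 + a * zr (F4 p) / 10) =
  a * zr (zsum F0 s) * x + y * zr (zsum F1 s) + a * zr (zsum F2 s) / 2 * l
    - zr (zsum F3 s) / 2 + a * zr (zsum F4 s) / 10.
Proof.
elim: s => [|p s IH]; first by rewrite big_nil /= !zr0 !(mulr0, mul0r) subr0 !addr0.
by rewrite big_cons IH /= !zrD; field.
Qed.

Lemma psi_small n : (n < 2 ^ 14)%N -> psi R n <= cst1 R * n%:R.
Proof.
case: n => [|n] nN; first by rewrite /psi /lcm_upto big_geq // ln1 mulr0.
rewrite -[leRHS]expRK /psi ler_ln ?posrE ?expR_gt0 ?ltr0n ?lcm_upto_gt0 //.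
by apply: lcm_upto_small; rewrite nN.
Qed.

Lemma cheb_psi_le n :
  zr cheb_den * psi R n <= \sum_(p <- cheb_b) zr (p.2 * p.1)%ZZ * ln ((n %/ Z.to_nat p.1)`!%:R)
    + \sum_(p <- cheb_w) zr p.2 * psi R (n %/ Z.to_nat p.1).
Proof.
set den := zr cheb_den; have den0 : 0 < den by rewrite -(zr0 R) zr_lt.
have b0 p : p \in cheb_b -> (0 < p.1)%ZZ by move=> /(allP cheb_b_gt0) /Z.ltb_lt.
have w0 p : p \in cheb_w -> (1 < p.1)%ZZ.
  by move=> /(allP cheb_w_bounds) /andP[/andP[/Z.ltb_lt]].
pose bR := [seq (Z.to_nat p.1, zr (p.2 * p.1)%ZZ / den) | p <- cheb_b].
pose wR := [seq (Z.to_nat p.1, zr p.2 / den) | p <- cheb_w].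
have := @chebyshev_scheme R bR wR n.
rewrite !big_map -(ler_pM2l den0) mulrDr !big_distrr /= => scheme.
apply: le_trans (scheme _ _ _) _.
- move=> y y0; rewrite /bR /wR !big_map /= -(ler_pM2l den0) mulr1 mulrDr !big_distrr /=.
  have -> : \sum_(p <- cheb_b) den * (zr (p.2 * p.1)%ZZ / den * (y %/ Z.to_nat p.1)%:R) =
      zr (esum cheb_b (Z.of_nat y)).
    rewrite /esum zr_sum; apply: eq_big_seq => p /b0 p0.
    rewrite mulrA mulrCA divff ?gt_eqF // mulr1 -zr_nat -zrM; congr zr.
    by case: p p0 => d b /= p0; rewrite of_nat_divn ?Z2Nat.id //; lia.
  have -> : \sum_(p <- cheb_w) den * (zr p.2 / den * (Z.to_nat p.1 <= y)%N%:R) =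
      zr (wsum (Z.of_nat y)).
    rewrite /wsum zr_sum; apply: eq_big_seq => p /w0 p0.
    rewrite mulrA mulrCA divff ?gt_eqF // mulr1.
    have -> : (Z.to_nat p.1 <= y)%N = (p.1 <=? Z.of_nat y)%ZZ by case: p p0 => d b /= p0; lia.
    by case: ifP; rewrite ?mulr1 ?mulr0.
  by rewrite -zrD zr_le; apply/Z.leb_le/cheb_scheme_ge; lia.
- by move=> _ /mapP[[d b] /b0 /= p0 ->] /=; lia.
- by move=> _ /mapP[[d b] /w0 /= p0 ->] /=; lia.
by apply: lerD; apply: ler_sum => p _; rewrite mulrA mulrCA divff ?gt_eqF // mulr1.
Qed.

Lemma ln_tangent n k : (0 < n)%N -> ln (n%:R : R) <= k%:R * ln 2 + (n%:R / 2 ^+ k - 1).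
Proof.
move=> n0; have p0 : 0 < n%:R / 2 ^+ k :> R by rewrite divr_gt0 ?ltr0n ?exprn_gt0.
have e : n%:R = 2 ^+ k * (n%:R / 2 ^+ k) :> R by rewrite mulrC divfK // expf_neq0.
rewrite {1}e lnM ?posrE ?exprn_gt0 // lnXn // -[_ *+ k]mulr_natl lerD2l.
have := @le_ln1Dx R (n%:R / 2 ^+ k - 1); rewrite [1 + _]addrC subrK; apply; lra.
Qed.

Theorem psi_le n : psi R n <= cst1 R * n%:R.
Proof.
elim/ltn_ind: n => n IH; have [/psi_small //|nN] := ltnP n (2 ^ 14).
have n200 : (200 <= n)%N by exact: leq_trans nN.
have n0 : (0 < n)%N by exact: leq_trans n200.
have den0 : 0 < zr cheb_den by rewrite -(zr0 R) zr_lt.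
have S0 : 0 < zr log_scale by rewrite -(zr0 R) zr_lt.
have c0 : 0 <= cst1 R by rewrite /cst1 addr_ge0 ?ler01 ?divr_ge0 ?exprn_ge0 ?ler0n.
have hb : zr log_scale *
    \sum_(p <- cheb_b) zr (p.2 * p.1)%ZZ * ln ((n %/ Z.to_nat p.1)`!%:R) <=
  n%:R * zr (zsum main_term cheb_b)
    + zr log_scale * zr (zsum abs_term cheb_b) / 2 * ln n%:R - zr (zsum abs_ln_term cheb_b) / 2
    + zr log_scale * zr (zsum cst_term cheb_b) / 10.
  have e : zr log_scale * zr (zsum snd cheb_b) * (n%:R * ln n%:R - n%:R) = 0.
    by have /andP[_ /Z.eqb_eq ->] := cheb_tail; rewrite zr0 mulr0 mul0r.
  apply: le_trans (_ : \sum_(p <- cheb_b) (zr log_scale * zr (snd p) * (n%:R * ln n%:R - n%:R)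
    + n%:R * zr (main_term p) + zr log_scale * zr (abs_term p) / 2 * ln n%:R
    - zr (abs_ln_term p) / 2 + zr log_scale * zr (cst_term p) / 10) <= _).
    rewrite mulr_sumr [leLHS]big_seq [leRHS]big_seq.
    apply: ler_sum => -[d b] /(allP cheb_b_bounds) /andP[/Z.ltb_lt /= d0 /Z.leb_le d1].
    by apply: scheme_term_le => //; [lia | apply: ln_tableP].
  by rewrite (sum_affine cheb_b snd) e add0r.
have hw : \sum_(p <- cheb_w) zr p.2 * psi R (n %/ Z.to_nat p.1) <=
    cst1 R * n%:R * zr (zsum inv_term cheb_w).
  rewrite zr_sum mulr_sumr !big_seq; apply: ler_sum => -[k w].
  move=> /(allP cheb_w_bounds) /andP[/andP[/Z.ltb_lt /= k1 _] /Z.ltb_lt /= w0].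
  have w0R : 0 <= zr w by rewrite -(zr0 R) zr_le; apply/Z.leb_le; lia.
  have k0 : 0 < zr k by rewrite -(zr0 R) zr_lt; apply/Z.ltb_lt; lia.
  have h1 : psi R (n %/ Z.to_nat k) <= cst1 R * (n%:R / zr k).
    apply: le_trans (IH _ _) _; first by rewrite ltn_Pdiv //; lia.
    apply: ler_wpM2l => //; rewrite ler_pdivlMr //.
    have -> : zr k = (Z.to_nat k)%:R by rewrite -zr_nat Z2Nat.id //; lia.
    by rewrite -natrM ler_nat leq_trunc_div.
  apply: le_trans (ler_wpM2l w0R h1) _.
  have h2 : zr w / zr k <= zr (inv_term (k, w)).
    by rewrite ler_pdivrMr // mulrC /inv_term zr_mul_succ_div_ge //; lia.
  have -> : zr w * (cst1 R * (n%:R / zr k)) = cst1 R * n%:R * (zr w / zr k) by ring.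
  by apply: ler_wpM2l => //; apply: mulr_ge0.
have hp := cheb_psi_le n.
have /andP[_ h2] := ln_tableP (conj (ltac:(lia) : (0 < 2)%ZZ) (ltac:(lia) : (2 <= 100)%ZZ)).
have hln := @ln_tangent n 14 n0.
have nN' : 2 ^+ 14 <= n%:R :> R by rewrite -natrX ler_nat.
have A0 : 0 <= zr (zsum abs_term cheb_b).
  by rewrite -(zr0 R) zr_le; vm_compute.
have := cheb_numeric; cbv zeta => /andP[].
move: hb hw hp h2 den0 S0 A0; rewrite -!(zr_le R).
move: (zsum main_term cheb_b) (zsum abs_term cheb_b) (zsum abs_ln_term cheb_b).
move: (zsum cst_term cheb_b) (zsum inv_term cheb_w) (ln_hi 2) => K V h P A L.
move: log_scale cheb_den => s den.
rewrite !(zrM, zrB, zrD) !zr1 !(zr_nat R 2, zr_nat R 10, zr_nat R 20, zr_nat R 140, zr_nat R 3883).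
(* Rewriting with [zrM] leaves the powers of 10 and 2 as nested products; these equations restore
   them. *)
have ec : 10 * 1 * (10 * 1 * (10 * 1 * (10 * 1 * (10 * 1)))) + 3883 = 10 ^+ 5 * cst1 R.
  rewrite /cst1 mulrDr [X in _ = _ + X]mulrC divfK; last by rewrite expf_neq0.
  by congr (_ + _); rewrite !mulr1 !exprS expr0 mulr1.
have e5 : 10 * 1 * (10 * 1 * (10 * 1 * (10 * 1 * (10 * 1)))) = 10 ^+ 5 :> R by ring.
have e14 : 2 * 1 * (2 * 1 * (2 * 1 * (2 * 1 * (2 * 1 * (2 * 1 * (2 * 1 * (2 * 1 * (2 * 1 *
  (2 * 1 * (2 * 1 * (2 * 1 * (2 * 1 * (2 * 1))))))))))))) = 2 ^+ 14 :> R by ring.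
rewrite ec e5 e14 !mulr1.
have W0 : 0 < 10 ^+ 5 :> R by rewrite exprn_gt0.
have T0 : 0 < 2 ^+ 14 :> R by rewrite exprn_gt0.
(* The bound is affine in y: [n1] is the comparison at y = 1, and [f5] is y - 1 times the comparison
   of slopes [n2]. *)
pose y := n%:R / 2 ^+ 14 : R; have yE : n%:R = y * 2 ^+ 14 by rewrite divfK ?gt_eqF.
have y1 : 1 <= y by rewrite ler_pdivlMr // mul1r.
move: hln; rewrite -/y yE.
move: (2 ^+ 14 : R) (10 ^+ 5 : R) T0 W0 => T W T0 W0.
move: (\sum_(p <- cheb_b) _) (\sum_(p <- cheb_w) _) => sb sw.
move: (ln 2) (ln (y * T)) (psi R n) (cst1 R) => l2 l ps c.
move: (zr s) (zr den) (zr K) (zr V) (zr h) (zr P) (zr A) (zr L).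
move=> {}s {}den {}K {}V {}h {}P {}A {}L hl hb hw hp h2 den0 S0 A0 n1 n2.
have {}n1 : 20 * T * P - 10 * L + 140 * A * h + 2 * K * s <= 20 * s * T * c * (den - V).
  rewrite -(ler_pM2l W0); apply: le_trans n1 _.
  by apply: le_of_eq; ring.
have {}n2 : 2 * T * P + A * s <= 2 * T * s * c * (den - V).
  rewrite -(ler_pM2l W0); apply: le_trans n2 _.
  by apply: le_of_eq; ring.
have f1 := ler_wpM2l (ltW S0) hp.
have f2 := ler_wpM2l (ltW S0) hw.
have f3 := ler_wpM2l (mulr_ge0 A0 (ltW S0)) hl.
have f4 := ler_wpM2l A0 h2.
have y0 : 0 <= y - 1 by lra.
have f5 := ler_wpM2l y0 n2.
rewrite -(ler_pM2l (mulr_gt0 S0 den0)).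
clear IH nN n200 n0 e5 e14 ec nN' hp hw hl h2 n2 y0 yE y1 T0 W0 den0 S0 A0.
lra.
Qed.

Corollary lcm_upto_le n : (lcm_upto n)%:R <= expR (cst1 R * n%:R).
Proof.
have l0 : 0 < (lcm_upto n)%:R :> R by rewrite ltr0n lcm_upto_gt0.
by rewrite -[leLHS]lnK ?posrE // ler_expR psi_le.
Qed.

End PsiBound.

(** * Pade approximations *)

Section Primitives.
Variable F : numFieldType.
Implicit Types (p q u G : {poly F}) (x : F).

(** The primitive vanishing at 0: for i = 0 the quotient by 0 is 0. *)
Definition primp p : {poly F} := \poly_(i < (size p).+1) (p`_i.-1 / i%:R).

Lemma coef_primp p i : (primp p)`_i = p`_i.-1 / i%:R.
Proof.
rewrite coef_poly; case: ltnP => // h.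
by rewrite nth_default ?mul0r // -ltnS (leq_trans h) // leqSpred.
Qed.

Fact primp_is_linear : linear primp.
Proof.
move=> a p q; apply/polyP => i.
by rewrite coefD coefZ !coef_primp coefD coefZ mulrDl mulrA.
Qed.
HB.instance Definition _ := GRing.isLinear.Build F {poly F} {poly F} _ primp primp_is_linear.

Lemma deriv_primp p : (primp p)^`() = p.
Proof.
by apply/polyP => i; rewrite coef_deriv coef_primp -[(_ / _) *+ _]mulr_natr divfK // pnatr_eq0.
Qed.

Lemma primp_horner0 p : (primp p).[0] = 0.
Proof. by rewrite horner_coef0 coef_primp invr0 mulr0. Qed.

Lemma primp_deriv p : p.[0] = 0 -> primp p^`() = p.
Proof.
rewrite horner_coef0 => p0; apply/polyP => -[|i].
  by rewrite coef_primp p0 invr0 mulr0.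
by rewrite coef_primp coef_deriv -[p`_i.+1 *+ _]mulr_natr mulfK // pnatr_eq0.
Qed.

Lemma primp_parts p q : p.[0] = 0 ->
  primp (p^`() * q) = p * q - primp (p * q^`()).
Proof.
move=> p0; apply/eqP; rewrite -subr_eq0 opprB addrA -linearD /= -derivM.
by rewrite primp_deriv ?subrr // hornerM p0 mul0r.
Qed.

Lemma size_primp p : (size (primp p) <= (size p).+1)%N.
Proof. exact: size_poly. Qed.

Lemma dvdp_deriv_exp x k u : ('X - x%:P) ^+ k.+1 %| u -> ('X - x%:P) ^+ k %| u^`().
Proof.
move=> /dvdpP[v ->]; rewrite derivM deriv_exp dvdp_addr.
  by rewrite derivXsubC mul1r mulrnAr -scaler_nat dvdpZr ?pnatr_eq0 // dvdp_mull.
by rewrite exprS mulrA dvdp_mull.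
Qed.

Lemma dvdp_derivn_root x k i u : (i < k)%N -> ('X - x%:P) ^+ k %| u -> u^`(i).[x] = 0.
Proof.
move=> ik; have [c ->] : exists c, k = (i + c).+1 by exists (k - i.+1)%N; lia.
elim: i {k ik} u => [|i IH] u h.
  by move: h; rewrite exprS => /(dvdp_trans (dvdp_mulr _ (dvdpp _))); rewrite dvdp_XsubCl => /rootP.
rewrite derivSn; apply: IH; exact: dvdp_deriv_exp.
Qed.

(** In characteristic 0 differentiation lowers the multiplicity of a root by exactly one. *)
Lemma dvdp_exp_deriv x k u : u.[x] = 0 -> ('X - x%:P) ^+ k %| u^`() ->
  ('X - x%:P) ^+ k.+1 %| u.
Proof.
have [->|u0] := eqVneq u 0; first by rewrite dvdp0.
move=> ux; have [j [v nv e]] := multiplicity_XsubC u x; rewrite u0 /= in nv.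
case: j e => [|j] e; first by case/negP: nv; rewrite /root -ux e expr0 mulr1.
rewrite e derivM deriv_exp derivXsubC mul1r => h.
rewrite dvdp_mull // dvdp_Pexp2l ?size_XsubC // ltnS leqNgt; apply/negP => jk.
have h1 : ('X - x%:P) ^+ j.+1 %| v * (('X - x%:P) ^+ j *+ j.+1).
  rewrite -(dvdp_addr _ (dvdp_mull v^`() (dvdpp _))).
  by apply: dvdp_trans h; rewrite dvdp_Pexp2l ?size_XsubC.
move: h1; rewrite mulrnAr -scaler_nat dvdpZr ?pnatr_eq0 // exprS.
rewrite dvdp_mul2r ?expf_neq0 ?polyXsubC_eq0 // dvdp_XsubCl.
by rewrite (negbTE nv).
Qed.

(** The boundary terms of the l integrations by parts vanish, because u vanishes to order l at both
    0 and x. *)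
Lemma primp_rodrigues x l p u : 'X ^+ l %| u -> ('X - x%:P) ^+ l %| u ->
  (primp (p * u^`(l))).[x] = (-1) ^+ l * (primp (p^`(l) * u)).[x].
Proof.
elim: l p => [|l IH] p hX hx; first by rewrite expr0 mul1r.
have hX' : ('X - 0%:P : {poly F}) ^+ l.+1 %| u by rewrite subr0.
have lX : 'X ^+ l %| u by apply: dvdp_trans hX; rewrite exprS dvdp_mull.
have lx : ('X - x%:P) ^+ l %| u by apply: dvdp_trans hx; rewrite exprS dvdp_mull.
rewrite derivnS mulrC primp_parts; last exact: dvdp_derivn_root hX'.
rewrite hornerD hornerN hornerM (dvdp_derivn_root _ hx) // mul0r add0r.
by rewrite mulrC IH // -derivSn exprS -mulrA mulN1r.
Qed.

(** Dividing by l! turns the falling factorial of n into a binomial coefficient: an integer, and 0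
    for n < l. *)
Lemma primp_rodriguesN x l n u : 'X ^+ l %| u -> ('X - x%:P) ^+ l %| u ->
  (primp ('X^n * u^`N(l))).[x] = (-1) ^+ l * 'C(n, l)%:R * (primp ('X^(n - l) * u)).[x].
Proof.
move=> hX hx; have lf : l`!%:R != 0 :> F by rewrite pnatr_eq0 -lt0n fact_gt0.
apply: (mulIf lf); have := @primp_rodrigues x l 'X^n u hX hx.
rewrite nderivn_def derivnXn mulrnAl ['X^n * _]mulrnAr !linearMn /= !hornerMn => h.
rewrite [LHS]mulr_natr h -bin_ffact -[_ *+ (_ * _)]mulr_natr natrM; ring.
Qed.

End Primitives.

Section Pade.
Variable F : numFieldType.
Implicit Types (p q u G : {poly F}) (x : F).

Definition divdiff G : {poly F} := (G - G.[-1]%:P) %/ ('X - (-1)%:P).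

Lemma divdiffE G : G = G.[-1]%:P + ('X + 1) * divdiff G.
Proof.
have -> : 'X + 1 = 'X - (-1)%:P :> {poly F} by rewrite polyCN opprK polyC1.
rewrite mulrC divpK ?addrNK; first by rewrite addrC subrK.
by rewrite dvdp_XsubCl /root hornerD hornerN hornerC subrr.
Qed.

Lemma X1_neq0 : 'X + 1 != 0 :> {poly F}.
Proof. by rewrite -[1]opprK -polyC1 -polyCN polyXsubC_eq0. Qed.

Lemma divdiff_uniq G p c : G = c%:P + ('X + 1) * p -> divdiff G = p.
Proof.
move=> e; have c1 : G.[-1] = c by rewrite e !hornerE addNr mul0r addr0.
apply: (mulfI X1_neq0); apply: (addrI G.[-1]%:P).
by rewrite -divdiffE c1.
Qed.

Fact divdiff_is_linear : linear divdiff.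
Proof.
move=> a p q; apply: (@divdiff_uniq _ _ (a * p.[-1] + q.[-1])).
rewrite {1}[p]divdiffE {1}[q]divdiffE -!mul_polyC polyCD polyCM; ring.
Qed.
HB.instance Definition _ := GRing.isLinear.Build F {poly F} {poly F} _ divdiff divdiff_is_linear.

Lemma divdiffXn k : divdiff 'X^k = \sum_(i < k) (-1) ^+ i *: 'X^(k.-1 - i).
Proof.
apply: (@divdiff_uniq _ _ ((-1) ^+ k)).
have -> : ((-1) ^+ k)%:P = (-1) ^+ k :> {poly F} by rewrite polyC_exp polyCN polyC1.
have -> : \sum_(i < k) (-1) ^+ i *: 'X^(k.-1 - i) =
   \sum_(i < k) 'X^(k.-1 - i) * (-1) ^+ i :> {poly F}.
  by apply: eq_bigr => i _; rewrite -mul_polyC polyC_exp polyCN polyC1 mulrC.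
apply/eqP; rewrite addrC -subr_eq; apply/eqP.
by rewrite subrXX opprK.
Qed.

Variables (m l : nat) (alpha : 'I_m -> F).

Definition nodal : {poly F} := \prod_j ('X - (alpha j)%:P) ^+ l.

Definition pade q : {poly F} := ('X^l * q * nodal)^`N(l).

Fact pade_is_linear : linear pade.
Proof.
move=> a p q; rewrite /pade -linearP /=; congr nderivn.
by rewrite mulrDr mulrDl -scalerAr -scalerAl.
Qed.
HB.instance Definition _ := GRing.isLinear.Build F {poly F} {poly F} _ pade pade_is_linear.

Lemma monic_nodal : nodal \is monic.
Proof. by apply: monic_prod => j _; rewrite monic_exp // monicXsubC. Qed.

Lemma size_nodal : size nodal = (m * l).+1.
Proof.
rewrite size_prod => [|j _]; last by rewrite expf_neq0 // polyXsubC_eq0.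
under eq_bigr do rewrite size_exp_XsubC.
by rewrite sum_nat_const card_ord mulnS; lia.
Qed.

Lemma dvdp_nodal j : ('X - (alpha j)%:P) ^+ l %| nodal.
Proof. by rewrite /nodal (bigD1 j) //= dvdp_mulIl. Qed.

Lemma pade_rodrigues n q j :
  (primp ('X^n * pade q)).[alpha j] =
  (-1) ^+ l * 'C(n, l)%:R * (primp ('X^(n - l) * ('X^l * q * nodal))).[alpha j].
Proof.
by apply: primp_rodriguesN; rewrite ?(dvdp_mull _ (dvdp_nodal j)) // -mulrA dvdp_mulIl.
Qed.

Lemma iter_primp_deriv K s i : (i <= s)%N -> (iter s (@primp F) K)^`(i) = iter (s - i) (@primp F) K.
Proof.
elim: i s => [|i IH] s; first by rewrite subn0.
by case: s => // s si; rewrite derivSn /= deriv_primp IH.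
Qed.

(* Repeated integration by parts: the moments of the iterated primitives of K
   against low powers vanish with those of K. *)
Lemma iter_primp_moment K x s n r : (forall i, (i <= r)%N -> (primp (K * 'X^i)).[x] = 0) ->
  (s + n <= r)%N -> (primp (iter s (@primp F) K * 'X^n)).[x] = 0.
Proof.
move=> h; elim: s n => [|s IH] n; first exact: h.
move=> snr; have := IH n.+1; rewrite addnS -addSn => /(_ snr).
set U := iter s _ K; rewrite -[U in primp (U * _)]deriv_primp primp_parts ?primp_horner0 //.
rewrite hornerD hornerN hornerM.
have -> : (primp U).[x] = 0.
  by have := IH 0%N; rewrite expr0 mulr1; apply; lia.
rewrite mul0r sub0r derivXn mulrnAr linearMn /= hornerMn => /eqP.
by rewrite oppr_eq0 mulrn_eq0 /= => /eqP.
Qed.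

Lemma dvdp_exp_derivn x k u : (forall i, (i < k)%N -> u^`(i).[x] = 0) ->
  ('X - x%:P) ^+ k %| u.
Proof.
elim: k u => [|k IH] u h; first by rewrite expr0 dvd1p.
by apply: dvdp_exp_deriv; [exact: (h 0%N) | apply: IH => i ik; rewrite -derivSn h].
Qed.

Lemma dvdp_prod_XsubC_exp (s : seq F) k u : uniq s ->
  (forall x, x \in s -> ('X - x%:P) ^+ k %| u) -> \prod_(x <- s) ('X - x%:P) ^+ k %| u.
Proof.
elim: s => [|x s IH] /=; first by rewrite big_nil dvd1p.
move=> /andP[xs us] h; rewrite big_cons Gauss_dvdp; last first.
  apply: coprimep_expl; rewrite coprimep_sym coprimep_XsubC /root.
  rewrite horner_prod prodf_seq_neq0; apply/allP => y ys /=.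
  rewrite horner_exp expf_neq0 // !hornerE subr_eq0.
  by apply: contraNneq xs => ->.
rewrite h ?inE ?eqxx //=; apply: IH => // y ys; apply: h.
by rewrite inE ys orbT.
Qed.

Lemma nderivn_eq0_size u n : u^`N(n) = 0 -> (size u <= n)%N.
Proof.
move=> h; rewrite leqNgt; apply/negP => nu.
have := congr1 (fun p : {poly F} => p`_((size u).-1 - n)) h.
rewrite coef_nderivn coef0 subnKC; last by lia.
move/eqP; rewrite mulrn_eq0 -lead_coefE lead_coef_eq0 -size_poly_eq0.
by rewrite -leqn0 leqNgt bin_gt0 => /orP[/negP|/eqP u0]; [apply; lia | rewrite u0 in nu].
Qed.

Lemma pade_nonvanishing q : injective alpha -> (forall j, alpha j != 0) ->
  (size q <= m.+1)%N -> (pade q).[-1] = 0 ->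
  (forall j, (primp (divdiff (pade q))).[alpha j] = 0) -> q = 0.
Proof.
move=> inj a0 sq G1; set K := divdiff (pade q) => hK.
have GK : pade q = ('X + 1) * K by rewrite {1}[pade q]divdiffE G1 polyC0 add0r.
(* As (1 + X) K = G, the moment of K of order i + 1 is the moment of G of order i, which is 0 for i
   < l, minus that of K of order i. *)
have mom j i : (i <= l)%N -> (primp (K * 'X^i)).[alpha j] = 0.
  elim: i => [|i IH] il; first by rewrite expr0 mulr1.
  have := @pade_rodrigues i q j; rewrite bin_small // mulr0 mul0r GK.
  have -> : 'X^i * (('X + 1) * K) = K * 'X^(i.+1) + K * 'X^i by rewrite exprS; ring.
  by rewrite linearD /= hornerD IH ?addr0 // ltnW.
pose U := iter l.+1 (@primp F) K.
have Ud i : (i <= l)%N -> U^`(i) = primp (iter (l - i) (@primp F) K).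
  by move=> il; rewrite iter_primp_deriv ?subSn // ltnW.
have dvdU x : x \in 0 :: [seq alpha j | j <- enum 'I_m] -> ('X - x%:P) ^+ l.+1 %| U.
  move=> hx; apply: dvdp_exp_derivn => i il; rewrite Ud //.
  move: hx; rewrite inE => /orP[/eqP ->|/mapP[j _ ->]]; first exact: primp_horner0.
  have := @iter_primp_moment K (alpha j) (l - i) 0 l (mom j).
  by rewrite expr0 mulr1; apply; rewrite addn0 leq_subr.
have us : uniq (0 :: [seq alpha j | j <- enum 'I_m]).
  rewrite /= map_inj_uniq ?enum_uniq // andbT; apply/mapP => -[j _ /esym/eqP].
  by rewrite (negbTE (a0 j)).
have dvd := dvdp_prod_XsubC_exp us dvdU.
have sG : (size (pade q) <= m * l + m.+1)%N.
  apply/leq_sizeP => i hi; rewrite coef_nderivn nth_default ?mul0rn //.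
  have h1 := size_polyMleq ('X^l * q) nodal; rewrite size_nodal in h1.
  have h2 := size_polyMleq 'X^l q; rewrite size_polyXn in h2.
  move: h1 h2 sq hi; clear; move: (size _) (size _) (size _) (m * l)%N => *; lia.
have sK : (size K <= m * l + m)%N.
  have [->|K0] := eqVneq K 0; first by rewrite size_poly0.
  have X1 : 'X + 1 = 'X - (-1)%:P :> {poly F} by rewrite polyCN opprK polyC1.
  move: sG; rewrite GK X1 size_monicM ?monicXsubC // size_XsubC.
  by clear; move: (size _) (m * l)%N => *; lia.
have sU s : (size (iter s (@primp F) K) <= size K + s)%N.
  by elim: s => [|s IH]; rewrite ?addn0 //= (leq_trans (size_primp _)) // addnS ltnS.
(* deg U < (m + 1) (l + 1), the number of zeros counted with multiplicity. *)
have U0 : U = 0.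
  apply: contraTeq dvd => U0; apply/negP => /(dvdp_leq U0).
  have -> : size (\prod_(x <- 0 :: [seq alpha j | j <- enum 'I_m]) ('X - x%:P) ^+ l.+1) =
      (m.+1 * l.+1).+1.
    have H0 : forall s : seq F, size (\prod_(x <- s) ('X - x%:P) ^+ l.+1) =
       (size s * l.+1).+1.
      elim=> [|x s IH]; first by rewrite big_nil size_poly1.
      rewrite big_cons size_Mmonic ?expf_neq0 ?polyXsubC_eq0 //; last first.
        by apply: monic_prod => ? _; rewrite monic_exp // monicXsubC.
      by rewrite IH size_exp_XsubC /= mulSn; lia.
    by rewrite H0 /= size_map size_enum_ord.
  have := sU l.+1; rewrite -/U mulnS mulSn; move: sK; clear.
  by move: (size _) (size _) (m * l)%N => *; lia.
have K0 : K = 0.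
  have := iter_primp_deriv K (leqnn l.+1).
  by rewrite subnn -/U U0 linear0 => /esym.
have /nderivn_eq0_size : pade q = 0 by rewrite GK K0 mulr0.
have [//|q0] := eqVneq q 0.
have qn0 : q * nodal != 0 by rewrite mulf_neq0 // monic_neq0 ?monic_nodal.
have -> : size ('X^l * q * nodal) = (l.+1 + size (q * nodal)).-1.
  by rewrite -mulrA size_monicM ?size_polyXn // monicXn.
by move: qn0; rewrite -size_poly_gt0; clear; move: (size _) => n *; lia.
Qed.

(** Row mu of W holds G(-1) and the negated integrals for q = X^mu. A left kernel vector of W is the
    coefficient vector of a q for which all these values are 0, hence is 0; so W is invertible and
    cannot kill lam. *)
Lemma pade_exists (lam : 'I_m.+1 -> F) : injective alpha -> (forall j, alpha j != 0) ->
  (exists i, lam i != 0) ->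
  exists mu : 'I_m.+1, lam ord0 * (pade 'X^mu).[-1]
    - \sum_j lam (lift ord0 j) * (primp (divdiff (pade 'X^mu))).[alpha j] != 0.
Proof.
move=> inj a0 [i0 li0].
pose row q : 'rV[F]_m.+1 := \row_k (if unlift ord0 k is Some j
  then - (primp (divdiff (pade q))).[alpha j] else (pade q).[-1]).
pose W : 'M[F]_m.+1 := \matrix_mu row 'X^mu.
pose L : 'rV[F]_m.+1 := \row_k lam k.
have [[mu h]|h] := pselect (exists mu, (L *m W^T) 0 mu != 0).
  exists mu; apply: contraNneq h => h0; apply/eqP; rewrite mxE big_ord_recl -[RHS]h0.
  rewrite !mxE unlift_none -sumrN; congr (_ + _); apply: eq_bigr => j _.
  by rewrite !mxE liftK mulrN.
have /det0P/eqP : exists2 v : 'rV_m.+1, v != 0 & v *m W^T = 0.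
  exists L; first by apply: contraNneq li0 => /rowP/(_ i0); rewrite !mxE => ->.
  by apply/rowP => mu; rewrite [RHS]mxE; apply/eqP; apply: contra_notT h => h; exists mu.
rewrite det_tr => /eqP/det0P[v v0 vW]; case/negP: v0; apply/eqP.
pose q := \sum_(mu < m.+1) v 0 mu *: 'X^mu : {poly F}.
have sq : (size q <= m.+1)%N.
  apply: leq_trans (size_sum _ _ _) _; apply/bigmax_leqP => mu _.
  by rewrite (leq_trans (size_scale_leq _ _)) // size_polyXn.
have vq k : (v *m W) 0 k = row q 0 k.
  rewrite !mxE /q; case: unliftP => [j|] ->.
    rewrite linear_sum /= !linear_sum /= horner_sum -sumrN; apply: eq_bigr => mu _.
    by rewrite !mxE liftK !linearZ /= hornerZ mulrN.
  rewrite linear_sum /= horner_sum; apply: eq_bigr => mu _.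
  by rewrite !mxE unlift_none linearZ /= hornerZ.
have q0 : q = 0.
  apply: pade_nonvanishing => //; first by have := vq ord0; rewrite vW !mxE unlift_none.
  move=> j; have := vq (lift ord0 j); rewrite vW !mxE liftK => /esym/eqP.
  by rewrite oppr_eq0 => /eqP.
apply/rowP => mu; rewrite mxE -[RHS](coef0 F mu) -q0 /q coef_sum (bigD1 mu) //=.
rewrite coefZ coefXn eqxx mulr1 big1 ?addr0 // => k /negbTE kmu.
by rewrite coefZ coefXn eq_sym [_ == _]kmu mulr0.
Qed.

End Pade.

(** * Coefficients, size and denominators of the approximations *)

Section PadeCoefficients.
Variable F : numFieldType.
Implicit Types (x : F).

Lemma primpXn k : primp 'X^k = k.+1%:R^-1 *: 'X^(k.+1) :> {poly F}.
Proof.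
apply/polyP => i; rewrite coef_primp coefZ !coefXn.
case: i => [|i]; first by rewrite invr0 !mulr0.
by rewrite eqSS /=; case: (i =P k) => [->|_]; rewrite ?mulr0 ?mul0r // mul1r mulr1.
Qed.

Lemma primp_divdiffXn k x :
  (primp (divdiff 'X^k)).[x] = \sum_(i < k) (-1) ^+ i * x ^+ (k - i) / (k - i)%:R.
Proof.
rewrite divdiffXn linear_sum horner_sum; apply: eq_bigr => i _.
have -> : (k - i = (k.-1 - i).+1)%N by have := ltn_ord i; lia.
by rewrite linearZ /= primpXn !hornerZ hornerXn [_^-1 * _]mulrC mulrA.
Qed.

Variables (m l : nat) (alpha : 'I_m -> F).
Let N := (m * l)%N.

Lemma nodal_sum : nodal l alpha = \sum_(i < N.+1) (nodal l alpha)`_i *: 'X^i.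
Proof. by rewrite -[LHS]coefK poly_def size_nodal. Qed.

Lemma padeXn mu : pade l alpha 'X^mu =
  \sum_(i < N.+1) ((nodal l alpha)`_i * 'C(i + mu + l, l)%:R) *: 'X^(i + mu).
Proof.
rewrite /pade {1}nodal_sum mulr_sumr linear_sum; apply: eq_bigr => i _ /=.
rewrite -scalerAr linearZ /= -!exprD nderivnXn -[in RHS]scalerA; congr (_ *: _).
by rewrite scaler_nat; congr ('X^ _ *+ 'C(_, _)); lia.
Qed.

Lemma pade_horner_m1 mu : (pade l alpha 'X^mu).[-1] =
  \sum_(i < N.+1) (nodal l alpha)`_i * 'C(i + mu + l, l)%:R * (-1) ^+ (i + mu).
Proof. by rewrite padeXn horner_sum; apply: eq_bigr => i _; rewrite !hornerE. Qed.

Lemma pade_primp_divdiff mu x : (primp (divdiff (pade l alpha 'X^mu))).[x] =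
  \sum_(i < N.+1) (nodal l alpha)`_i * 'C(i + mu + l, l)%:R
    * \sum_(s < i + mu) (-1) ^+ s * x ^+ (i + mu - s) / (i + mu - s)%:R.
Proof.
rewrite padeXn !linear_sum horner_sum; apply: eq_bigr => i _.
by rewrite !linearZ /= hornerZ primp_divdiffXn.
Qed.

(** Listing the roots with multiplicity lets each coefficient estimate proceed by induction over
    linear factors. *)
Lemma nodal_factors : exists s : seq F, [/\ size s = N, {subset s <= codom alpha}
  & nodal l alpha = \prod_(x <- s) ('X - x%:P)].
Proof.
exists (flatten [seq nseq l (alpha j) | j <- enum 'I_m]); split.
- rewrite size_flatten /shape -map_comp sumnE big_map.
  under eq_bigr do rewrite /= size_nseq.
  by rewrite big_const_seq count_predT size_enum_ord iter_addn_0 mulnC.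
- move=> x /flattenP[_ /mapP[j _ ->]] /nseqP[-> _]; exact: codom_f.
rewrite big_flatten big_map /nodal /= -big_enum /=; apply: eq_bigr => j _.
by rewrite big_nseq -[iter _ _ _]/(iter l ( *%R _) 1) iter_mulr_1.
Qed.

End PadeCoefficients.

(** Two neighbours are bounded together to save a factor 2 in [bin_le_exp2_pred]; it is the source
    of 2^(m-1), rather than 2^m, in R_1. *)
Lemma bin_add_le_exp2 n k : ('C(n, k) + 'C(n, k.+1) <= 2 ^ n)%N.
Proof.
elim: n k => [|n IH] [|k] //.
  rewrite bin0 bin1 expnS; have := ltn_expl n (isT : 1 < 2)%N; lia.
by rewrite !binS expnS; have := IH k; have := IH k.+1; lia.
Qed.

Lemma bin_le_exp2_pred n k : (0 < k)%N -> ('C(n, k) <= 2 ^ n.-1)%N.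
Proof. by case: n k => [|n] [|k] // _; rewrite binS addnC bin_add_le_exp2. Qed.

Section RootProducts.
Variable F : realFieldType.

Lemma coefXsubCM (x : F) (P : {poly F}) i :
  (('X - x%:P) * P)`_i = (if i is i'.+1 then P`_i' else 0) - x * P`_i.
Proof. by rewrite mulrBl coefB coefXM coefCM; case: i. Qed.

(** Majorization by the coefficients of (X + M)^n. *)
Lemma coef_prod_XsubC_le (M : F) (s : seq F) i : (forall x, x \in s -> `|x| <= M) ->
  `|(\prod_(x <- s) ('X - x%:P))`_i| <= 'C(size s, i)%:R * M ^+ (size s - i).
Proof.
elim: s i => [|x s IH] i h.
  by rewrite big_nil coef1 bin0n sub0n expr0 mulr1; case: (i == 0)%N; rewrite ?normr1 ?normr0.
have xM : `|x| <= M by apply: h; rewrite mem_head.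
have M0 : 0 <= M := le_trans (normr_ge0 _) xM.
have {}IH k := IH k (fun y ys => h y (@mem_behead _ (x :: s) y ys)).
rewrite big_cons coefXsubCM /=; apply: le_trans (ler_normB _ _) _; rewrite normrM.
have hx : `|x| * `|(\prod_(y <- s) ('X - y%:P))`_i| <= 'C(size s, i)%:R * M ^+ ((size s).+1 - i).
  apply: le_trans (ler_pM _ _ xM (IH i)) _ => //.
  have [is_|si] := leqP i (size s); first by rewrite subSn // exprS mulrCA.
  by rewrite bin_small // !mul0r mulr0.
case: i hx => [|i] hx.
  by rewrite normr0 add0r bin0 -[in leRHS](bin0 (size s)).
by rewrite subSS binS natrD mulrDl addrC lerD // -subSS.
Qed.

End RootProducts.

Section PadeSize.
Variables (F : realFieldType) (m l : nat) (alpha : 'I_m -> F) (M : F).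
Hypotheses (l0 : (0 < l)%N) (M1 : 1 < M) (alphaM : forall j, `|alpha j| <= M).
Let N := (m * l)%N.

Definition pade_bound : F := 2 ^+ (l + m).-1 * 3 ^+ N * M ^+ N * (M ^+ m.+1 / (M - 1)).

Let M0 : 0 < M. Proof. exact: lt_trans M1. Qed.
Let M10 : 0 < M - 1. Proof. by rewrite subr_gt0. Qed.

Lemma coef_nodal_le i : `|(nodal l alpha)`_i| <= 'C(N, i)%:R * M ^+ (N - i).
Proof.
rewrite /N; have [s [<- sub ->]] := nodal_factors l alpha.
by apply: coef_prod_XsubC_le => x /sub /codomP[j ->].
Qed.

(** Both G(-1) and the integrals of K have this form. The 2^i split off the binomial coefficient is
    summed against C(N, i) to give 3^N, and the M^i in T completes M^(N - i) to M^N. *)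
Lemma pade_sum_le (mu : nat) (T : nat -> F) : (mu <= m)%N ->
  (forall k, `|T k| <= M ^+ k.+1 / (M - 1)) ->
  `|\sum_(i < N.+1) (nodal l alpha)`_i * 'C(i + mu + l, l)%:R * T (i + mu)%N| <= pade_bound.
Proof.
move=> mum hT; apply: le_trans (ler_norm_sum _ _ _) _.
have e3 : \sum_(i < N.+1) ('C(N, i)%:R * 2 ^+ i) = 3 ^+ N :> F.
  have -> : 3 = 1 + 2 :> F by rewrite -(natrD _ 1 2).
  by rewrite exprDn; apply: eq_bigr => i _; rewrite expr1n mul1r mulr_natl.
apply: le_trans (_ : \sum_(i < N.+1) ('C(N, i)%:R * 2 ^+ i) *
   (2 ^+ (mu + l).-1 * M ^+ N * (M ^+ mu.+1 / (M - 1))) <= _).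
  apply: ler_sum => i _; rewrite !normrM normr_nat.
  have iN : (i <= N)%N by rewrite -ltnS.
  have -> : 'C(N, i)%:R * 2 ^+ i * (2 ^+ (mu + l).-1 * M ^+ N * (M ^+ mu.+1 / (M - 1))) =
     'C(N, i)%:R * M ^+ (N - i) * 2 ^+ (i + mu + l).-1 * (M ^+ (i + mu).+1 / (M - 1)).
    have -> : M ^+ N = M ^+ (N - i) * M ^+ i by rewrite -exprD subnK.
    have -> : (i + mu).+1 = (i + mu.+1)%N by rewrite addnS.
    have -> : (i + mu + l).-1 = (i + (mu + l).-1)%N by lia.
    by rewrite !exprD; ring.
  apply: (ler_pM _ _ _ (hT _)); rewrite ?mulr_ge0 ?normr_ge0 ?ler0n //.
  apply: (ler_pM _ _ (coef_nodal_le _)); rewrite ?normr_ge0 ?ler0n //.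
  by rewrite -natrX ler_nat bin_le_exp2_pred.
rewrite -big_distrl /= e3 /pade_bound.
have -> : 2 ^+ (l + m).-1 * 3 ^+ N * M ^+ N * (M ^+ m.+1 / (M - 1)) =
   3 ^+ N * (2 ^+ (l + m).-1 * M ^+ N * (M ^+ m.+1 / (M - 1))) by ring.
rewrite ler_pM2l ?exprn_gt0 //.
have h2 : 0 <= 2 ^+ (mu + l).-1 :> F by rewrite exprn_ge0.
have hM := ltW M0.
apply: ler_pM; rewrite ?mulr_ge0 ?invr_ge0 ?exprn_ge0 // ?(ltW M10) //.
  by rewrite ler_wpM2r ?exprn_ge0 // ler_weXn2l ?ler1n //; lia.
by rewrite ler_wpM2r ?invr_ge0 ?(ltW M10) // ler_weXn2l // ltW.
Qed.

Lemma geometric_le k : \sum_(s < k) M ^+ (k - s) <= M ^+ k.+1 / (M - 1).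
Proof.
rewrite ler_pdivlMr // mulrC.
have -> : \sum_(s < k) M ^+ (k - s) = \sum_(s < k) M ^+ (s.+1).
  rewrite (reindex_inj rev_ord_inj); apply: eq_bigr => s _ /=; congr (_ ^+ _).
  by have := ltn_ord s; lia.
under eq_bigr do rewrite exprS.
rewrite -big_distrr /= mulrCA -subrX1 exprS mulrBr mulr1.
by rewrite lerBlDr lerDl ltW.
Qed.

Lemma pade_horner_m1_le (mu : nat) : (mu <= m)%N -> `|(pade l alpha 'X^mu).[-1]| <= pade_bound.
Proof.
move=> mum; rewrite pade_horner_m1; apply: (@pade_sum_le mu (fun k => (-1) ^+ k)) => // k.
rewrite normrX normrN1 expr1n ler_pdivlMr // mul1r.
rewrite -(lerD2r 1) subrK; apply: le_trans (ler_weXn2l (ltW M1) (ltn0Sn k)) _.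
by rewrite lerDl.
Qed.

Lemma pade_primp_divdiff_le (mu : nat) x : (mu <= m)%N -> `|x| <= M ->
  `|(primp (divdiff (pade l alpha 'X^mu))).[x]| <= pade_bound.
Proof.
move=> mum xM; rewrite pade_primp_divdiff.
pose T k := \sum_(s < k) (-1) ^+ s * x ^+ (k - s) / (k - s)%:R.
apply: (@pade_sum_le mu T) => // k.
apply: le_trans (ler_norm_sum _ _ _) _; apply: le_trans (geometric_le k).
apply: ler_sum => s _; rewrite !normrM normrX normrN1 expr1n mul1r normrX.
rewrite normrV ?unitfE; last first.
  by rewrite pnatr_eq0; have := ltn_ord s; lia.
rewrite normr_nat ler_pdivrMr; last by rewrite ltr0n; have := ltn_ord s; lia.
apply: le_trans (lerXn2r _ _ _ xM) _; rewrite ?nnegrE //; first exact: ltW.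
rewrite ler_peMr ?exprn_ge0 ?(ltW M0) // ler1n; have := ltn_ord s; lia.
Qed.

End PadeSize.

Section PadeDenominators.
Variables (m l : nat) (alpha : 'I_m -> rat) (Q : int).
Hypothesis Qalpha : forall j, Q%:~R * alpha j \is a Num.int.
Let N := (m * l)%N.

Lemma coef_prod_XsubC_int (s : seq rat) i : (forall x, x \in s -> Q%:~R * x \is a Num.int) ->
  Q%:~R ^+ (size s - i) * (\prod_(x <- s) ('X - x%:P))`_i \is a Num.int.
Proof.
elim: s i => [|x s IH] i h; first by rewrite big_nil coef1 sub0n mul1r; case: (i == 0)%N.
have hx : Q%:~R * x \is a Num.int by apply: h; rewrite mem_head.
have {}IH k := IH k (fun y ys => h y (@mem_behead _ (x :: s) y ys)).
rewrite big_cons coefXsubCM /= mulrBr; set P := \prod_(y <- s) _ in IH *.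
apply: rpredB; first by case: i => [|i]; rewrite ?mulr0 // subSS.
have [is_|si] := leqP i (size s).
  by rewrite subSn // exprS mulrACA rpredM.
by rewrite nth_default ?mulr0 // /P size_prod_XsubC.
Qed.

Lemma coef_nodal_int i : Q%:~R ^+ (N - i) * (nodal l alpha)`_i \is a Num.int.
Proof.
rewrite /N; have [s [<- sub ->]] := nodal_factors l alpha.
by apply: coef_prod_XsubC_int => x /sub /codomP[j ->].
Qed.

Let D : rat := (lcm_upto (N + m))%:R.

Let D_int : D \is a Num.int. Proof. exact: rpred_nat. Qed.

Lemma pade_horner_m1_int (mu : nat) : (mu <= m)%N ->
  D * Q%:~R ^+ (N + m) * (pade l alpha 'X^mu).[-1] \is a Num.int.
Proof.
move=> mum; rewrite pade_horner_m1 mulr_sumr; apply: rpred_sum => i _.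
have iN : (i <= N)%N by rewrite -ltnS.
have -> : (N + m = (i + m) + (N - i))%N by lia.
have -> : forall b c d, D * Q%:~R ^+ (i + m + (N - i)) * (c * b * d) =
  D * Q%:~R ^+ (i + m) * (Q%:~R ^+ (N - i) * c) * b * d.
  by move=> b c d; rewrite exprD; ring.
move: (coef_nodal_int i); set z := _ * _ => hz; clearbody z.
by rewrite !rpredM ?D_int ?rpredX ?rpredN ?rpred1 ?rpred_nat ?intr_int.
Qed.

(** Q^(N - i) clears the coefficient of [nodal], Q^k clears alpha_j^k, and the lcm clears 1 / k
    because k <= i + mu <= N + m. *)
Lemma pade_primp_divdiff_int (mu : nat) j : (mu <= m)%N ->
  D * Q%:~R ^+ (N + m) * (primp (divdiff (pade l alpha 'X^mu))).[alpha j] \is a Num.int.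
Proof.
move=> mum; rewrite pade_primp_divdiff mulr_sumr; apply: rpred_sum => i _.
have iN : (i <= N)%N by rewrite -ltnS.
rewrite mulr_sumr mulr_sumr; apply: rpred_sum => s _.
have sk := ltn_ord s; set k := (i + mu - s)%N.
have /dvdnP[d ed] : (k %| lcm_upto (N + m))%N by apply: dvdn_lcm_upto; rewrite /k; lia.
have k0 : k%:R != 0 :> rat by rewrite pnatr_eq0 /k; lia.
have -> : (N + m = (m + i - k) + k + (N - i))%N by rewrite /k; lia.
have -> : forall b c e,
  D * Q%:~R ^+ (m + i - k + k + (N - i)) * (c * b * (e * alpha j ^+ k / k%:R)) =
  (D / k%:R) * Q%:~R ^+ (m + i - k) * (Q%:~R ^+ (N - i) * c) * b * e * (Q%:~R * alpha j) ^+ k.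
  by move=> b c e; rewrite !exprD exprMn; ring.
have -> : D / k%:R = d%:R by rewrite /D ed natrM mulfK.
move: (coef_nodal_int i) (Qalpha j); set z := _ * _; set z' := _ * _ => hz hz'; clearbody z z'.
by rewrite !rpredM ?D_int ?rpredX ?rpredN ?rpred1 ?rpred_nat ?intr_int.
Qed.

End PadeDenominators.

(** * p-adic estimates *)

Section PadicNormBounds.
Variables (p : nat) (p_pr : prime p).
Implicit Types (x : rat) (k n : nat).
Local Notation normp := (padic_norm p).

Lemma padic_norm_intr (z : int) : z != 0 -> normp z%:~R = (p%:R ^+ logn p `|z|)^-1.
Proof.
move=> z0; rewrite /padic_norm intr_eq0 (negbTE z0).
have -> : z%:~R = z%:~R / 1%:~R :> rat by rewrite divr1.
by rewrite padic_valE // absz1 logn1 subr0 -exprnN.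
Qed.

Lemma padic_norm_int x : x \is a Num.int -> normp x <= 1.
Proof.
move=> /intrP[z ->]; have [->|z0] := eqVneq z 0; first by rewrite padic_norm0.
rewrite padic_norm_intr // invf_le1 ?exprn_gt0 ?ltr0n ?prime_gt0 //.
by rewrite exprn_ege1 // ler1n prime_gt0.
Qed.

(** The p-part of z divides z: the Liouville inequality behind the final lower bound. *)
Lemma padic_norm_int_ge (z : int) : z != 0 -> `|z%:~R|^-1 <= normp z%:~R.
Proof.
move=> z0; rewrite padic_norm_intr // lef_pV2 ?posrE ?normr_gt0 ?intr_eq0 //; last first.
  by rewrite exprn_gt0 ?ltr0n ?prime_gt0.
have az : (0 < `|z|)%N by rewrite absz_gt0.
rewrite -natrX -intr_norm -abszE -pmulrn ler_nat.
by apply: dvdn_leq => //; exact: pfactor_dvdnn.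
Qed.

Lemma padic_normV x : normp x^-1 = (normp x)^-1.
Proof.
have [->|x0] := eqVneq x 0; first by rewrite invr0 padic_norm0.
have nx : normp x != 0 by rewrite padic_norm_eq0.
by apply: (mulfI nx); rewrite -padic_normM // !mulfV // padic_norm1.
Qed.

Lemma padic_normX x k : normp (x ^+ k) = normp x ^+ k.
Proof.
elim: k => [|k IH]; first by rewrite padic_norm1.
by rewrite !exprS padic_normM // IH.
Qed.

Lemma padic_norm_inv_nat_le k : normp k%:R^-1 <= k%:R.
Proof.
have [->|k0] := posnP k; first by rewrite invr0 padic_norm0.
have kz : k%:Z != 0 by case: k k0.
rewrite padic_normV -[leRHS]invrK lef_pV2 ?posrE ?invr_gt0 ?ltr0n //.
  by have := padic_norm_int_ge kz; rewrite -pmulrn ger0_norm ?ler0n.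
by rewrite lt_neqAle eq_sym padic_norm_eq0 // pnatr_eq0 -lt0n k0 padic_norm_ge0.
Qed.

Lemma padic_norm_sum_le (I : Type) (s : seq I) (P : pred I) (f : I -> rat) B : 0 <= B ->
  (forall i, P i -> normp (f i) <= B) -> normp (\sum_(i <- s | P i) f i) <= B.
Proof.
move=> B0 h; apply: (big_ind (fun x => normp x <= B)) => //.
by move=> x y hx hy; apply: le_trans (padic_norm_ultra p_pr _ _) _; rewrite ge_max hx hy.
Qed.

(** Nonzero values are powers of p, so those below 1 are at most 1 / p; 1/2 serves for all p. *)
Lemma padic_norm_lt1 x : normp x < 1 -> normp x <= 1 / 2.
Proof.
rewrite /padic_norm; case: eqP => // _; set v := padic_val p x.
have p2 : 2 <= p%:R :> rat by rewrite (ler_nat _ 2) prime_gt1.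
case: (- v) => n; last first.
  move=> _; rewrite -[_ ^ _]/((p%:R ^+ n.+1)^-1) mul1r lef_pV2 ?posrE ?exprn_gt0 //; last lra.
  by rewrite exprS; apply: (le_trans p2); rewrite ler_peMr ?ler0n // exprn_ege1 //; lra.
by rewrite -exprnP ltNge exprn_ege1 //; lra.
Qed.

(** As K + t + 1 <= 2 (K + t), each factor a absorbs one step of the linear growth; so later moments
    obey the bound of the first nonzero one. *)
Lemma exp_half_le (a : rat) K t : 0 <= a <= 1 / 2 -> (0 < K)%N ->
  a ^+ t * (K + t)%:R <= K%:R.
Proof.
move=> /andP[a0 a2] K0; elim: t => [|t IH]; first by rewrite mul1r addn0.
apply: le_trans IH; rewrite exprSr -mulrA ler_wpM2l ?exprn_ge0 //.
apply: le_trans (ler_wpM2r (ler0n _ _) a2) _.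
rewrite mul1r ler_pdivrMl // -natrM ler_nat; lia.
Qed.

Lemma sqrn_le_exp2 k : (k ^ 2 <= 2 ^ k.+1)%N.
Proof.
elim: k => // k IH; have [k3|k3] := leqP 3 k; last by case: k k3 {IH} => [|[|[|]]].
by rewrite expnS; apply: leq_trans (leq_mul (leqnn 2) IH); nia.
Qed.

(** The size of 1 / k is at most k, and k / 2^k <= 2 / k: an explicit null sequence for the
    logarithmic series. *)
Lemma padic_norm_pow_div_le x k : normp x <= 1 / 2 -> (0 < k)%N ->
  normp (x ^+ k / k%:R) <= 2 / k%:R.
Proof.
move=> x2 k0; have kp : 0 < k%:R :> rat by rewrite ltr0n.
rewrite padic_normM // padic_normX.
have h1 : normp x ^+ k <= (1 / 2) ^+ k.
  by apply: lerXn2r => //; rewrite nnegrE ?padic_norm_ge0.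
apply: le_trans (ler_pM _ _ h1 (padic_norm_inv_nat_le k)) _.
- by rewrite exprn_ge0 ?padic_norm_ge0.
- exact: padic_norm_ge0.
rewrite ler_pdivlMr // mul1r exprVn -mulrA ler_pdivrMl ?exprn_gt0 //.
by rewrite -natrX -!natrM ler_nat mulnn mulnC -expnS sqrn_le_exp2.
Qed.

Variables (m l : nat) (alpha : 'I_m -> rat) (a : rat).
Hypotheses (a0 : 0 <= a) (a2 : a <= 1 / 2) (alpha_a : forall j, normp (alpha j) <= a).
Let N := (m * l)%N.

Let a1 : a <= 1. Proof. by apply: le_trans a2 _. Qed.

Lemma coef_nodal_padic i : (i <= N)%N -> normp (nodal l alpha)`_i <= a ^+ (N - i).
Proof.
rewrite /N; have [s [<- sub ->]] := nodal_factors l alpha.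
have hs x : x \in s -> normp x <= a by move=> /sub /codomP[j ->].
elim: s {sub} i hs => [|x s IH] i hs; first by case: i => // _; rewrite big_nil coef1 padic_norm1.
have hx : normp x <= a by apply: hs; rewrite mem_head.
have {}IH k ks := IH k (fun y ys => hs y (@mem_behead _ (x :: s) y ys)) ks.
rewrite big_cons coefXsubCM /= => is_.
apply: le_trans (padic_norm_ultra p_pr _ _) _; rewrite ge_max padic_normN; apply/andP; split.
  by case: i is_ => [|i] is_; rewrite ?padic_norm0 ?exprn_ge0 // subSS IH.
have [i_s|si] := leqP i (size s).
  rewrite padic_normM // subSn // exprS.
  by apply: ler_pM; rewrite ?padic_norm_ge0 // IH.
by rewrite nth_default ?mulr0 ?padic_norm0 ?exprn_ge0 // size_prod_XsubC.
Qed.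

Definition pade_remainder : rat := (m.+1 * l).+1%:R * a ^+ (m.+1 * l).+1.

Lemma pade_moment_padic n (mu : nat) j :
  normp (primp ('X^n * pade l alpha 'X^mu)).[alpha j] <= pade_remainder.
Proof.
have rem0 : 0 <= pade_remainder by rewrite mulr_ge0 ?exprn_ge0.
rewrite pade_rodrigues; have [nl|ln] := ltnP n l.
  by rewrite bin_small // mulr0 mul0r padic_norm0.
rewrite padic_normM //.
have h1 : normp ((-1) ^+ l * 'C(n, l)%:R) <= 1.
  by apply: padic_norm_int; rewrite rpredM ?rpredX ?rpredN ?rpred1 ?rpred_nat.
apply: le_trans (ler_wpM2r (padic_norm_ge0 p_pr _) h1) _; rewrite mul1r.
have -> : 'X^(n - l) * ('X^l * 'X^mu * nodal l alpha) =
   \sum_(i < N.+1) (nodal l alpha)`_i *: 'X^(n + mu + i) :> {poly rat}.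
  rewrite {1}nodal_sum !mulrA -!exprD subnK // mulr_sumr.
  by apply: eq_bigr => i _; rewrite -scalerAr -exprD.
rewrite linear_sum horner_sum; apply: padic_norm_sum_le => // i _.
rewrite linearZ /= primpXn !hornerZ hornerXn [_^-1 * _]mulrC.
have iN : (i <= N)%N by rewrite -ltnS.
rewrite !padic_normM // padic_normX.
set k := (n + mu + i).+1.
have h2 : normp (alpha j) ^+ k <= a ^+ k.
  by apply: lerXn2r; rewrite ?nnegrE ?padic_norm_ge0.
have h3 := padic_norm_inv_nat_le k.
have h4 : normp (alpha j) ^+ k * normp k%:R^-1 <= a ^+ k * k%:R.
  by apply: ler_pM; rewrite ?exprn_ge0 ?padic_norm_ge0.
apply: le_trans (ler_pM _ _ (coef_nodal_padic iN) h4) _.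
- exact: padic_norm_ge0.
- by rewrite mulr_ge0 ?exprn_ge0 ?padic_norm_ge0.
(* t is the excess of the exponent N - i + k over (m + 1) l + 1. *)
pose t := (n - l + mu)%N.
have -> : a ^+ (N - i) * (a ^+ k * k%:R) = a ^+ (m.+1 * l).+1 * (a ^+ t * k%:R).
  rewrite !mulrA -!exprD; congr (a ^+ _ * _); rewrite /k /t mulSn -/N; lia.
rewrite mulrC /pade_remainder ler_wpM2r ?exprn_ge0 //.
apply: le_trans (_ : a ^+ t * ((m.+1 * l).+1 + t)%:R <= _).
  rewrite ler_wpM2l ?exprn_ge0 // ler_nat /k /t mulSn -/N; lia.
by apply: exp_half_le; rewrite ?a0.
Qed.

End PadicNormBounds.

(** * The logarithmic series and its approximation *)

Section LogRemainder.
Variables (p : nat) (p_pr : prime p).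
Implicit Types (x : rat) (k n : nat).
Local Notation normp := (padic_norm p).

Definition log_sum n x : rat := \sum_(0 <= k < n) (-1) ^+ k / k.+1%:R * x ^+ k.+1.

(** The expansion of G / (1 + X) stopped after n terms, with exact remainder. The induction step
    integrates X^n G = G(-1) X^n + X^n (1 + X) K. *)
Lemma log_sum_divdiff (G : {poly rat}) n x :
  G.[-1] * log_sum n x + (primp (divdiff G)).[x] =
  \sum_(0 <= k < n) (-1) ^+ k * (primp ('X^k * G)).[x]
  + (-1) ^+ n * (primp (divdiff G * 'X^n)).[x].
Proof.
elim: n => [|n IH]; first by rewrite /log_sum !big_geq // mulr0 !add0r expr0 mul1r mulr1.
rewrite /log_sum !big_nat_recr //= -/(log_sum n x) mulrDr addrAC IH.
have e : G.[-1] * (x ^+ n.+1 / n.+1%:R) = (primp ('X^n * G)).[x]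
    - (primp (divdiff G * 'X^(n.+1))).[x] - (primp (divdiff G * 'X^n)).[x].
  have -> : x ^+ n.+1 / n.+1%:R = (primp ('X^n : {poly rat})).[x].
    by rewrite primpXn hornerZ hornerXn mulrC.
  rewrite -!hornerN -!hornerD -!linearB /= -hornerZ -linearZ /=; congr (_.[x]); congr primp.
  by rewrite {2}(divdiffE G) -mul_polyC exprS; ring.
have -> : G.[-1] * ((-1) ^+ n / n.+1%:R * x ^+ n.+1) = (-1) ^+ n * (G.[-1] * (x ^+ n.+1 / n.+1%:R)).
  by ring.
by rewrite e [(-1) ^+ n.+1]exprS; ring.
Qed.

(** Makes the remainder in [log_sum_divdiff] tend to 0. *)
Lemma primp_mulXn_padic (P : {poly rat}) n x : (forall i, normp P`_i <= 1) -> normp x <= 1 / 2 ->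
  normp (primp (P * 'X^n)).[x] <= 2 / n.+1%:R.
Proof.
move=> hP hx; have c0 : 0 <= 2 / n.+1%:R :> rat by rewrite divr_ge0.
have -> : P * 'X^n = \sum_(i < size P) P`_i *: 'X^(i + n).
  rewrite -{1}[P]coefK poly_def mulr_suml; apply: eq_bigr => i _.
  by rewrite -scalerAl -exprD.
rewrite linear_sum horner_sum; apply: padic_norm_sum_le => // i _.
rewrite linearZ /= primpXn !hornerZ hornerXn [_^-1 * _]mulrC padic_normM //.
apply: le_trans (ler_wpM2r (padic_norm_ge0 p_pr _) (hP i)) _; rewrite mul1r.
apply: le_trans (padic_norm_pow_div_le p_pr hx (ltn0Sn _)) _.
rewrite ler_wpM2l // lef_pV2 ?posrE ?ltr0n // ler_nat; lia.
Qed.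

Lemma log_sum_dist i j x : normp x <= 1 / 2 -> (i <= j)%N ->
  normp (log_sum j x - log_sum i x) <= 2 / i.+1%:R.
Proof.
move=> hx ij; rewrite /log_sum (@big_cat_nat _ _ _ i) //= [_ + \sum_(i <= k < j) _]addrC addrK.
rewrite big_nat_cond; apply: padic_norm_sum_le => // k /andP[/andP[ik _] _].
rewrite -mulrA [_^-1 * _]mulrC padic_normM // padic_normX //.
rewrite padic_normN padic_norm1 expr1n mul1r.
apply: le_trans (padic_norm_pow_div_le p_pr hx (ltn0Sn _)) _.
by rewrite ler_wpM2l // lef_pV2 ?posrE ?ltr0n // ler_nat.
Qed.

Variables (m l : nat) (alpha : 'I_m -> rat) (a : rat).
Hypotheses (a0 : 0 <= a) (a2 : a <= 1 / 2) (alpha_a : forall j, normp (alpha j) <= a).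

Lemma coef_nodal_padic_le1 i : normp (nodal l alpha)`_i <= 1.
Proof.
have [iN|Ni] := leqP i (m * l).
  apply: le_trans (coef_nodal_padic p_pr a0 alpha_a iN) _.
  by rewrite exprn_ile1 //; apply: le_trans a2 _.
by rewrite nth_default ?padic_norm0 // size_nodal.
Qed.

Lemma pade_horner_m1_padic (mu : nat) : normp (pade l alpha 'X^mu).[-1] <= 1.
Proof.
rewrite pade_horner_m1; apply: padic_norm_sum_le => // i _.
rewrite -mulrA padic_normM //; apply: mulr_ile1; rewrite ?padic_norm_ge0 ?coef_nodal_padic_le1 //.
by apply: padic_norm_int; rewrite // rpredM ?rpredX ?rpredN ?rpred1 ?rpred_nat.
Qed.

Lemma coef_divdiff_pade_padic (mu i : nat) : normp (divdiff (pade l alpha 'X^mu))`_i <= 1.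
Proof.
rewrite padeXn linear_sum coef_sum; apply: padic_norm_sum_le => // k _.
rewrite linearZ coefZ /= -mulrA padic_normM //.
apply: mulr_ile1; rewrite ?padic_norm_ge0 ?coef_nodal_padic_le1 //.
apply: padic_norm_int => //; rewrite rpredM ?rpred_nat // divdiffXn coef_sum.
by apply: rpred_sum => s _; rewrite coefZ coefXn rpredM ?rpredX ?rpredN ?rpred1 ?rpred_nat.
Qed.

Lemma log_sum_pade_padic n (mu : nat) j :
  normp ((pade l alpha 'X^mu).[-1] * log_sum n (alpha j)
    + (primp (divdiff (pade l alpha 'X^mu))).[alpha j])
  <= Num.max (pade_remainder m l a) (2 / n.+1%:R).
Proof.
have rem0 : 0 <= pade_remainder m l a by rewrite mulr_ge0 ?exprn_ge0.
have sg k y : normp ((-1) ^+ k * y) = normp y.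
  by rewrite padic_normM // padic_normX // padic_normN padic_norm1 expr1n mul1r.
rewrite log_sum_divdiff; apply: le_trans (padic_norm_ultra p_pr _ _) _.
rewrite ge_max !le_max; apply/andP; split; apply/orP; [left | right].
  by apply: padic_norm_sum_le => // k _; rewrite sg; exact: pade_moment_padic.
rewrite sg; apply: primp_mulXn_padic; first exact: coef_divdiff_pade_padic.
exact: le_trans (alpha_a j) a2.
Qed.

End LogRemainder.

Section PadicLogarithm.
Variables (R : realType) (p : nat) (p_pr : prime p).
Local Notation K := (Qp p_pr).
Local Notation absp := (padic_abs R).

(** A named copy of [ratr], to which the ring morphism structure is attached. *)
Definition qp_of_rat (x : rat) : K := ratr x.

Fact qp_of_rat_is_zmod_morphism : zmod_morphism qp_of_rat.
Proof.
by move=> x y; rewrite /qp_of_rat -!pi_cst -rmorphB; congr (\pi_K%qT _); apply/val_inj.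
Qed.

Fact qp_of_rat_is_monoid_morphism : monoid_morphism qp_of_rat.
Proof.
split=> [|x y]; rewrite /qp_of_rat -!pi_cst.
  by rewrite -(rmorph1 (\pi_K%qT : cauchy_seq p_pr -> K)); congr (\pi_K%qT _); apply/val_inj.
by rewrite -rmorphM; congr (\pi_K%qT _); apply/val_inj.
Qed.

HB.instance Definition _ := GRing.isZmodMorphism.Build rat K qp_of_rat qp_of_rat_is_zmod_morphism.
HB.instance Definition _ :=
  GRing.isMonoidMorphism.Build rat K qp_of_rat qp_of_rat_is_monoid_morphism.

Lemma padic_abs_qp x : absp (qp_of_rat x) = ratr (padic_norm p x).
Proof. exact: padic_abs_rat. Qed.

Lemma padic_abs_sum_le (I : Type) (s : seq I) (P : pred I) (f : I -> K) (B : R) : 0 <= B ->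
  (forall i, P i -> absp (f i) <= B) -> absp (\sum_(i <- s | P i) f i) <= B.
Proof.
move=> B0 h; apply: (big_ind (fun x => absp x <= B)) => //; first by rewrite padic_abs0.
by move=> x y hx hy; apply: le_trans (padic_abs_ultra _ _ _) _; rewrite ge_max hx hy.
Qed.

Lemma log_sum_cvg x : padic_norm p x < 1 ->
  padic_cvg R (fun n => qp_of_rat (log_sum n x)) (padic_log R (1 + ratr x)).
Proof.
move=> /padic_norm_lt1 - /(_ p_pr) x2.
have [c hc] : exists c : K, padic_cvg R (fun n => qp_of_rat (log_sum n x)) c.
  apply: Qp_complete => e e0; have [n hn] : exists n : nat, 2 / n.+1%:R < e :> R.
    exists (Num.bound (2 / e)); rewrite ltr_pdivrMr // mulrC -ltr_pdivrMr //.
    apply: lt_trans (archi_boundP _) _; first by rewrite divr_ge0 // ltW.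
    by rewrite ltr_nat.
  exists n => i j ni nj; apply: le_lt_trans hn; rewrite -rmorphB /= padic_abs_qp.
  have -> : 2 / n.+1%:R = ratr (2 / n.+1%:R) :> R by rewrite fmorph_div !rmorph_nat.
  rewrite ler_rat.
  have key u v : (n <= u)%N -> (u <= v)%N ->
      padic_norm p (log_sum v x - log_sum u x) <= 2 / n.+1%:R.
    move=> nu uv; apply: le_trans (log_sum_dist p_pr x2 uv) _.
    by rewrite ler_wpM2l // lef_pV2 ?posrE ?ltr0n // ler_nat.
  have [ij|ji] := leqP i j; last by apply: key => //; exact: ltnW.
  by rewrite -padic_normN opprB key.
suff -> : padic_log R (1 + ratr x) = c by [].
apply: padic_logP; congr (padic_cvg R _ c): hc.
apply/funext => n; rewrite /log_sum rmorph_sum /=; apply: eq_bigr => k _.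
rewrite [1 + _]addrC addrK !rmorphM rmorphXn fmorphV rmorph_nat /=.
by rewrite rmorphXn rmorphN rmorph1.
Qed.

Variables (m l : nat) (alpha : 'I_m -> rat) (a : rat).
Hypotheses (a0 : 0 <= a) (a2 : a <= 1 / 2) (alpha_a : forall j, padic_norm p (alpha j) <= a).

Let rem0 : 0 <= pade_remainder m l a. Proof. by rewrite mulr_ge0 ?exprn_ge0. Qed.

(** The limit of [log_sum_pade_padic]: for n large, both 2 / (n + 1) and the distance from
    [log_sum n] to the logarithm are below e. *)
Lemma log_pade_le (mu : nat) j :
  absp (qp_of_rat (pade l alpha 'X^mu).[-1] * padic_log R (1 + ratr (alpha j))
    + qp_of_rat (primp (divdiff (pade l alpha 'X^mu))).[alpha j])
  <= ratr (pade_remainder m l a).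
Proof.
have aj1 : padic_norm p (alpha j) < 1 by apply: le_lt_trans (alpha_a j) (le_lt_trans a2 _).
have /cvgrPdist_lt cv := log_sum_cvg aj1.
set G := (pade l alpha 'X^mu).[-1]; set A := (primp _).[_]; set L := padic_log R _.
apply/ler_addgt0Pr => e e0; have [n0 _ hn0] := cv _ e0.
pose n := (n0 + Num.bound (2 / e))%N.
have hn : 2 / n.+1%:R < e :> R.
  rewrite ltr_pdivrMr // mulrC -ltr_pdivrMr //.
  apply: lt_le_trans (archi_boundP _) _; first by rewrite divr_ge0 // ltW.
  by rewrite ler_nat leqW // leq_addl.
have := hn0 n (leq_addr _ _); rewrite /= sub0r normrN ger0_norm ?padic_abs_ge0 // -/L => hL.
have -> : qp_of_rat G * L + qp_of_rat A =
    - (qp_of_rat G * (qp_of_rat (log_sum n (alpha j)) - L))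
    + qp_of_rat (G * log_sum n (alpha j) + A).
  by rewrite rmorphD rmorphM /= mulrBr opprB addrA subrK.
apply: le_trans (padic_abs_ultra _ _ _) _; rewrite ge_max padic_absN; apply/andP; split.
  rewrite padic_absM padic_abs_qp.
  have G1 : ratr (padic_norm p G) <= 1 :> R.
    rewrite -[leRHS](rmorph1 (@ratr R)) ler_rat /G.
    exact: (@pade_horner_m1_padic p p_pr m l alpha a).
  apply: le_trans (ler_wpM2r (padic_abs_ge0 _ _) G1) _; rewrite mul1r.
  by apply: le_trans (ltW hL) _; rewrite lerDr ler0q.
rewrite padic_abs_qp.
have := @log_sum_pade_padic p p_pr m l alpha a a0 a2 alpha_a n mu j; rewrite -/G -/A le_max.
move=> /orP[h|h]; first by rewrite ler_wpDr ?(ltW e0) // ler_rat.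
apply: (@le_trans _ _ (ratr (2 / n.+1%:R))); first by rewrite ler_rat.
by rewrite fmorph_div !rmorph_nat (le_trans (ltW hn)) // lerDr ler0q.
Qed.

(** The coefficients are integers, of p-adic size at most 1, so by the ultrametric inequality the
    error is no worse than for one logarithm. *)
Lemma Lambda_pade_le (lam : 'I_m.+1 -> int) (mu : nat) :
  absp (qp_of_rat (pade l alpha 'X^mu).[-1] * Lambda R p_pr lam alpha
    - qp_of_rat ((lam ord0)%:~R * (pade l alpha 'X^mu).[-1]
        - \sum_j (lam (lift ord0 j))%:~R * (primp (divdiff (pade l alpha 'X^mu))).[alpha j]))
  <= ratr (pade_remainder m l a).
Proof.
set G := (pade l alpha 'X^mu).[-1]; pose A j := (primp (divdiff (pade l alpha 'X^mu))).[alpha j].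
rewrite -[\sum_j _]/(\sum_j (lam (lift ord0 j))%:~R * A j).
have -> : qp_of_rat G * Lambda R p_pr lam alpha - qp_of_rat ((lam ord0)%:~R * G
     - \sum_j (lam (lift ord0 j))%:~R * A j) =
   \sum_j qp_of_rat (lam (lift ord0 j))%:~R *
     (qp_of_rat G * padic_log R (1 + ratr (alpha j)) + qp_of_rat (A j)).
  rewrite /Lambda mulrDr rmorphB rmorphM rmorph_int opprB rmorph_sum /=.
  rewrite addrC [qp_of_rat G * _%:~R]mulrC subrKA mulr_sumr -big_split /=.
  apply: eq_bigr => j _.
  by rewrite rmorphM !rmorph_int [RHS]mulrDr [LHS]addrC mulrCA.
apply: padic_abs_sum_le; first by rewrite ler0q.
move=> j _; rewrite padic_absM padic_abs_qp.
have l1 : ratr (padic_norm p (lam (lift ord0 j))%:~R) <= 1 :> R.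
  by rewrite -[leRHS](rmorph1 (@ratr R)) ler_rat padic_norm_int ?intr_int.
by apply: le_trans (ler_wpM2r (padic_abs_ge0 _ _) l1) _; rewrite mul1r log_pade_le.
Qed.

End PadicLogarithm.

(** * The linear form *)

Section LinearFormLowerBound.
Variables (R : realType) (p : nat) (p_pr : prime p) (m l : nat).
Variables (lam : 'I_m.+1 -> int) (alpha : 'I_m -> rat) (Q : int) (M a : rat) (H : R).
Hypotheses (l0 : (0 < l)%N) (lam0 : exists i, lam i != 0) (alpha_inj : injective alpha)
  (alpha0 : forall i, alpha i != 0) (Q0 : 0 < Q)
  (Qalpha : forall i, Q%:~R * alpha i \is a Num.int)
  (M1 : 1 < M) (alphaM : forall i, `|alpha i| <= M)
  (a0 : 0 <= a) (a2 : a <= 1 / 2) (alpha_a : forall i, padic_norm p (alpha i) <= a)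
  (lamH : forall i, `|lam i|%:~R <= H).
Let N := (m * l)%N.

Definition linear_form_bound : R :=
  (m%:R + 1) * H * expR (cst1 R * (N + m)%:R) * Q%:~R ^+ (N + m) * ratr (pade_bound m l M).

Lemma linear_form_ge : ratr (pade_remainder m l a) * linear_form_bound < 1 ->
  linear_form_bound^-1 <= padic_abs R (Lambda R p_pr lam alpha).
Proof.
move=> rem1.
have [|mu] := @pade_exists rat m l alpha (fun i => (lam i)%:~R) alpha_inj alpha0.
  by have [i li] := lam0; exists i; rewrite intr_eq0.
have mum : (mu <= m)%N by rewrite -ltnS.
have := @Lambda_pade_le R p p_pr m l alpha a a0 a2 alpha_a lam mu.
have Gp := @pade_horner_m1_padic p p_pr m l alpha a a0 a2 alpha_a mu.
have Gle := pade_horner_m1_le l0 M1 alphaM mum.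
have Ale j := pade_primp_divdiff_le l0 M1 alphaM mum (alphaM j).
have Gint := pade_horner_m1_int l Qalpha mum.
have Aint j := pade_primp_divdiff_int l Qalpha j mum.
move: Gp Gle Ale Gint Aint.
set G := (pade l alpha 'X^mu).[-1]; set S := \sum_j _; set B := pade_bound m l M.
set D : rat := (lcm_upto (m * l + m))%:R => Gp Gle Ale Gint Aint.
set Delta := _ - S => rem_le D0.
(* z is a nonzero integer, so its p-adic size is at least 1 / |z|; the multiplier of Delta is an
   integer and cannot increase that size. *)
pose z := D * Q%:~R ^+ (N + m) * Delta.
have Q0r : 0 < Q%:~R :> rat by rewrite ltr0z.
have Dp : 0 < D by rewrite ltr0n lcm_upto_gt0.
have z0 : z != 0 by rewrite !mulf_neq0 ?expf_neq0 // gt_eqF.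
have [zi ezi] : exists zi : int, z = zi%:~R.
  apply/intrP; rewrite /z /Delta mulrBr rpredB //.
    by rewrite mulrCA rpredM ?intr_int.
  rewrite mulr_sumr; apply: rpred_sum => j _.
  by rewrite mulrCA rpredM ?intr_int // Aint.
have zW : ratr `|z| <= linear_form_bound.
  rewrite /z normrM rmorphM /=.
  have e1 : ratr `|D * Q%:~R ^+ (N + m)| = (lcm_upto (N + m))%:R * Q%:~R ^+ (N + m) :> R.
    by rewrite ger0_norm ?mulr_ge0 ?exprn_ge0 ?ltW // rmorphM rmorphXn /= rmorph_nat ratr_int.
  have h1 : ratr `|Delta| <= (m%:R + 1) * H * ratr B.
    have -> : (m%:R + 1) * H * ratr B = \sum_(i < m.+1) H * ratr B.
      by rewrite sumr_const card_ord -[RHS]mulr_natl -natr1 mulrA.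
    rewrite big_ord_recl; have termH i y : `|y| <= B -> ratr `|(lam i)%:~R * y| <= H * ratr B.
      move=> yB; rewrite normrM rmorphM /= -intr_norm ratr_int.
      by apply: ler_pM; rewrite ?ler0q ?ler0z ?normr_ge0 // ler_rat.
    apply: le_trans (_ : ratr (`|(lam ord0)%:~R * G| + `|S|) <= _).
      by rewrite ler_rat ler_normB.
    rewrite rmorphD /= lerD ?termH //.
    apply: le_trans (_ : ratr (\sum_j `|(lam (lift ord0 j))%:~R *
       (primp (divdiff (pade l alpha 'X^mu))).[alpha j]|) <= _).
      by rewrite ler_rat ler_norm_sum.
    by rewrite rmorph_sum /=; apply: ler_sum => j _; apply: termH.
  rewrite e1; apply: le_trans (ler_wpM2l _ h1) _.
    by rewrite mulr_ge0 ?ler0n ?exprn_ge0 // ler0z ltW.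
  have H0 : 0 <= H by apply: le_trans (lamH ord0); rewrite ler0z.
  have B0 : 0 <= B by apply: le_trans Gle.
  have := lcm_upto_le R (N + m); set E := expR _; set LU := _%:R => hE.
  have -> : LU * Q%:~R ^+ (N + m) * ((m%:R + 1) * H * ratr B) =
    LU * (Q%:~R ^+ (N + m) * ((m%:R + 1) * H * ratr B)) by rewrite -[LHS]mulrA.
  apply: le_trans (ler_wpM2r _ hE) _.
    have Qge : 0 <= Q%:~R :> R by rewrite ler0z ltW.
    apply: mulr_ge0; first exact: exprn_ge0.
    by apply: mulr_ge0; rewrite ?ler0q // mulr_ge0 ?addr_ge0 ?ler0n ?ler01.
  by rewrite /linear_form_bound -/E -/B le_eqVlt; apply/orP; left; apply/eqP; ring.
have W0 : 0 < linear_form_bound by apply: lt_le_trans zW; rewrite ltr0q normr_gt0.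
have Dge : linear_form_bound^-1 <= padic_abs R (qp_of_rat p_pr Delta).
  rewrite padic_abs_qp; apply: (@le_trans _ _ (ratr (padic_norm p z))).
    have zi0 : zi != 0 by move: z0; rewrite ezi intr_eq0.
    apply: (@le_trans _ _ (ratr `|z|^-1)).
      by rewrite fmorphV lef_pV2 ?posrE // ltr0q normr_gt0.
    by rewrite ler_rat ezi padic_norm_int_ge.
  rewrite ler_rat /z padic_normM // ler_piMl ?padic_norm_ge0 // padic_norm_int //.
  by rewrite rpredM ?rpredX ?rpred_nat ?intr_int.
have remD : ratr (pade_remainder m l a) < padic_abs R (qp_of_rat p_pr Delta).
  by apply: lt_le_trans Dge; rewrite -ltr_pdivlMr // div1r in rem1.
apply: le_trans Dge _.
(* Delta is G Lambda minus the remainder, which is smaller than Delta; so Delta is at most G Lambda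
   in size, and G has size at most 1. *)
have := padic_abs_ultra R (qp_of_rat p_pr G * Lambda R p_pr lam alpha)
  (- (qp_of_rat p_pr G * Lambda R p_pr lam alpha - qp_of_rat p_pr Delta)).
rewrite subKr padic_absN le_max => /orP[h|h]; last first.
  by have := lt_le_trans remD (le_trans h rem_le); rewrite ltxx.
apply: le_trans h _; rewrite padic_absM padic_abs_qp ler_piMl ?padic_abs_ge0 //.
by rewrite -[leRHS](rmorph1 (@ratr R)) ler_rat.
Qed.

End LinearFormLowerBound.

(** * Choice of the degree and final constants *)

Section ChoiceOfDegree.
Variable R : realType.

Lemma ln3_ge : 13 / 12 <= ln (3 : R).
Proof.
have := @ln_atanh_ge R (1 / 2) ltac:(lra).
have -> : (1 + 1 / 2) / (1 - 1 / 2) = 3 :> R by field.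
by apply: le_trans; lra.
Qed.

Lemma expR1_ge : 27 / 10 <= expR (1 : R).
Proof.
have := @expR_ge_partial R 1 6 ler01; rewrite !big_nat_recr // big_geq //= add0r.
rewrite !expr1n !factS fact0 !natrM => h.
by apply: le_trans h; lra.
Qed.

Lemma cst3_ge : 11 <= cst3 R.
Proof. by rewrite /cst3 lerDl divr_ge0 ?exprn_ge0 ?ler0n. Qed.

(** Applied with r = R_1, h = log H and L = log f; 13/12 bounds log 3 from below. The last condition
    lets f^l = e^(l L) absorb the factor l. *)
Lemma exists_degree (r h L : R) : 0 < L -> 13 / 12 <= h -> r <= h -> 1 <= r + h ->
  exists l : nat, [/\ (0 < l)%N, l%:R * L < r + 1 + h + cst3 R * ln h + L
    & expR (r + h) * (l%:R * L) < expR (l%:R * L)].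
Proof.
move=> L0 h1 rh rh1.
have h0 : 0 < h by lra.
set u := ln h; have c3 := cst3_ge; set c := cst3 R in c3 *; clearbody c.
have u1 : 1 / 13 <= u.
  have : 1 <= h by lra.
  move/(@ge1_ln_geV R); apply: le_trans.
  have : h^-1 <= 12 / 13 by rewrite -[leRHS]invrK lef_pV2 ?posrE ?invr_gt0 //; lra.
  lra.
set y0 := r + 1 + h + c * u.
have cu : 0 <= c * u by rewrite mulr_ge0 //; lra.
have y01 : 1 <= y0 by rewrite /y0; lra.
(* e^y0 = e^(r + h) e h^c, and y0 <= 2 h + 1 + c ln h. Here 1 + c ln h <= h^c, and 23/13 h <= h^c
   because (c - 1) ln h >= 10/13; finally 1 + 26/23 < 27/10. *)
have yX : expR (r + h) * y0 < expR y0.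
  have -> : y0 = (r + h) + (1 + c * u) by rewrite /y0; ring.
  rewrite [ltRHS]expRD ltr_pM2l ?expR_gt0 // expRD.
  have hu : expR u = h by rewrite lnK // posrE.
  have hc : expR (c * u) = h * expR ((c - 1) * u) by rewrite -hu -expRD; congr expR; ring.
  have g1 : 1 + c * u <= expR (c * u) := expR_ge1Dx _.
  have g2 : 1 + (c - 1) * u <= expR ((c - 1) * u) := expR_ge1Dx _.
  have g3 : 10 / 13 <= (c - 1) * u.
    have : 10 * (1 / 13) <= (c - 1) * u by apply: ler_pM; lra.
    by lra.
  have g4 : h * (23 / 13) <= expR (c * u) by rewrite hc ler_pM2l //; lra.
  have g5 : 27 / 10 * expR (c * u) <= expR 1 * expR (c * u).
    by rewrite ler_pM2r ?expR_gt0 // expR1_ge.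
  lra.
have exl : exists l : nat, y0 <= l%:R * L.
  exists (Num.bound (y0 / L)); rewrite -ler_pdivrMr // ltW //.
  by apply: archi_boundP; rewrite divr_ge0 ?ltW //; lra.
pose l := ex_minn exl; exists l; rewrite /l; case: ex_minnP => {l} -[|l] yl lmin.
  by move: yl; rewrite mul0r; lra.
split => //.
  have : ~~ (y0 <= l%:R * L) by apply/negP => /lmin; rewrite ltnn.
  by rewrite -ltNge -natr1 mulrDl mul1r /y0; lra.
set y := l.+1%:R * L in yl *.
have e1 := expR_ge1Dx (y - y0).
(* Beyond y0 the inequality persists: y / y0 <= 1 + (y - y0) since y0 >= 1. *)
have e2 : y <= y0 * expR (y - y0).
  apply: le_trans (ler_wpM2l _ e1); last by lra.
  have : 0 <= (y0 - 1) * (y - y0) by rewrite mulr_ge0 ?subr_ge0.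
  by lra.
have e3 : expR y = expR y0 * expR (y - y0) by rewrite -expRD; congr expR; ring.
rewrite e3; apply: le_lt_trans (ler_wpM2l (expR_ge0 _) e2) _.
by rewrite mulrA ltr_pM2r ?expR_gt0.
Qed.

End ChoiceOfDegree.

Section FinalBound.
Variables (R : realType) (m : nat) (M q a H P : R).
Hypotheses (m0 : (0 < m)%N) (M1 : 1 < M) (q1 : 1 <= q) (a0 : 0 < a).

Let c := cst1 R.

(* Chosen so that f is 1 / (S a ^ (m + 1)) and real_linear_form_bound l is S ^ l Y. *)
Let S : R := 2 * 3 ^+ m * expR (c * m%:R) * q ^+ m * M ^+ m.
Let Y : R := (m%:R + 1) * H * expR (c * m%:R) * q ^+ m * 2 ^+ m.-1 * (M ^+ m.+1 / (M - 1)).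

Definition real_linear_form_bound l : R :=
  (m%:R + 1) * H * expR (cst1 R * (m * l + m)%:R) * q ^+ (m * l + m)
  * (2 ^+ (l + m).-1 * 3 ^+ (m * l) * M ^+ (m * l) * (M ^+ m.+1 / (M - 1))).

Let M0 : 0 < M. Proof. exact: lt_trans M1. Qed.
Let q0 : 0 < q. Proof. exact: lt_le_trans q1. Qed.
Let M10 : 0 < M - 1. Proof. by rewrite subr_gt0. Qed.
Let mp : 0 < m%:R + 1 :> R. Proof. by rewrite natr1 ltr0n. Qed.

Lemma real_linear_form_boundE l : real_linear_form_bound l = S ^+ l * Y.
Proof.
rewrite /real_linear_form_bound /S /Y !exprMn -!exprM.
have -> : expR (cst1 R * (m * l + m)%:R) = expR (c * m%:R) ^+ l * expR (c * m%:R).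
  by rewrite -expRM_natr -expRD natrD natrM mulrDr mulrA.
have -> : (l + m).-1 = (l + m.-1)%N by lia.
by rewrite !exprD; ring.
Qed.

Lemma S_gt1 : 1 < S.
Proof.
have c0 : 0 <= c by rewrite /c /cst1 addr_ge0 ?ler01 ?divr_ge0 ?exprn_ge0 ?ler0n.
have e1 : 1 <= expR (c * m%:R) by rewrite -expR0 ler_expR mulr_ge0 ?ler0n.
have g1 : 1 <= 3 ^+ m :> R by rewrite exprn_ege1 // ler1n.
have g2 : 1 <= q ^+ m by rewrite exprn_ege1.
have g3 : 1 <= M ^+ m by rewrite exprn_ege1 // ltW.
have le1 x y : 1 <= x -> 1 <= y -> 1 <= x * y :> R.
  by move=> x1 y1; rewrite -[1]mulr1 ler_pM.
have -> : S = 2 * (3 ^+ m * (expR (c * m%:R) * (q ^+ m * M ^+ m))) by rewrite /S; ring.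
by have := le1 _ _ g1 (le1 _ _ e1 (le1 _ _ g2 g3)); set s := _ * (_ * _); lra.
Qed.

Let S0 : 0 < S. Proof. exact: lt_trans S_gt1. Qed.

Lemma fE : f m M q a = (S * a ^+ m.+1)^-1.
Proof. by rewrite /f /S expRN !invfM. Qed.

Lemma ln_fE : ln (f m M q a) = - (ln S + (m%:R + 1) * ln a).
Proof.
have Sa : 0 < S * a ^+ m.+1 by apply: mulr_gt0 => //; exact: exprn_gt0.
rewrite fE lnV ?posrE // lnM ?posrE ?exprn_gt0 //.
by rewrite lnXn // -[ln a *+ _]mulr_natl natr1.
Qed.

Lemma cst2E : cst2 R = 2 * cst1 R.
Proof.
have dbl (x y z : R) : y = 2 * x -> 2 + y / z = 2 * (1 + x / z) by move=> ->; ring.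
exact: dbl (natrM R 2 3883).
Qed.

Lemma padic_lower_bound :
  let F := f m M q a in
  let E := (m%:R + 1) * ln a / ln F in
  1 < F ->
  - (1 / (expR (R1 m M q a) * H)) =
    - ln F / (2 ^+ m.-1 * expR (cst1 R * m%:R) * q ^+ m * H
              * (M ^+ m.+1 / (M - 1)) * ((m%:R + 1) * (m%:R + 2)) * a) ->
  - ln F / (2 ^+ m.-1 * expR (cst1 R * m%:R) * q ^+ m * H
            * (M ^+ m.+1 / (M - 1)) * ((m%:R + 1) * (m%:R + 2)) * a)
    >= - (1 / expR 1) ->
  H >= Num.max 3 (expR (R1 m M q a)) ->
  (forall l, (0 < l)%N ->
    (m.+1 * l).+1%:R * a ^+ (m.+1 * l).+1 * real_linear_form_bound l < 1 ->
    (real_linear_form_bound l)^-1 <= P) ->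
  c1 m M q a * H `^ (E + cst3 R * (1 + E) * (ln (ln H) / ln H)) < P.
Proof.
move=> F E F1; set Z := _ * a; rewrite /c1 -/F.
set r := R1 m M q a => eqZ; rewrite -eqZ => geZ; clearbody r.
rewrite ge_max => /andP[H3 Hr] hP.
have H0 : 0 < H by apply: lt_le_trans H3.
have F0 : 0 < F := lt_trans ltr01 F1.
pose L := ln F; rewrite -/L in eqZ *; have L0 : 0 < L by rewrite ln_gt0.
pose h := ln H; rewrite -/h.
have eh : expR h = H by rewrite lnK ?posrE.
have h1 : 13 / 12 <= h.
  by apply: le_trans (ln3_ge R) _; rewrite ler_ln ?posrE.
have h0 : 0 < h by lra.
have rh : r <= h by rewrite -ler_expR eh.
have rh1 : 1 <= r + h.
  rewrite -ler_expR expRD eh; move: geZ; rewrite lerN2 !div1r lef_pV2 ?posrE ?expR_gt0 //.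
  by rewrite mulr_gt0 ?expR_gt0.
have Y0 : 0 < Y by rewrite /Y !mulr_gt0 ?invr_gt0 ?exprn_gt0 ?expR_gt0.
have ZY : Z = Y * (m%:R + 2) * a by rewrite /Z /Y -/c; ring.
have m2 : 0 < m%:R + 2 :> R by rewrite -natrD ltr0n addn2.
have Z0 : 0 < Z by rewrite ZY; apply: mulr_gt0 => //; exact: mulr_gt0.
(* R_1 is designed for this: (m + 2) a Y, the constant part of remainder times bound, equals log f
   e^(R_1) H, so the condition on l becomes l log f e^(R_1 + log H) < f^l. *)
have {}eqZ : Z = L * expR (r + h).
  have X0 : expR r * H != 0 by rewrite mulf_neq0 ?gt_eqF ?expR_gt0.
  have Zn0 : Z != 0 by rewrite gt_eqF.
  move/eqP: eqZ; rewrite mulNr eqr_opp (eqr_div _ _ X0 Zn0).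
  by rewrite mul1r expRD eh => /eqP.
have [l [l0 lL lX]] := exists_degree L0 h1 rh rh1.
have FL : F ^+ l = expR (l%:R * L) by rewrite expRM_natl lnK // posrE.
have hl : (m.+1 * l).+1%:R * a ^+ (m.+1 * l).+1 * real_linear_form_bound l < 1.
  rewrite real_linear_form_boundE.
  have -> : (m.+1 * l).+1%:R * a ^+ (m.+1 * l).+1 * (S ^+ l * Y) =
     (m.+1 * l).+1%:R * (a * Y / F ^+ l).
    rewrite /F fE exprVn invrK (exprMn l S (a ^+ m.+1)) -exprM [a ^+ _.+1]exprS.
    by move: (S ^+ l) Y => s y; ring.
  apply: (@le_lt_trans _ _ (((m%:R + 2) * l%:R) * (a * Y / F ^+ l))).
    rewrite ler_pM2r; last by apply: divr_gt0; [exact: mulr_gt0 | exact: exprn_gt0].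
    have -> : m%:R + 2 = (m + 2)%:R :> R by rewrite natrD.
    rewrite -natrM ler_nat mulSn mulnDl; move: l0; clear; move: (m * l)%N => *; lia.
  have -> : (m%:R + 2) * l%:R * (a * Y / F ^+ l) = l%:R * Z / F ^+ l by rewrite ZY; ring.
  rewrite ltr_pdivrMr ?mul1r; last exact: exprn_gt0.
  rewrite eqZ FL; apply: le_lt_trans lX; apply: le_of_eq.
  by rewrite mulrA [RHS]mulrC.
apply: lt_le_trans (hP l l0 hl); rewrite real_linear_form_boundE.
have s0 : 0 < ln S by rewrite ln_gt0 // S_gt1.
have E1 : 1 + E = - (ln S / L).
  rewrite /E -/L; have -> : (m%:R + 1) * ln a = - L - ln S by rewrite /L /F ln_fE; ring.
  by move: (ln S) => t; field; rewrite gt_eqF.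
have -> : H `^ (E + cst3 R * (1 + E) * (ln h / h)) =
    expR (- h) * expR ((1 + E) * (h + cst3 R * ln h)).
  rewrite /powR gt_eqF // -/h -expRD; congr expR.
  by field; rewrite gt_eqF.
(* The factor S next to Y pays for rounding l up, that is, for the last L in [lL]. *)
have -> : (M - 1) / (6 ^+ m * (m%:R + 1) * expR (cst2 R * m%:R) * q ^+ (2 * m) * M ^+ (2 * m + 1)) =
    H / (S * Y).
  have e2 : expR (cst2 R * m%:R) = expR (c * m%:R) * expR (c * m%:R).
    by rewrite -expRD cst2E -/c; congr expR; ring.
  have e6 : 6 ^+ m = 3 ^+ m * (2 * 2 ^+ m.-1) :> R.
    by rewrite -exprS prednK // -exprMn -natrM.
  rewrite /S /Y e2 e6 mul2n -addnn addn1 [M ^+ _.+1]exprS !exprD.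
  have Mm : M ^+ m.+1 = M * M ^+ m by rewrite exprS.
  rewrite Mm; have en := expR_gt0 (c * m%:R).
  have := exprn_gt0 m M0; have := exprn_gt0 m q0.
  set x1 := M ^+ m; set x2 := q ^+ m; set x3 := expR _ in en *.
  have : 0 < 3 ^+ m :> R by rewrite exprn_gt0.
  have : 0 < 2 ^+ m.-1 :> R by rewrite exprn_gt0.
  set x4 := 2 ^+ m.-1; set x5 := 3 ^+ m => p4 p5 p2 p1.
  by field; rewrite !gt_eqF.
rewrite -/E [E + 1]addrC expRN eh.
have -> : H / (S * Y) * expR ((1 + E) * (r + 1)) * (H^-1 * expR ((1 + E) * (h + cst3 R * ln h)))
   = expR ((1 + E) * (r + 1 + h + cst3 R * ln h)) / (S * Y).
  have -> : (1 + E) * (r + 1 + h + cst3 R * ln h) =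
    (1 + E) * (r + 1) + (1 + E) * (h + cst3 R * ln h) by ring.
  rewrite expRD; field; by rewrite !gt_eqF.
have p1 : 0 < S ^+ l * Y by apply: mulr_gt0 => //; exact: exprn_gt0.
have p2 t : 0 < expR t * (S * Y) by apply: mulr_gt0; [exact: expR_gt0 | exact: mulr_gt0].
rewrite E1 mulNr expRN -invfM ltf_pV2 ?posrE //.
rewrite [expR _ * (S * Y)]mulrA (ltr_pM2r Y0).
have -> : S ^+ l = expR (l%:R * ln S) by rewrite expRM_natl lnK // posrE.
have eS : S = expR (ln S) by rewrite lnK // posrE.
rewrite [X in _ < _ * X]eS.
rewrite -expRD ltr_expR.
have -> : l%:R * ln S = ln S / L * (l%:R * L) by field; rewrite gt_eqF.
have eL : ln S = ln S / L * L by rewrite divfK ?gt_eqF.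
by rewrite [X in _ < _ + X]eL -mulrDr ltr_pM2l // divr_gt0.
Qed.

End FinalBound.

Lemma ratr_bigmax (R : realType) (I : finType) (f : I -> rat) :
  ratr (\big[Num.max/0]_i f i) = \big[Num.max/0]_i (ratr (f i) : R).
Proof.
apply: (big_morph (@ratr R)); last exact: rmorph0.
by move=> x y; rewrite !maxElt ltr_rat; case: ifP.
Qed.

Theorem corollary2p2 (R : realType) (p : nat) (p_pr : prime p) (m : nat)
    (lam : 'I_m.+1 -> int) (alpha : 'I_m -> rat) (Q : int) :
  let M : R := max_abs R alpha in
  let a : R := max_padic_norm R p alpha in
  let H : R := height R lam in
  let q : R := Q%:~R in
  let F : R := f m M q a in
  let E : R := (m%:R + 1) * ln a / ln F in
  (1 <= m)%N ->
  (exists i, lam i != 0) ->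
  injective alpha ->
  (forall i, alpha i != 0) ->
  0 < Q ->
  (forall i, Q%:~R * alpha i \is a Num.int) ->
  1 < M ->
  a < 1 ->
  1 < H ->
  1 < F ->
  - (1 / (expR (R1 m M q a) * H)) =
    - ln F / (2 ^+ m.-1 * expR (cst1 R * m%:R) * q ^+ m * H
              * (M ^+ m.+1 / (M - 1)) * ((m%:R + 1) * (m%:R + 2)) * a) ->
  - ln F / (2 ^+ m.-1 * expR (cst1 R * m%:R) * q ^+ m * H
            * (M ^+ m.+1 / (M - 1)) * ((m%:R + 1) * (m%:R + 2)) * a)
    >= - (1 / expR 1) ->
  H >= Num.max 3 (expR (R1 m M q a)) ->
  padic_abs R (Lambda R p_pr lam alpha) >
    c1 m M q a * H `^ (E + cst3 R * (1 + E) * (ln (ln H) / ln H)).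
Proof.
move=> M a H q F E m0 lam0 inj alpha0 Q0 Qalpha M1 a1 H1 F1 eqZ geZ HR.
(* The estimates for the approximations hold over [rat], so the real maxima are first recognised as
   images of rational ones. *)
pose Mq : rat := \big[Num.max/0]_i `|alpha i|.
pose aq : rat := \big[Num.max/0]_i padic_norm p (alpha i).
have eM : M = ratr Mq by rewrite ratr_bigmax.
have ea : a = ratr aq by rewrite ratr_bigmax.
have one : 1 = ratr 1 :> R by rewrite rmorph1.
have M1q : 1 < Mq by move: M1; rewrite eM one ltr_rat.
have a1q : aq < 1 by move: a1; rewrite ea one ltr_rat.
have alphaM i : `|alpha i| <= Mq by exact: le_bigmax.
have alpha_a i : padic_norm p (alpha i) <= aq.
  by apply: (le_bigmax _ (fun i => padic_norm p (alpha i))).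
have aq0 : 0 < aq.
  apply: lt_le_trans (alpha_a (Ordinal m0)).
  by rewrite lt_neqAle eq_sym padic_norm_eq0 // alpha0 padic_norm_ge0.
have aq2 : aq <= 1 / 2.
  apply: bigmax_le => // i _; apply: padic_norm_lt1 => //.
  exact: le_lt_trans (alpha_a i) a1q.
have lamH i : `|lam i|%:~R <= H by apply: (le_bigmax _ (fun i => `|lam i|%:~R : R)).
have q1 : 1 <= q by rewrite ler1z -gtz0_ge1.
have a0 : 0 < a by rewrite ea ltr0q.
apply: (padic_lower_bound m0 M1 q1 a0 F1 eqZ geZ HR) => l l0.
have -> : real_linear_form_bound m M q H l = linear_form_bound m l Q Mq H.
  rewrite /real_linear_form_bound /linear_form_bound /pade_bound eM.
  by rewrite !rmorphM fmorphV rmorphB !rmorphXn /= rmorph1 !rmorph_nat.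
have -> : (m.+1 * l).+1%:R * a ^+ (m.+1 * l).+1 = ratr (pade_remainder m l aq).
  by rewrite /pade_remainder rmorphM rmorphXn /= rmorph_nat ea.
by apply: (@linear_form_ge R p p_pr m l lam alpha Q Mq aq H) => //; exact: ltW.
Qed.
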